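(* Let $I\subset\mathbb{R}$ be a bounded open interval of length $l(I)$. Consider the Laplace operator $\Delta u=u''$ as $$\Delta:H^2_0(I)\subset L^2_{loc}(I)\longrightarrow L^2_{loc}(I),$$ its adjoint $\Delta^{*}:D(\Delta^{*})\subset L^2_c(I)\to L^2_c(I)$, its closure $\overline{\Delta}$ in $L^2_{loc}(I)$, and the operator $$\Delta_{L^2}: H^1_0(I)\cap H^2(I)\subset L^2_{loc}(I)\longrightarrow L^2_{loc}(I),\qquad \Delta_{L^2}u=u''.$$ Then $$\sigma_c(\Delta)=\sigma_r(\Delta^{*})=\sigma_p(\overline{\Delta})=\mathbb{C}\qquad\text{and}\qquad \sigma_c(\Delta_{L^2})=\mathbb{C}\setminus\left\{-\frac{\pi^2n^2}{l(I)^2}: n\in\mathbb{N}\right\}.$$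
   Context: Functions are complex valued and $\mathbb{N}=\{1,2,3,\dots\}$. $L^2_{loc}(I)=H^0_{loc}(I)$ is the Fréchet space of locally square integrable functions on $I$, with seminorms $u\mapsto\|\varphi_j u\|_{L^2(\mathbb{R})}$, where $I_j=(a_j,b_j)$, $[a_j,b_j]\subset(a_{j+1},b_{j+1})$, $I=\bigcup_j[a_j,b_j]$, $\varphi_j\in C_c^\infty(I_{j+1})$ and $\varphi_j=1$ on $[a_j,b_j]$. The domains of $\Delta$, $\Delta_{L^2}$ and $\overline{\Delta}$ carry the topology induced from $L^2_{loc}(I)$. $H^k_0(I)$ is the closure of $C_c^\infty(I)$ in the usual Sobolev space $H^k(I)$. $L^2_c(I)$ is the space of $L^2$ functions with compact support in $I$. It is identified with the dual of $L^2_{loc}(I)$ via $\langle g,u\rangle=\int_I gu\,dx$ and equipped with the weak* topology. $D(\Delta^* )$ is the set of $g\in L^2_c(I)$ such that $u\mapsto\langle g,u''\rangle$, $u\in H^2_0(I)$, is continuous for the topology induced by $L^2_{loc}(I)$. For such $g$, $\Delta^*g\in L^2_c(I)$ represents the unique continuous extension of this functional to $L^2_{loc}(I)$. The closure $\overline{A}$ of a closable operator $A$ is the operator whose graph is the closure of the graph of $A$. For a linear operator $A:D(A)\subset X\to X$, where $X$ is either $L^2_{loc}(I)$ with its Fréchet topology or $L^2_c(I)$ with the weak* topology, $\sigma_p(A)$ is the set of $\lambda\in\mathbb{C}$ with $\lambda-A$ not injective. $\sigma_r(A)$ is the set of $\lambda$ with $\lambda-A$ injective and $\overline{R(\lambda-A)}\neq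 X$. $\sigma_c(A)$ is the set of $\lambda$ with $\lambda-A$ injective, $\overline{R(\lambda-A)}=X$, and $(\lambda-A)^{-1}:R(\lambda-A)\to X$ not continuous. Here $R(\cdot)$ denotes the range. *)

(* Defs.v *)
From HB Require Import structures.
From mathcomp Require Import all_boot all_order all_algebra.
From mathcomp Require Import complex ring lra.
From mathcomp Require Import all_classical all_reals all_analysis.
From mathcomp Require Import measurable_realfun.

Set Implicit Arguments.
Unset Strict Implicit.
Unset Printing Implicit Defensive.

Import Order.TTheory GRing.Theory Num.Theory.
Import numFieldNormedType.Exports.

Local Open Scope classical_set_scope.
Local Open Scope ring_scope.
Local Open Scope complex_scope.

(* An operator D(A) -> X with D(A) a subset of X is represented by its graph, a
   subset of X * X; the closure of a closable operator is then the topological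
   closure of its graph. *)
Section spectra.
Context {K : numFieldType} {X : preTopologicalLmodType K}.
Implicit Types (A G : set (X * X)) (l : K).

Definition graph_of (D : set X) (f : X -> X) : set (X * X) :=
  [set (u, f u) | u in D].

(* The graph of l - A. *)
Definition shift l A : set (X * X) := [set (p.1, l *: p.1 - p.2) | p in A].

Definition op_injective G := forall u v w, G (u, w) -> G (v, w) -> u = v.

Definition op_range G : set X := snd @` G.

Definition op_inverse_continuous G :=
  exists2 f : X -> X, (forall u w, G (u, w) -> f w = u) &
    {within op_range G, continuous f}.

Definition point_spectrum A : set K := [set l | ~ op_injective (shift l A)].

Definition residual_spectrum A : set K :=
  [set l | op_injective (shift l A) /\ closure (op_range (shift l A)) <> setT].

Definition continuous_spectrum A : set K :=
  [set l | [/\ op_injective (shift l A),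
               closure (op_range (shift l A)) = setT &
               ~ op_inverse_continuous (shift l A)]].

End spectra.

Section complex_functions.
Context {R : realType}.
Local Notation mu := (@lebesgue_measure R).
Implicit Types (f g : R -> R[i]) (D : set R) (a b : R).

Definition sqnormc (z : R[i]) : R := complex.Re z ^+ 2 + complex.Im z ^+ 2.

Definition cmeasurable D f :=
  measurable_fun D (fun x => complex.Re (f x)) /\
  measurable_fun D (fun x => complex.Im (f x)).

Definition cintegral D f : R[i] :=
  (\int[mu]_(x in D) complex.Re (f x)) +i* (\int[mu]_(x in D) complex.Im (f x)).

Definition sqL2norm D f : \bar R := (\int[mu]_(x in D) (sqnormc (f x))%:E)%E.

Definition L2norm D f : \bar R := (sqL2norm D f `^ 2^-1)%E.

Definition cderive n f (x : R) : R[i] :=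
  derive1n n (fun y => complex.Re (f y)) x
    +i* derive1n n (fun y => complex.Im (f y)) x.

Definition csmooth f := forall n x,
  derivable (derive1n n (fun y => complex.Re (f y))) x 1 /\
  derivable (derive1n n (fun y => complex.Im (f y))) x 1.

Definition test_function a b f :=
  [/\ csmooth f, compact (closure [set x | f x != 0]) &
      closure [set x | f x != 0] `<=` `]a, b[].

End complex_functions.

(* A sequence of cutoffs adapted to an exhaustion of `]a, b[ *)
Record exhaustion {R : realType} (a b : R) := Exhaustion {
  lo : nat -> R;
  hi : nat -> R;
  cutoff : nat -> R -> R[i];
  lo_lt_hi : forall j, lo j < hi j;
  exhaustion_incr : forall j,
    [set` `[lo j, hi j]] `<=` [set` `]lo j.+1, hi j.+1[ ];
  exhaustion_cover : \bigcup_j [set` `[lo j, hi j]] = [set` `]a, b[ ];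
  cutoff_test : forall j, test_function (lo j.+1) (hi j.+1) (cutoff j);
  cutoff1 : forall j x, x \in `[lo j, hi j] -> cutoff j x = 1 }.

Section L2loc_fun.
Context {R : realType}.
Variables a b : R.
Local Notation mu := (@lebesgue_measure R).
Local Notation I := [set` `]a, b[ ].

Definition locally_square_integrable : {pred R -> R[i]} :=
  mem [set f : R -> R[i] | cmeasurable I f /\
    forall K, compact K -> K `<=` I -> (sqL2norm K f < +oo)%E].

Record L2loc_fun := L2locFun {
  L2loc_val :> R -> R[i];
  L2loc_valP : L2loc_val \in locally_square_integrable }.

HB.instance Definition _ := [isSub for L2loc_val].
HB.instance Definition _ := gen_eqMixin L2loc_fun.
HB.instance Definition _ := gen_choiceMixin L2loc_fun.

Lemma sqnormc_ge0 (z : R[i]) : 0 <= sqnormc z.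
Proof. by rewrite addr_ge0// sqr_ge0. Qed.

Lemma sqnormcZ (c z : R[i]) : sqnormc (c * z) = sqnormc c * sqnormc z.
Proof. by case: c z => [? ?] [? ?]; rewrite /sqnormc/=; ring. Qed.

Lemma sqnormcD (z t : R[i]) :
  sqnormc (z + t) <= 2 * (sqnormc z + sqnormc t).
Proof.
case: z t => [x y] [u v]; rewrite /sqnormc/=.
have := sqr_ge0 (x - u); have := sqr_ge0 (y - v); nra.
Qed.

Lemma cmeasurable_sqnormc D (f : R -> R[i]) : cmeasurable D f ->
  measurable_fun D (fun x => (sqnormc (f x))%:E).
Proof.
move=> [mr mi]; apply/measurable_EFinP; rewrite /sqnormc.
by apply: measurable_funD; exact: measurable_funX.
Qed.

Lemma cmeasurable0 D : cmeasurable D (0 : R -> R[i]).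
Proof. by split; exact: measurable_cst. Qed.

Lemma cmeasurable_lin D (c : R[i]) (f g : R -> R[i]) :
  cmeasurable D f -> cmeasurable D g -> cmeasurable D (c *: f + g).
Proof.
case: c => x y [fr fi] [gr gi]; split.
  rewrite [X in measurable_fun _ X](_ : _ = fun t =>
    x * complex.Re (f t) - y * complex.Im (f t) + complex.Re (g t)).
    by apply: measurable_funD => //; apply: measurable_funB;
       apply: measurable_funM => //; exact: measurable_cst.
  apply/funext => t; rewrite -[(_ + _) t]/(_ *: f t + g t).
  by case: (f t) (g t) => [? ?] [? ?].
rewrite [X in measurable_fun _ X](_ : _ = fun t =>
    x * complex.Im (f t) + y * complex.Re (f t) + complex.Im (g t)).
  by apply: measurable_funD => //; apply: measurable_funD;
     apply: measurable_funM => //; exact: measurable_cst.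
apply/funext => t; rewrite -[(_ + _) t]/(_ *: f t + g t).
by case: (f t) (g t) => [? ?] [? ?].
Qed.

Lemma locally_square_integrable_submod :
  submod_closed locally_square_integrable.
Proof.
split.
  rewrite inE; split; first exact: cmeasurable0.
  move=> K _ _; rewrite /sqL2norm integral0_eq ?ltry// => x _.
  by rewrite /sqnormc/= !expr0n/= addr0.
move=> c f g; rewrite !inE => -[mf fK] [mg gK].
have mh := cmeasurable_lin c mf mg; split => // K cK KI.
have mK : measurable K by apply: closed_measurable; exact: compact_closed cK.
have mKF (h : R -> R[i]) : cmeasurable I h ->
    measurable_fun K (fun x => (sqnormc (h x))%:E).
  by move=> mh'; apply: (@measurable_funS _ _ _ _ I) => //;
     exact: cmeasurable_sqnormc.
have le2 : (sqL2norm K (c *: f + g)%R <=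
    \int[mu]_(x in K) ((2 * sqnormc c)%:E * (sqnormc (f x))%:E
      + 2%:E * (sqnormc (g x))%:E))%E.
  apply: ge0_le_integral => //.
  - by move=> x _; rewrite lee_fin sqnormc_ge0.
  - exact: mKF.
  - by apply: emeasurable_funD; apply: emeasurable_funM => //;
      first exact: mKF; exact: mKF.
  - move=> x _; rewrite -!EFinM -EFinD lee_fin.
    rewrite -[X in sqnormc X]/(c * f x + g x).
    by apply: (le_trans (sqnormcD _ _)); rewrite sqnormcZ; nra.
apply: (le_lt_trans le2).
have s0 := @sqnormc_ge0.
rewrite ge0_integralD//; last first.
- by apply: emeasurable_funM => //; exact: mKF.
- by move=> x _; rewrite mule_ge0// lee_fin.
- by apply: emeasurable_funM => //; exact: mKF.
- by move=> x _; rewrite mule_ge0// lee_fin ?mulr_ge0.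
rewrite !ge0_integralZl//; try exact: mKF; try by move=> *; rewrite lee_fin ?mulr_ge0.
by rewrite lte_add_pinfty// lte_mul_pinfty//; (rewrite lee_fin ?mulr_ge0//) || (exact: fK) || exact: gK.
Qed.

HB.instance Definition _ := GRing.isSubmodClosed.Build _ _
  locally_square_integrable locally_square_integrable_submod.
HB.instance Definition _ := [SubChoice_isSubLmodule of L2loc_fun by <:].

Definition eq_ae_on (f g : L2loc_fun) :=
  `[< (f : R -> R[i]) = g %[ae mu in I] >].

Lemma eq_ae_on_refl : reflexive eq_ae_on.
Proof. by move=> f; apply/asboolP; exact: ae_eq_refl. Qed.

Lemma eq_ae_on_sym : symmetric eq_ae_on.
Proof. by move=> f g; apply/asboolP/asboolP; exact: ae_eq_sym. Qed.

Lemma eq_ae_on_trans : transitive eq_ae_on.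
Proof.
by move=> f g h /asboolP gf /asboolP fh; apply/asboolP; exact: ae_eq_trans gf fh.
Qed.

Canonical eq_ae_on_equiv :=
  EquivRel eq_ae_on eq_ae_on_refl eq_ae_on_sym eq_ae_on_trans.

End L2loc_fun.

Local Open Scope quotient_scope.

Section L2loc.
Context {R : realType} {a b : R}.
Variable E : exhaustion a b.
Local Notation mu := (@lebesgue_measure R).
Local Notation I := [set` `]a, b[ ].

(* The exhaustion only serves to define the seminorms below. *)
Definition L2loc : Type := let _ := E in {eq_quot @eq_ae_on R a b}.
HB.instance Definition _ := Choice.on L2loc.
HB.instance Definition _ := EqQuotient.on L2loc.

Let ae_filter := ae_filter_ringOfSetsType mu.

Definition L2loc_to_fun (u : L2loc) : R -> R[i] := repr u.
Coercion L2loc_to_fun : L2loc >-> Funclass.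

Definition L2loc_add (u v : L2loc) : L2loc := \pi_L2loc (repr u + repr v).
Definition L2loc_scale (c : R[i]) (u : L2loc) : L2loc := \pi_L2loc (c *: repr u).
Definition L2loc_opp (u : L2loc) : L2loc := \pi_L2loc (- repr u).

Lemma pi_L2locP (f g : L2loc_fun a b) :
  \pi_L2loc f = \pi_L2loc g <-> (f : R -> R[i]) = g %[ae mu in I].
Proof.
split=> [/eqmodP/asboolP //|fg].
by apply/eqmodP/asboolP.
Qed.

Lemma repr_pi_L2loc (f : L2loc_fun a b) :
  (repr (\pi_L2loc f) : R -> R[i]) = f %[ae mu in I].
Proof. by apply/pi_L2locP; rewrite reprK. Qed.

Lemma pi_L2loc_add (f g : L2loc_fun a b) :
  \pi_L2loc (f + g) = L2loc_add (\pi_L2loc f) (\pi_L2loc g).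
Proof.
apply/esym/pi_L2locP.
move: (repr_pi_L2loc f) (repr_pi_L2loc g); apply: (@filterS2 _ _ ae_filter) => x hf hg Ix.
by rewrite -[LHS]/(repr (\pi_L2loc f) x + repr (\pi_L2loc g) x) hf// hg.
Qed.

Lemma pi_L2loc_scale c (f : L2loc_fun a b) :
  \pi_L2loc (c *: f) = L2loc_scale c (\pi_L2loc f).
Proof.
apply/esym/pi_L2locP.
move: (repr_pi_L2loc f); apply: (@filterS _ _ ae_filter) => x hf Ix.
by rewrite -[LHS]/(c *: repr (\pi_L2loc f) x) hf.
Qed.

Lemma pi_L2loc_opp (f : L2loc_fun a b) : \pi_L2loc (- f) = L2loc_opp (\pi_L2loc f).
Proof.
apply/esym/pi_L2locP.
move: (repr_pi_L2loc f); apply: (@filterS _ _ ae_filter) => x hf Ix.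
by rewrite -[LHS]/(- repr (\pi_L2loc f) x) hf.
Qed.

Lemma L2loc_addA : associative L2loc_add.
Proof.
move=> u v w; elim/quotW: u => f; elim/quotW: v => g; elim/quotW: w => h.
by rewrite -(pi_L2loc_add g h) -(pi_L2loc_add f (g + h))
  -(pi_L2loc_add f g) -(pi_L2loc_add (f + g) h) addrA.
Qed.

Lemma L2loc_addC : commutative L2loc_add.
Proof.
move=> u v; elim/quotW: u => f; elim/quotW: v => g.
by rewrite -(pi_L2loc_add f g) -(pi_L2loc_add g f) addrC.
Qed.

Lemma L2loc_add0 : left_id (\pi_L2loc 0) L2loc_add.
Proof. by move=> u; elim/quotW: u => f; rewrite -(pi_L2loc_add 0 f) add0r. Qed.

Lemma L2loc_addN : left_inverse (\pi_L2loc 0) L2loc_opp L2loc_add.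
Proof.
move=> u; elim/quotW: u => f.
by rewrite -(pi_L2loc_opp f) -(pi_L2loc_add (- f) f) addNr.
Qed.

HB.instance Definition _ := GRing.isZmodule.Build L2loc
  L2loc_addA L2loc_addC L2loc_add0 L2loc_addN.

Lemma L2loc_scaleA c d (u : L2loc) :
  L2loc_scale c (L2loc_scale d u) = L2loc_scale (c * d) u.
Proof.
elim/quotW: u => f.
by rewrite -(pi_L2loc_scale d f) -(pi_L2loc_scale c (d *: f))
  -(pi_L2loc_scale (c * d) f) scalerA.
Qed.

Lemma L2loc_scale1 : left_id 1 L2loc_scale.
Proof.
by move=> u; elim/quotW: u => f; rewrite -(pi_L2loc_scale 1 f) scale1r.
Qed.

Lemma L2loc_scaleDr : right_distributive L2loc_scale +%R.
Proof.
move=> c u v; elim/quotW: u => f; elim/quotW: v => g.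
rewrite -[X in L2loc_scale c X]/(L2loc_add _ _) -[RHS]/(L2loc_add _ _).
by rewrite -(pi_L2loc_add f g) -(pi_L2loc_scale c (f + g))
  -(pi_L2loc_scale c f) -(pi_L2loc_scale c g)
  -(pi_L2loc_add (c *: f) (c *: g)) scalerDr.
Qed.

Lemma L2loc_scaleDl (u : L2loc) :
  {morph L2loc_scale^~ u : c d / c + d >-> c + d}.
Proof.
elim/quotW: u => f c d /=; rewrite -[RHS]/(L2loc_add _ _).
by rewrite -(pi_L2loc_scale (c + d) f) -(pi_L2loc_scale c f)
  -(pi_L2loc_scale d f) -(pi_L2loc_add (c *: f) (d *: f)) scalerDl.
Qed.

HB.instance Definition _ := GRing.Zmodule_isLmodule.Build R[i] L2loc
  L2loc_scaleA L2loc_scale1 L2loc_scaleDr L2loc_scaleDl.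

Definition seminorm (j : nat) (u : L2loc) : \bar R :=
  L2norm setT (fun x => cutoff E j x * u x).

(* The topology generated by the seminorms: basic neighbourhoods are the finite
   intersections of balls, of a common radius. *)
Definition L2loc_open (U : set L2loc) : Prop :=
  forall u, U u -> exists n (e : R), 0 < e /\
    [set v | forall j, (j <= n)%N -> (seminorm j (v - u)%R < e%:E)%E] `<=` U.

Lemma L2loc_openT : L2loc_open setT.
Proof. by move=> u _; exists 0%N, 1; split. Qed.

Lemma L2loc_openI : setI_closed L2loc_open.
Proof.
move=> U V oU oV u [/oU[n [e [e0 nU]]] /oV[m [d [d0 mV]]]].
exists (maxn n m), (Num.min e d); split; first by rewrite lt_min e0 d0.
move=> v vnm; split; [apply: nU|apply: mV] => j jn.
- rewrite (lt_le_trans (vnm j _)) ?lee_fin ?ge_min ?lexx//.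
  by rewrite leq_max jn.
- rewrite (lt_le_trans (vnm j _)) ?lee_fin ?ge_min ?lexx ?orbT//.
  by rewrite leq_max jn orbT.
Qed.

Lemma L2loc_open_bigU (T : Type) (U : T -> set L2loc) :
  (forall i, L2loc_open (U i)) -> L2loc_open (\bigcup_i U i).
Proof.
move=> oU u [i _ /oU[n [e [e0 nU]]]]; exists n, e; split => // v /nU Uv.
by exists i.
Qed.

HB.instance Definition _ := isOpenTopological.Build L2loc
  L2loc_openT L2loc_openI L2loc_open_bigU.

(* On a compact subset of I local square integrability gives square
   integrability, so only the support has to be constrained. *)
Definition compactly_supported : {pred L2loc} := mem [set u : L2loc |
  exists K, [/\ compact K, K `<=` I &
    (u : R -> R[i]) = cst 0 %[ae mu in I `\` K] ]].

Record L2c := L2cMk {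
  L2c_val :> L2loc;
  L2c_valP : L2c_val \in compactly_supported }.

HB.instance Definition _ := [isSub for L2c_val].
HB.instance Definition _ := [Choice of L2c by <:].

Lemma compactly_supported_submod : submod_closed compactly_supported.
Proof.
split.
  rewrite inE; exists set0; split => //; first exact: compact0.
  have := repr_pi_L2loc 0; apply: (@filterS _ _ ae_filter) => x h [Ix _].
  by rewrite /L2loc_to_fun h.
move=> c u v /[!inE] -[K [cK KI uK]] -[L [cL LI vL]].
exists (K `|` L); split; first exact: compactU.
  by move=> x [/KI|/LI].
have hs := repr_pi_L2loc (c *: repr u).
have hD := repr_pi_L2loc (repr (c *: u) + repr v).
move: uK vL (@filterI _ _ ae_filter _ _ hs hD); apply: (@filterS3 _ _ ae_filter) => x ux vx [sx Dx] [Ix KLx].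
have {}ux : repr u x = 0 by apply: ux; split => // Kx; apply: KLx; left.
have {}vx : repr v x = 0 by apply: vx; split => // Lx; apply: KLx; right.
rewrite -[LHS]/(repr (\pi_L2loc (repr (c *: u) + repr v)) x) Dx//.
rewrite -[LHS]/(repr (c *: u) x + repr v x) vx addr0.
rewrite -[LHS]/(repr (\pi_L2loc (c *: repr u)) x) sx//.
by rewrite -[LHS]/(c *: repr u x) ux scaler0.
Qed.

HB.instance Definition _ := GRing.isSubmodClosed.Build _ _
  compactly_supported compactly_supported_submod.
HB.instance Definition _ := [SubChoice_isSubLmodule of L2c by <:].

(* No complex conjugation: the pairing is bilinear. *)
Definition pairing (g u : L2loc) : R[i] := cintegral I (fun x => g x * u x).

(* The weak* topology on L2c is that of pointwise convergence on L2loc. *)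
Definition weak_star_embedding (g : L2c) : {ptws L2loc -> R[i]^o} :=
  fun u => pairing g u.

HB.instance Definition _ :=
  Topological.copy L2c (initial_topology weak_star_embedding).

Definition square_integrable : set L2loc :=
  [set u | (sqL2norm I u < +oo)%E].

(* The classes of the test functions, i.e. C_c^oo(I) as a subspace of L2loc. *)
Definition test_functions : set L2loc :=
  [set w | exists2 phi, test_function a b phi &
    (w : R -> R[i]) = phi %[ae mu in I]].

Definition is_weak_derivative (k : nat) (u v : L2loc) := forall phi,
  test_function a b phi ->
  cintegral I (fun x => u x * cderive k phi x) =
  (-1) ^+ k * cintegral I (fun x => v x * phi x).

(* The k-th weak derivative of u; it is 0 if u has none in L2loc. *)
Definition weak_derivative (k : nat) (u : L2loc) : L2loc :=
  xget 0 [set v | is_weak_derivative k u v].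

Definition sobolev (k : nat) : set L2loc :=
  [set u | forall j, (j <= k)%N ->
    exists2 v, square_integrable v & is_weak_derivative j u v].

Definition sobolev_norm (k : nat) (u : L2loc) : \bar R :=
  ((\sum_(j < k.+1) sqL2norm I (weak_derivative j u)) `^ 2^-1)%E.

Definition sobolev0 (k : nat) : set L2loc :=
  [set u | sobolev k u /\ forall e : R, 0 < e ->
    exists2 w, test_functions w & (sobolev_norm k (u - w)%R < e%:E)%E].

Definition laplacian : set (L2loc * L2loc) :=
  graph_of (sobolev0 2) (weak_derivative 2).

Definition laplacian_L2 : set (L2loc * L2loc) :=
  graph_of (sobolev0 1 `&` sobolev 2) (weak_derivative 2).

Definition laplacian_adjoint_domain : set L2c :=
  [set g | {within sobolev0 2,
    continuous (fun u => pairing g (weak_derivative 2 u) : R[i]^o)}].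

(* For g in the domain, an element h of L2c represents the continuous extension
   of u |-> <g, u''> exactly when both functionals agree on sobolev0 2. *)
Definition laplacian_adjoint : set (L2c * L2c) :=
  [set gh : L2c * L2c | laplacian_adjoint_domain gh.1 /\
    forall u, sobolev0 2 u ->
      pairing gh.2 u = pairing gh.1 (weak_derivative 2 u)].

End L2loc.

Arguments laplacian {R a b} E.
Arguments laplacian_L2 {R a b} E.
Arguments laplacian_adjoint {R a b} E.

(* Main.v *)
(* All neighbourhoods in L^2_loc(I) only see a compact segment of I, so a local
   solution of u'' = lam u or of u'' = lam u - g can be cut off near the endpoints
   at no cost, which makes it a test function.  With the homogeneous solutions
   e^(sx), s^2 = lam, this shows that lam is an eigenvalue of the closure, that the
   inverse of lam - Delta is not continuous, and that the range of lam - Delta^* is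
   orthogonal to e^(sx).  With the inhomogeneous solutions and the density of the
   test functions in L^2, it gives the density of the ranges and the injectivity of
   lam - Delta^*.  The injectivity of lam - Delta and of lam - Delta_{L^2} comes
   from Green's formula: a difference z of two preimages satisfies
   int z (h'' - lam h) = 0 for all smooth h, resp. all smooth h vanishing at the
   endpoints; then h'' - lam h ranges over all test functions, in the second case
   because lam is not a Dirichlet eigenvalue. *)

Require Import Defs.
From HB Require Import structures.
From mathcomp Require Import all_boot all_order all_algebra.
From mathcomp Require Import complex ring lra.
From mathcomp Require Import all_classical all_reals all_analysis.
From mathcomp Require Import measurable_realfun.

Import Order.TTheory GRing.Theory Num.Theory.
Import numFieldNormedType.Exports.

Set Implicit Arguments.
Unset Strict Implicit.
Unset Printing Implicit Defensive.

Local Open Scope classical_set_scope.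
Local Open Scope ring_scope.
Local Open Scope complex_scope.

(** * Calculus of smooth complex-valued functions *)

(** Elements of the Sobolev spaces are handled as bare classes modulo null sets, without continuous
    representatives, traces or regularity. Every identity therefore moves the derivatives onto
    functions that are smooth on the whole line, and passages to the limit take one form: a number
    that equals pairings with arbitrarily small L^2 functions is zero. The boundary conditions
    decide which factor is approximated. On H^2_0 it is the Sobolev function alone; h stays free at
    the endpoints, initial value problems suffice, and no [lam] is exceptional. On the Dirichlet
    domain only one derivative can be moved in this way; the other is moved by approximating h
    itself in H^1 by test functions, which requires h to vanish at both endpoints and lets the sines
    appear as eigenfunctions. Over the complex numbers D^2 - lam splits into first-order factors, so
    variation of constants with exponentials replaces a general existence theorem for differential
    equations. *)

Section complex_calculus.
Context {R : realType}.
Implicit Types (f g : R -> R[i]) (s lam : R[i]) (x : R).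

Lemma cReD (z t : R[i]) : complex.Re (z + t) = complex.Re z + complex.Re t.
Proof. by case: z t => [? ?] [? ?]. Qed.
Lemma cImD (z t : R[i]) : complex.Im (z + t) = complex.Im z + complex.Im t.
Proof. by case: z t => [? ?] [? ?]. Qed.
Lemma cReN (z : R[i]) : complex.Re (- z) = - complex.Re z.
Proof. by case: z => [? ?]. Qed.
Lemma cImN (z : R[i]) : complex.Im (- z) = - complex.Im z.
Proof. by case: z => [? ?]. Qed.
Lemma cReM (z t : R[i]) :
  complex.Re (z * t) = complex.Re z * complex.Re t - complex.Im z * complex.Im t.
Proof. by case: z t => [? ?] [? ?]. Qed.
Lemma cImM (z t : R[i]) :
  complex.Im (z * t) = complex.Re z * complex.Im t + complex.Im z * complex.Re t.
Proof. by case: z t => [? ?] [? ?]. Qed.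

Definition ReImE := (cReD, cImD, cReN, cImN, cReM, cImM).

Lemma complex_ext (z t : R[i]) : complex.Re z = complex.Re t -> complex.Im z = complex.Im t ->
  z = t.
Proof. by case: z t => [? ?] [? ?] /= -> ->. Qed.

(** A relation instead of an equation for [cderive 1 f]: it carries differentiability along, so
    derivatives are assembled rule by rule and converted to [cderive] only at the end. *)
Definition is_cderive f f' := forall x,
  is_derive x (1 : R) (fun y => complex.Re (f y)) (complex.Re (f' x)) /\
  is_derive x (1 : R) (fun y => complex.Im (f y)) (complex.Im (f' x)).

Lemma is_cderiveE f f' : is_cderive f f' -> cderive 1 f = f'.
Proof.
move=> h; apply/funext => x; have [h1 h2] := h x.
by apply: complex_ext; rewrite /cderive /= derive1E derive_val.
Qed.

Lemma is_cderive_cst s : is_cderive (fun=> s) (fun=> 0).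
Proof. by move=> x; split; exact: is_derive_cst. Qed.

Lemma is_cderive_id : is_cderive (fun x => x%:C) (fun=> 1).
Proof. by move=> x; split => /=; [exact: is_derive_id|exact: is_derive_cst]. Qed.

Lemma is_cderiveD f f' g g' : is_cderive f f' -> is_cderive g g' ->
  is_cderive (fun x => f x + g x) (fun x => f' x + g' x).
Proof.
move=> hf hg x; have [f1 f2] := hf x; have [g1 g2] := hg x; rewrite !ReImE; split.
- by under eq_fun do rewrite ReImE; exact: is_deriveD.
- by under eq_fun do rewrite ReImE; exact: is_deriveD.
Qed.

Lemma is_cderiveN f f' : is_cderive f f' ->
  is_cderive (fun x => - f x) (fun x => - f' x).
Proof.
move=> hf x; have [f1 f2] := hf x; rewrite !ReImE; split.
- by under eq_fun do rewrite ReImE; exact: is_deriveN.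
- by under eq_fun do rewrite ReImE; exact: is_deriveN.
Qed.

Lemma is_cderiveM f f' g g' : is_cderive f f' -> is_cderive g g' ->
  is_cderive (fun x => f x * g x) (fun x => f' x * g x + f x * g' x).
Proof.
move=> hf hg x; have [f1 f2] := hf x; have [g1 g2] := hg x; rewrite !ReImE; split.
- under eq_fun do rewrite ReImE.
  by apply: (is_derive_eq (is_deriveB (is_deriveM f1 g1) (is_deriveM f2 g2)));
     rewrite /GRing.scale /=; ring.
- under eq_fun do rewrite ReImE.
  by apply: (is_derive_eq (is_deriveD (is_deriveM f1 g2) (is_deriveM f2 g1)));
     rewrite /GRing.scale /=; ring.
Qed.

Lemma is_cderiveZ s f f' : is_cderive f f' ->
  is_cderive (fun x => s * f x) (fun x => s * f' x).
Proof.
move=> hf; have := is_cderiveM (is_cderive_cst s) hf.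
by congr is_cderive; apply/funext => x; rewrite mul0r add0r.
Qed.

Lemma is_cderive_affine (c d : R) f f' : is_cderive f f' ->
  is_cderive (fun x => f (c * x + d)) (fun x => c%:C * f' (c * x + d)).
Proof.
move=> hf x; have [f1 f2] := hf (c * x + d).
have aff : is_derive x (1 : R) (fun y => c * y + d) c.
  by apply: (is_derive_eq (is_deriveD (is_deriveZ c (is_derive_id x 1))
    (is_derive_cst d x 1))); rewrite /GRing.scale /= mulr1 addr0.
have hR := @is_derive1_comp _ (fun y => complex.Re (f y)) (fun y => c * y + d) _ _ _ f1 aff.
have hI := @is_derive1_comp _ (fun y => complex.Im (f y)) (fun y => c * y + d) _ _ _ f2 aff.
split; [apply: (is_derive_eq hR)|apply: (is_derive_eq hI)];
  by rewrite !ReImE /GRing.scale /=; ring.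
Qed.

(** The comparison function may change with the point, which is what functions defined by cases
    require. *)
Lemma is_cderive_near f f' : (forall x, exists g g',
    [/\ \forall y \near x, g y = f y, is_cderive g g' & g' x = f' x]) ->
  is_cderive f f'.
Proof.
move=> h x; have [g [g' [fg dg <-]]] := h x; have [g1 g2] := dg x; split.
- by apply: near_eq_is_derive g1; apply: filterS fg => y ->.
- by apply: near_eq_is_derive g2; apply: filterS fg => y ->.
Qed.

(** Finite orders of differentiability with existential derivatives: closure under products becomes
    an induction on n, with no formula for the n-th derivative. *)
Fixpoint cdiffn n f : Prop :=
  if n is m.+1 then exists2 f', is_cderive f f' & cdiffn m f' else True.

Lemma cderive0 f : cderive 0 f = f.
Proof. by apply/funext => x; exact: complex_ext. Qed.

Lemma csmooth_is_cderive n f : csmooth f ->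
  is_cderive (cderive n f) (cderive n.+1 f).
Proof.
move=> sf x; have [h1 h2] := sf n x.
split; [have := derivableP h1|have := derivableP h2]; rewrite -derive1E; exact.
Qed.

Lemma csmoothP f : csmooth f <-> forall n, cdiffn n f.
Proof.
split=> [sf n|df n x].
  suff H : forall m, cdiffn n (cderive m f) by have := H 0%N; rewrite cderive0.
  elim: n => [//|n IH] m; exists (cderive m.+1 f); last exact: IH.
  exact: csmooth_is_cderive.
have H : forall k m g, cdiffn (m + k) g -> cdiffn m (cderive k g).
  elim => [|k IH] m g; first by rewrite cderive0 addn0.
  rewrite addnS => /(IH m.+1)[g' dg' dg'2].
  by move: dg'2; rewrite -(is_cderiveE dg').
have [g dg _] := H n 1%N f (df (1 + n)%N).
by have [[h1 _] [h2 _]] := dg x; split; [exact: h1|exact: h2].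
Qed.

End complex_calculus.

(** * Smooth functions, complex exponentials and linear differential equations *)

Section smooth_functions.
Context {R : realType}.
Implicit Types (f g : R -> R[i]) (s lam : R[i]) (x : R).

Lemma cdiffnW n f : cdiffn n.+1 f -> cdiffn n f.
Proof.
elim: n f => [//|n IH] f [f' df cf].
by exists f' => //; exact: IH.
Qed.

Lemma cdiffnD n f g : cdiffn n f -> cdiffn n g -> cdiffn n (fun x => f x + g x).
Proof.
elim: n f g => [//|n IH] f g [f' df cf] [g' dg cg].
by exists (fun x => f' x + g' x); [exact: is_cderiveD|exact: IH].
Qed.

Lemma cdiffnM n f g : cdiffn n f -> cdiffn n g -> cdiffn n (fun x => f x * g x).
Proof.
elim: n f g => [//|n IH] f g sf sg.
move: (sf) (sg) => [f' df cf] [g' dg cg].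
exists (fun x => f' x * g x + f x * g' x); first exact: is_cderiveM.
by apply: cdiffnD; apply: IH => //; exact: cdiffnW.
Qed.

(** Coinduction principle for smoothness; exponentials and glued functions are handled through a
    family stable under differentiation, without computing any n-th derivative. *)
Lemma csmooth_coind (P : (R -> R[i]) -> Prop) :
  (forall f, P f -> exists2 f', is_cderive f f' & P f') ->
  forall f, P f -> csmooth f.
Proof.
move=> h f Pf; apply/csmoothP => n; elim: n f Pf => [//|n IH] f Pf.
by have [f' df Pf'] := h f Pf; exists f' => //; exact: IH.
Qed.

Lemma csmoothD f g : csmooth f -> csmooth g -> csmooth (fun x => f x + g x).
Proof. by move=> /csmoothP sf /csmoothP sg; apply/csmoothP => n; exact: cdiffnD. Qed.

Lemma csmoothM f g : csmooth f -> csmooth g -> csmooth (fun x => f x * g x).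
Proof. by move=> /csmoothP sf /csmoothP sg; apply/csmoothP => n; exact: cdiffnM. Qed.

Lemma csmooth_cst s : csmooth (fun=> s : R[i]).
Proof.
apply: (@csmooth_coind (fun f => exists s, f = fun=> s)); last by exists s.
by move=> _ [c ->]; exists (fun=> 0); [exact: is_cderive_cst|exists 0].
Qed.

Lemma csmoothZ s f : csmooth f -> csmooth (fun x => s * f x).
Proof. move=> sf; exact: (csmoothM (csmooth_cst s) sf). Qed.

Lemma csmoothN f : csmooth f -> csmooth (fun x => - f x).
Proof.
move=> /(csmoothZ (-1)); congr csmooth.
by apply/funext => x; rewrite mulN1r.
Qed.

Lemma csmoothB f g : csmooth f -> csmooth g -> csmooth (fun x => f x - g x).
Proof. move=> sf sg; exact: (csmoothD sf (csmoothN sg)). Qed.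

Lemma csmooth_deriv f f' : is_cderive f f' -> csmooth f' -> csmooth f.
Proof.
move=> df /csmoothP sf'; apply/csmoothP; case=> [//|n].
by exists f'.
Qed.

Lemma csmooth_id : csmooth (fun x : R => x%:C).
Proof. exact: (csmooth_deriv is_cderive_id (csmooth_cst 1)). Qed.

Lemma csmooth_cderive n f : csmooth f -> csmooth (cderive n f).
Proof.
move=> sf; apply: (@csmooth_coind (fun g => exists n, g = cderive n f)); last by exists n.
by move=> _ [m ->]; exists (cderive m.+1 f); [exact: csmooth_is_cderive|exists m.+1].
Qed.

Lemma csmooth_affine (c d : R) f : csmooth f -> csmooth (fun x => f (c * x + d)).
Proof.
move=> /csmoothP sf; apply/csmoothP => n; move/(_ n): sf.
elim: n f => [//|n IH] f [f' df cf].
exists (fun x => c%:C * f' (c * x + d)); first exact: is_cderive_affine.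
by apply: cdiffnM; [have /csmoothP := csmooth_cst c%:C; exact|exact: IH].
Qed.

Lemma cderive2E f f' f'' : is_cderive f f' -> is_cderive f' f'' -> cderive 2 f = f''.
Proof.
by move=> df df'; rewrite -(is_cderiveE df') -(is_cderiveE df).
Qed.

(** Locality of iterated derivatives; through it localized functions inherit the differential
    equation of the original. *)
Lemma cderive_open (U : set R) n f g : open U -> (forall y, U y -> f y = g y) ->
  forall y, U y -> cderive n f y = cderive n g y.
Proof.
move=> oU fg.
suff H (u v : R -> R) : (forall y, U y -> u y = v y) ->
    forall y, U y -> derive1n n u y = derive1n n v y.
  by move=> y Uy; apply: complex_ext => /=; apply: H => // t Ut; rewrite fg.
move=> uv; elim: n => [//|n IH] y Uy.
rewrite /= !derive1E; apply: near_eq_derive.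
have : nbhs y U by exact: open_nbhs_nbhs.
by apply: filterS => z; exact: IH.
Qed.

Definition cexp s x : R[i] :=
  (expR (complex.Re s * x))%:C *
  (cos (complex.Im s * x) +i* sin (complex.Im s * x)).

Lemma is_cderive_cexp s : is_cderive (cexp s) (fun x => s * cexp s x).
Proof.
case: s => p q x.
have lin (c : R) : is_derive x (1 : R) (fun y => c * y) c.
  by apply: (is_derive_eq (is_deriveZ c (is_derive_id x 1)));
     rewrite /GRing.scale /= mulr1.
have hE := @is_derive1_comp _ expR (fun y => p * y) _ _ _ (is_derive_expR _) (lin p).
have hC := @is_derive1_comp _ cos (fun y => q * y) _ _ _ (is_derive_cos _) (lin q).
have hS := @is_derive1_comp _ sin (fun y => q * y) _ _ _ (is_derive_sin _) (lin q).
have ER : (fun y => complex.Re (cexp (p +i* q) y)) = (expR \o *%R p) * (cos \o *%R q).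
  by apply/funext => y; rewrite /cexp ReImE /= mul0r subr0.
have EI : (fun y => complex.Im (cexp (p +i* q) y)) = (expR \o *%R p) * (sin \o *%R q).
  by apply/funext => y; rewrite /cexp ReImE /= mul0r addr0.
rewrite ER EI /cexp !ReImE /=; split.
- by apply: (is_derive_eq (is_deriveM hE hC)); rewrite /GRing.scale /=; ring.
- by apply: (is_derive_eq (is_deriveM hE hS)); rewrite /GRing.scale /=; ring.
Qed.

Lemma csmooth_cexp s : csmooth (cexp s).
Proof.
apply: (@csmooth_coind (fun g => exists c, g = fun x => c * cexp s x)); last first.
  by exists 1; apply/funext => x; rewrite mul1r.
move=> _ [c ->]; exists (fun x => c * (s * cexp s x)).
  exact/is_cderiveZ/is_cderive_cexp.
by exists (c * s); apply/funext => x; rewrite mulrA.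
Qed.

Lemma cderive2_cexp s : cderive 2 (cexp s) = fun x => s * (s * cexp s x).
Proof.
by apply: (cderive2E (is_cderive_cexp s)); exact/is_cderiveZ/is_cderive_cexp.
Qed.

Lemma sqnormc_cexp s x : sqnormc (cexp s x) = expR (complex.Re s * x) ^+ 2.
Proof.
rewrite sqnormcZ /sqnormc /= expr0n /= addr0.
by rewrite cos2Dsin2 mulr1.
Qed.

Lemma cexpN s x : cexp s x * cexp (- s) x = 1.
Proof.
rewrite /cexp !ReImE; set p := complex.Re s; set q := complex.Im s.
rewrite !mulNr expRN cosN sinN; apply: complex_ext; rewrite !ReImE /=.
  have := cos2Dsin2 (q * x); have : expR (p * x) != 0 by rewrite gt_eqF ?expR_gt0.
  set e := expR _; set c := cos _; set t := sin _ => e0 h.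
  transitivity (e * e^-1 * (c ^+ 2 + t ^+ 2)); first by ring.
  by rewrite h mulfV ?mulr1.
by ring.
Qed.

Lemma sqnormc_eq0 (z : R[i]) : (sqnormc z == 0) = (z == 0).
Proof.
case: z => u v; rewrite /sqnormc paddr_eq0 ?sqr_ge0// !sqrf_eq0.
by rewrite eq_complex.
Qed.

Lemma cexp_neq0 s x : cexp s x != 0.
Proof. by rewrite -sqnormc_eq0 sqnormc_cexp sqrf_eq0 gt_eqF ?expR_gt0. Qed.

Lemma is_cderive_continuous f f' : is_cderive f f' ->
  continuous (fun x => complex.Re (f x)) /\ continuous (fun x => complex.Im (f x)).
Proof.
move=> df; split=> x; have [h1 h2] := df x;
  apply/differentiable_continuous/derivable1_diffP; exact: ex_derive.
Qed.

Lemma csmooth_continuous f : csmooth f ->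
  continuous (fun x => complex.Re (f x)) /\ continuous (fun x => complex.Im (f x)).
Proof.
move=> /(@csmooth_is_cderive _ 0); rewrite cderive0; exact: is_cderive_continuous.
Qed.

(* Since [f] vanishes on the left of [c], integrating from [c - 1] is enough to
   get an antiderivative on the whole line. *)
Lemma antiderivative (f : R -> R) (c : R) : continuous f ->
  (forall x, x <= c -> f x = 0) ->
  exists2 F : R -> R, (forall x, x <= c -> F x = 0) &
    forall x, is_derive x (1 : R) F (f x).
Proof.
move=> cf f0.
pose mu := @lebesgue_measure R.
pose F x := (\int[mu]_(t in [set` `[c - 1, x]]) f t)%R.
have F0 x : x <= c -> F x = 0.
  move=> xc; rewrite /F /Rintegral integral0_eq// => y /=.
  by rewrite in_itv /= => /andP[_ yx]; rewrite f0// (le_trans yx).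
exists F => // x; have [xc|cx] := ltP x c.
  rewrite f0 ?(ltW xc)//.
  apply: near_eq_is_derive (is_derive_cst (0 : R^o) x (1 : R)).
  near=> y; rewrite F0//; apply/ltW; near: y; exact: lt_nbhsl.
have [] := @continuous_FTC1_closed R f (c - 1) x (x + 1).
- by rewrite ltrDl.
- apply: continuous_compact_integrable; first exact: segment_compact.
  exact: continuous_subspaceT.
- by rewrite ltrBlDr (le_lt_trans cx)// ltrDl.
- exact: cf.
by move=> dF; rewrite derive1E => <-; exact: derivableP.
Unshelve. all: by end_near. Qed.

Lemma cantiderivative f (c : R) : csmooth f -> (forall x, x <= c -> f x = 0) ->
  exists F, [/\ csmooth F, forall x, x <= c -> F x = 0 & is_cderive F f].
Proof.
move=> sf f0; have [cR cI] := csmooth_continuous sf.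
have [|F F0 dF] := @antiderivative _ c cR; first by move=> x /f0 ->.
have [|G G0 dG] := @antiderivative _ c cI; first by move=> x /f0 ->.
have dH : is_cderive (fun x => F x +i* G x) f by move=> x; split; [exact: dF|exact: dG].
exists (fun x => F x +i* G x); split; last exact: dH.
- exact: csmooth_deriv dH sf.
- by move=> x xc; rewrite F0// G0.
Qed.

(** Variation of constants: w = e^(sx) F, where F is the antiderivative of e^(-sx) f that vanishes
    left of c. The zero start passes on to w, so the lemma can be iterated. *)
Lemma linear_ode1 s f (c : R) : csmooth f -> (forall x, x <= c -> f x = 0) ->
  exists w, [/\ csmooth w, forall x, x <= c -> w x = 0 &
    is_cderive w (fun x => s * w x + f x)].
Proof.
move=> sf f0.
have [||F [sF F0 dF]] := @cantiderivative (fun x => cexp (- s) x * f x) c.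
- exact: csmoothM (csmooth_cexp _) _.
- by move=> x /f0 ->; rewrite mulr0.
exists (fun x => cexp s x * F x); split.
- exact: csmoothM (csmooth_cexp _) _.
- by move=> x /F0 ->; rewrite mulr0.
- have := is_cderiveM (is_cderive_cexp s) dF; congr is_cderive; apply/funext => x.
  by move: (cexpN s x); move: (cexp s x) (cexp (- s) x) => u v uv; rewrite !mulrA uv mul1r.
Qed.

(* Factorization D^2 - lam = (D + s)(D - s) with s^2 = lam. *)
Lemma linear_ode2 lam f (c : R) : csmooth f -> (forall x, x <= c -> f x = 0) ->
  exists u, [/\ csmooth u, forall x, x <= c -> u x = 0 &
    cderive 2 u = fun x => lam * u x + f x].
Proof.
move=> sf f0; pose s := sqrtc lam.
have [w [sw w0 dw]] := linear_ode1 s sf f0.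
have [u [su u0 du]] := linear_ode1 (- s) sw w0.
exists u; split; [exact: su|exact: u0|apply: (cderive2E du)].
have := is_cderiveD (is_cderiveZ (- s) du) dw; congr is_cderive; apply/funext => x.
rewrite -[lam in RHS]sqr_sqrtc -/s; ring.
Qed.

End smooth_functions.

(** * Supports, test functions and a smooth step *)

Section cutoffs.
Context {R : realType}.
Implicit Types (f g : R -> R[i]) (s : R[i]) (a b c d x : R) (K : set R).

Lemma compact_sub_segment a b K : a < b -> compact K -> K `<=` [set` `]a, b[ ] ->
  exists c d, [/\ a < c, c < d, d < b & forall x, K x -> c <= x <= d].
Proof.
move=> ab cK KI; have [->|/set0P K0] := eqVneq K set0.
  exists ((2 * a + b) / 3), ((a + 2 * b) / 3); split => //; lra.
have idc : {within K, continuous (fun x : R => x)}.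
  by apply: continuous_subspaceT => x; exact: cvg_id.
have [d0 d0K dP] := compact_EVT_max K0 cK idc.
have [c0 c0K cP] := compact_EVT_min K0 cK idc.
have /= := KI _ (set_mem d0K); have /= := KI _ (set_mem c0K).
rewrite !in_itv /= => /andP[ac0 _] /andP[_ d0b].
have c0d0 := cP _ d0K.
(* Halfway from the extrema of K to the endpoints: this keeps the segment nondegenerate even if K is
   a single point. *)
exists ((a + c0) / 2), ((d0 + b) / 2); split; try lra.
by move=> x Kx; have := cP x (mem_set Kx); have := dP x (mem_set Kx); lra.
Qed.

(** With its converse [test_functionE], this trades closures and compactness for a segment outside
    which the function vanishes; supports are handled in that form from here on. *)
Lemma test_functionI a b c d f : csmooth f -> a < c -> d < b ->
  (forall x, ~~ (c <= x <= d) -> f x = 0) -> test_function a b f.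
Proof.
move=> sf ac db f0.
have sub : closure [set x | f x != 0] `<=` [set` `[c, d]].
  have cl : closed [set` `[c, d]] by exact: itv_closed.
  rewrite [X in _ `<=` X]((closure_id _).1 cl).
  apply: closure_subset => x /= fx; rewrite in_itv /=.
  by apply: contraNT fx => /f0 ->.
split; first exact: sf.
- apply: (subclosed_compact _ (@segment_compact _ c d) sub).
  exact: closed_closure.
- move=> x /sub /=; rewrite !in_itv /= => /andP[cx xd].
  by rewrite (lt_le_trans ac cx) (le_lt_trans xd db).
Qed.

Lemma test_functionE a b f : a < b -> test_function a b f ->
  exists c d, [/\ a < c, c < d, d < b & forall x, ~~ (c <= x <= d) -> f x = 0].
Proof.
move=> ab [_ cK KI]; have [c [d [ac cd db cdK]]] := compact_sub_segment ab cK KI.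
exists c, d; split => // x; apply: contraNeq => fx0; apply: cdK.
by apply: subset_closure => /=.
Qed.

Lemma csmooth_bounded f a b : csmooth f ->
  exists2 M, 0 < M & forall x, a <= x <= b -> sqnormc (f x) <= M.
Proof.
move=> sf; have [ab|ba] := leP a b; last by exists 1 => // x /andP[ax xb]; lra.
have [cR cI] := csmooth_continuous sf.
have cN : continuous (fun x => sqnormc (f x)).
  move=> x; rewrite /sqnormc; apply: cvgD; under eq_fun do rewrite expr2;
  by rewrite expr2; apply: cvgM; ((exact: cR) || (exact: cI)).
have [c _ cP] := EVT_max ab (continuous_subspaceT cN).
exists (sqnormc (f c) + 1); first by rewrite ltr_wpDl// sqnormc_ge0.
by move=> x xab; rewrite (le_trans (cP x _))// ?in_itv// lerDl.
Qed.

(** Near c the glued function is constant, elsewhere it is locally f or constant, and its derivative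
    is again a glued function, built from f' and the value 0. Coinduction over all pairs (f, k) then
    gives all orders. *)
Lemma csmooth_glue f c e k : 0 < e -> csmooth f ->
  (forall x, c - e < x < c + e -> f x = k) ->
  csmooth (fun x => if x < c then f x else k).
Proof.
move=> e0 sf fk.
pose P g := exists f k, [/\ csmooth f, (forall x, c - e < x < c + e -> f x = k) &
  g = fun x => if x < c then f x else k].
apply: (@csmooth_coind _ P); last by exists f, k; split; [exact: sf|exact: fk|].
move=> _ {f sf k fk}[f [k [sf fk ->]]].
have df := csmooth_is_cderive 0 sf; rewrite cderive0 in df.
exists (fun x => if x < c then cderive 1 f x else 0); last first.
  exists (cderive 1 f), 0; split; [exact: csmooth_cderive| |by []].
  move=> x xc; rewrite (@cderive_open _ [set` `]c - e, c + e[ ] 1 f (fun=> k)).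
  - by rewrite (is_cderiveE (is_cderive_cst k)).
  - exact: itv_open.
  - by move=> y /= ; rewrite in_itv /=; exact: fk.
  - by rewrite /= in_itv.
apply: is_cderive_near => x; have [xc|cx] := ltP x c.
  exists f, (cderive 1 f); split; [|exact: df|by []].
  by near do (rewrite ifT//); exact: lt_nbhsl.
exists (fun=> k), (fun=> 0); split; [|exact: is_cderive_cst|by []].
near=> y; case: ifPn => // yc; rewrite fk//.
apply/andP; split; last by rewrite (lt_trans yc)// ltrDl.
by near: y; apply: lt_nbhsr; rewrite ltrBlDr (le_lt_trans cx)// ltrDl.
Unshelve. all: by end_near. Qed.

(* The cutoffs of the exhaustion are smooth with compact support, so that no
   explicit bump function has to be built. *)
Lemma smooth_step a b (E : exhaustion a b) : exists eta : R -> R[i],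
  [/\ csmooth eta, forall x, x <= 0 -> eta x = 0 & forall x, 1 <= x -> eta x = 1].
Proof.
have lh0 := lo_lt_hi E 0; have lh1 := lo_lt_hi E 1.
pose m := (lo E 0 + hi E 0) / 2; pose e := (hi E 0 - lo E 0) / 2.
have e0 : 0 < e by rewrite /e; lra.
have [sphi _ phiI] := cutoff_test E 0.
have incr x : lo E 0 <= x <= hi E 0 -> lo E 1 < x < hi E 1.
  by move=> h; have /= := @exhaustion_incr _ _ _ E 0 x; rewrite !in_itv /=; exact.
have phi1 x : lo E 0 <= x <= hi E 0 -> cutoff E 0 x = 1.
  by move=> h; apply: cutoff1; rewrite in_itv.
have phi0 x : x <= lo E 1 -> cutoff E 0 x = 0.
  move=> xl; apply/eqP/negPn/negP => px; have /= : [set` `]lo E 1, hi E 1[ ] x.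
    by apply: phiI; exact: subset_closure.
  by rewrite in_itv /= ltNge xl.
have sg := @csmooth_glue (cutoff E 0) m e 1 e0 sphi.
have l10 : lo E 1 < lo E 0 by have /andP[] := incr (lo E 0) ltac:(lra).
(* The affine map sends 0 to [lo E 1], where the cutoff still vanishes, and 1 to [lo E 0], where it
   has reached 1; beyond the midpoint m of the first segment the constant 1 replaces its descent. *)
exists (fun x => if (lo E 0 - lo E 1) * x + lo E 1 < m
   then cutoff E 0 ((lo E 0 - lo E 1) * x + lo E 1) else 1); split.
- apply: (@csmooth_affine _ _ _ (fun x => if x < m then cutoff E 0 x else 1)).
  by apply: sg => x; rewrite /m /e => h; apply: phi1; lra.
- move=> x x0; have h : (lo E 0 - lo E 1) * x <= 0 by rewrite mulr_ge0_le0// subr_ge0 ltW.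
  rewrite ifT; last by rewrite /m; lra.
  by apply: phi0; lra.
- move=> x x1; have h : lo E 0 - lo E 1 <= (lo E 0 - lo E 1) * x.
    by rewrite ler_peMr// subr_ge0 ltW.
  case: ifPn => // xm; apply: phi1; move: xm; rewrite /m => xm; lra.
Qed.

End cutoffs.

(** * Square integrable functions *)

Section square_integrable_functions.
Context {R : realType}.
Local Notation mu := (@lebesgue_measure R).
Implicit Types (f g h : R -> R[i]) (s : R[i]) (D : set R).

Lemma ae_imply (P Q : R -> Prop) : (forall x, P x -> Q x) ->
  {ae mu, forall x, P x} -> {ae mu, forall x, Q x}.
Proof. exact: (@filterS _ _ (ae_filter_ringOfSetsType mu)). Qed.

Lemma ae_imply2 (P Q S : R -> Prop) : (forall x, P x -> Q x -> S x) ->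
  {ae mu, forall x, P x} -> {ae mu, forall x, Q x} -> {ae mu, forall x, S x}.
Proof. exact: (@filterS2 _ _ (ae_filter_ringOfSetsType mu)). Qed.

Lemma cmeasurableD D f g : cmeasurable D f -> cmeasurable D g ->
  cmeasurable D (fun x => f x + g x).
Proof.
move=> [f1 f2] [g1 g2]; split; under eq_fun do rewrite ReImE;
  exact: measurable_funD.
Qed.

Lemma cmeasurableN D f : cmeasurable D f -> cmeasurable D (fun x => - f x).
Proof.
by move=> [f1 f2]; split; under eq_fun do rewrite ReImE; exact: measurableT_comp.
Qed.

Lemma cmeasurableB D f g : cmeasurable D f -> cmeasurable D g ->
  cmeasurable D (fun x => f x - g x).
Proof. by move=> mf mg; exact: cmeasurableD mf (cmeasurableN mg). Qed.

Lemma cmeasurableM D f g : cmeasurable D f -> cmeasurable D g ->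
  cmeasurable D (fun x => f x * g x).
Proof.
move=> [f1 f2] [g1 g2]; split; under eq_fun do rewrite ReImE;
  [apply: measurable_funB|apply: measurable_funD]; exact: measurable_funM.
Qed.

Lemma cmeasurable_cst D s : cmeasurable D (fun=> s).
Proof. by split; exact: measurable_cst. Qed.

Lemma cmeasurable_csmooth D f : measurable D -> csmooth f -> cmeasurable D f.
Proof.
move=> mD /csmooth_continuous[c1 c2].
by split; apply: measurable_funTS; exact: continuous_measurable_fun.
Qed.

Definition L2on D f := cmeasurable D f /\ (sqL2norm D f < +oo)%E.

Lemma sqL2norm_ge0 D f : (0 <= sqL2norm D f)%E.
Proof. by apply: integral_ge0 => x _; rewrite lee_fin sqnormc_ge0. Qed.

Lemma sqL2norm_eq D f g : (forall x, D x -> f x = g x) ->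
  sqL2norm D f = sqL2norm D g.
Proof. by move=> fg; apply: eq_integral => x /set_mem Dx; rewrite fg. Qed.

Lemma sqL2normD D f g : measurable D -> cmeasurable D f -> cmeasurable D g ->
  (sqL2norm D (fun x => f x + g x)%R <= 2%:E * sqL2norm D f + 2%:E * sqL2norm D g)%E.
Proof.
move=> mD mf mg; rewrite /sqL2norm.
have mf2 := cmeasurable_sqnormc mf; have mg2 := cmeasurable_sqnormc mg.
have ge0 h x : D x -> (0 <= (sqnormc (h x))%:E)%E by rewrite lee_fin sqnormc_ge0.
rewrite -!ge0_integralZl//; try exact: ge0.
rewrite -ge0_integralD//; try by move=> x Dx; rewrite mule_ge0// ge0.
- apply: ge0_le_integral => //.
  + exact: ge0.
  + exact: (cmeasurable_sqnormc (cmeasurableD mf mg)).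
  + by apply: emeasurable_funD; apply: measurable_funeM.
  + move=> x Dx; rewrite -!EFinM -EFinD lee_fin -mulrDr; exact: sqnormcD.
- exact: measurable_funeM.
- exact: measurable_funeM.
Qed.

Lemma sqL2normZ D s f : measurable D -> cmeasurable D f ->
  sqL2norm D (fun x => s * f x) = ((sqnormc s)%:E * sqL2norm D f)%E.
Proof.
move=> mD mf; rewrite /sqL2norm -ge0_integralZl//.
- by apply: eq_integral => x _; rewrite sqnormcZ.
- exact: cmeasurable_sqnormc.
- by move=> x _; rewrite lee_fin sqnormc_ge0.
- by rewrite lee_fin sqnormc_ge0.
Qed.

Lemma sqL2normN D f : sqL2norm D (fun x => - f x) = sqL2norm D f.
Proof.
by apply: eq_integral => x _; rewrite /sqnormc !ReImE !sqrrN.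
Qed.

Lemma sqL2norm_ae D f g : measurable D -> cmeasurable D f -> cmeasurable D g ->
  f = g %[ae mu in D] -> sqL2norm D f = sqL2norm D g.
Proof.
move=> mD mf mg fg; apply: ge0_ae_eq_integral => //.
- exact: cmeasurable_sqnormc.
- exact: cmeasurable_sqnormc.
- by move=> x _; rewrite lee_fin sqnormc_ge0.
- by move=> x _; rewrite lee_fin sqnormc_ge0.
- by apply: ae_imply fg => x fg Dx; rewrite fg.
Qed.

Lemma sqL2norm_eq0 D f : measurable D -> cmeasurable D f -> sqL2norm D f = 0%E ->
  f = (fun=> 0) %[ae mu in D].
Proof.
move=> mD mf h.
have : (\int[mu]_(x in D) `|(sqnormc (f x))%:E| = 0)%E.
  by rewrite -[RHS]h; apply: eq_integral => x _; rewrite gee0_abs// lee_fin sqnormc_ge0.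
move/(ae_eq_integral_abs mu mD (cmeasurable_sqnormc mf)).
apply: ae_imply => x /= h0 Dx; apply/eqP; rewrite -sqnormc_eq0; apply/eqP.
by have [] := h0 Dx.
Qed.

Lemma sqL2norm_le D f g : measurable D -> cmeasurable D f -> cmeasurable D g ->
  (forall x, D x -> sqnormc (f x) <= sqnormc (g x)) ->
  (sqL2norm D f <= sqL2norm D g)%E.
Proof.
move=> mD mf mg fg; apply: ge0_le_integral => //.
- by move=> x _; rewrite lee_fin sqnormc_ge0.
- exact: cmeasurable_sqnormc.
- exact: cmeasurable_sqnormc.
Qed.

Lemma sqL2norm_leM D f g M : measurable D -> 0 <= M -> cmeasurable D f -> cmeasurable D g ->
  (forall x, D x -> sqnormc (f x) <= M * sqnormc (g x)) ->
  (sqL2norm D f <= M%:E * sqL2norm D g)%E.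
Proof.
move=> mD M0 mf mg fg; rewrite /sqL2norm -ge0_integralZl//.
- apply: ge0_le_integral => //.
  + by move=> x _; rewrite lee_fin sqnormc_ge0.
  + exact: cmeasurable_sqnormc.
  + by apply: measurable_funeM; exact: cmeasurable_sqnormc.
- exact: cmeasurable_sqnormc.
- by move=> x _; rewrite lee_fin sqnormc_ge0.
Qed.

Lemma sqL2norm_bounded D f M : measurable D -> 0 <= M -> cmeasurable D f ->
  (forall x, D x -> sqnormc (f x) <= M) -> (sqL2norm D f <= M%:E * mu D)%E.
Proof.
move=> mD M0 mf fM; rewrite -integral_cst//; apply: ge0_le_integral => //.
- by move=> x _; rewrite lee_fin sqnormc_ge0.
- exact: cmeasurable_sqnormc.
Qed.

Lemma L2onD D f g : measurable D -> L2on D f -> L2on D g ->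
  L2on D (fun x => f x + g x).
Proof.
move=> mD [mf lf] [mg lg]; split; first exact: cmeasurableD.
by rewrite (le_lt_trans (sqL2normD mD mf mg))// lte_add_pinfty// lte_mul_pinfty// lee_fin.
Qed.

Lemma L2onN D f : L2on D f -> L2on D (fun x => - f x).
Proof. by move=> [mf lf]; split; [exact: cmeasurableN|rewrite sqL2normN]. Qed.

Lemma L2onB D f g : measurable D -> L2on D f -> L2on D g ->
  L2on D (fun x => f x - g x).
Proof. by move=> mD lf lg; apply: L2onD => //; exact: L2onN. Qed.

Lemma L2onZ D s f : measurable D -> L2on D f -> L2on D (fun x => s * f x).
Proof.
move=> mD [mf lf]; split; first exact: cmeasurableM (cmeasurable_cst D s) mf.
by rewrite sqL2normZ// lte_mul_pinfty// lee_fin sqnormc_ge0.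
Qed.

Lemma L2on_bounded D f M : measurable D -> (mu D < +oo)%E -> cmeasurable D f ->
  (forall x, D x -> sqnormc (f x) <= M) -> L2on D f.
Proof.
move=> mD D0 mf fM; split => //.
have h : (sqL2norm D f <= (Num.max 0 M)%:E * mu D)%E.
  apply: sqL2norm_bounded => //; first by rewrite le_max lexx.
  by move=> x Dx; rewrite le_max fM ?orbT.
by rewrite (le_lt_trans h)// lte_mul_pinfty// lee_fin le_max lexx.
Qed.

Lemma mu_itv_oo (a b : R) : (mu [set` `]a, b[ ] < +oo)%E.
Proof. by rewrite lebesgue_measure_itv /=; case: ifP => // _; rewrite ltry. Qed.

Lemma L2on_csmooth (a b : R) f : csmooth f -> L2on [set` `]a, b[ ] f.
Proof.
move=> sf; have [M M0 fM] := csmooth_bounded a b sf.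
apply: (@L2on_bounded _ _ M) => //.
- exact: mu_itv_oo.
- exact: cmeasurable_csmooth.
- by move=> x /=; rewrite in_itv /= => /andP[ax xb]; apply: fM; rewrite !ltW.
Qed.

Definition cintegrable D f := mu.-integrable D (EFin \o (fun x => complex.Re (f x))) /\
  mu.-integrable D (EFin \o (fun x => complex.Im (f x))).

Lemma normr_mul_le_AMGM (t x y : R) : 0 < t -> `|x * y| <= (t * x ^+ 2 + t^-1 * y ^+ 2) / 2.
Proof.
move=> t0; have t0' : 0 < t^-1 by rewrite invr_gt0.
have tt : t * t^-1 = 1 by rewrite mulfV ?gt_eqF.
have h1 : 0 <= t^-1 * (t * x - y) ^+ 2 by rewrite mulr_ge0 ?sqr_ge0// ltW.
have h2 : 0 <= t^-1 * (t * x + y) ^+ 2 by rewrite mulr_ge0 ?sqr_ge0// ltW.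
have e1 : t^-1 * (t * x - y) ^+ 2 = (t * t^-1) * (t * x ^+ 2) - (t * t^-1) * 2 * (x * y) + t^-1 * y ^+ 2 by ring.
have e2 : t^-1 * (t * x + y) ^+ 2 = (t * t^-1) * (t * x ^+ 2) + (t * t^-1) * 2 * (x * y) + t^-1 * y ^+ 2 by ring.
by rewrite e1 tt in h1; rewrite e2 tt in h2; rewrite ler_norml; apply/andP; split; lra.
Qed.

Lemma normr_Re_mul_le (t : R) (z w : R[i]) : 0 < t ->
  `|complex.Re (z * w)| <= t * sqnormc z + t^-1 * sqnormc w.
Proof.
case: z w => x y [u v] t0; rewrite /sqnormc /=.
have := normr_mul_le_AMGM x u t0; have := normr_mul_le_AMGM y v t0.
have := ler_normB (x * u) (y * v).
have : 0 <= t^-1 * u ^+ 2 by rewrite mulr_ge0 ?sqr_ge0 ?invr_ge0 ?ltW.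
have : 0 <= t^-1 * v ^+ 2 by rewrite mulr_ge0 ?sqr_ge0 ?invr_ge0 ?ltW.
have : 0 <= t * x ^+ 2 by rewrite mulr_ge0 ?sqr_ge0 ?ltW.
have : 0 <= t * y ^+ 2 by rewrite mulr_ge0 ?sqr_ge0 ?ltW.
by rewrite !mulrDr; lra.
Qed.

(** Multiplication by -i turns an imaginary part into a real part; estimates are proved for real
    parts and carried over by this rotation, which preserves [sqnormc]. *)
Lemma Im_mul (z w : R[i]) : complex.Im (z * w) = complex.Re (z * ('i * - w)).
Proof. by case: z w => x y [u v] /=; ring. Qed.

Lemma sqnormc_iN (w : R[i]) : sqnormc ('i * - w) = sqnormc w.
Proof. by case: w => u v; rewrite /sqnormc /=; ring. Qed.

Lemma normr_Im_mul_le (t : R) (z w : R[i]) : 0 < t ->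
  `|complex.Im (z * w)| <= t * sqnormc z + t^-1 * sqnormc w.
Proof.
by move=> t0; rewrite Im_mul (le_trans (normr_Re_mul_le _ _ t0))// sqnormc_iN.
Qed.

Lemma sqnormc_integrable D f : L2on D f ->
  mu.-integrable D (EFin \o (fun x => sqnormc (f x))).
Proof.
move=> [mf lf]; apply/integrableP; split; first exact: cmeasurable_sqnormc.
by under eq_integral do rewrite /= ger0_norm ?sqnormc_ge0//.
Qed.

Lemma L2on_cintegrable D f g : measurable D -> L2on D f -> L2on D g ->
  cintegrable D (fun x => f x * g x).
Proof.
move=> mD lf lg; have [m1 m2] := cmeasurableM lf.1 lg.1.
have ii : mu.-integrable D (EFin \o (fun x => sqnormc (f x) + sqnormc (g x))).
  exact: (@integrableD _ _ _ mu D mD _ _ (sqnormc_integrable lf) (sqnormc_integrable lg)).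
have m1' : measurable_fun D (EFin \o (fun x => complex.Re (f x * g x))) by exact/measurable_EFinP.
have m2' : measurable_fun D (EFin \o (fun x => complex.Im (f x * g x))) by exact/measurable_EFinP.
have bnd (x r : R) (i : `|r| <= sqnormc (f x) + sqnormc (g x)) :
    (`|r%:E| <= `|(sqnormc (f x) + sqnormc (g x))%:E|)%E.
  have s0 : 0 <= sqnormc (f x) + sqnormc (g x) by apply: addr_ge0; exact: sqnormc_ge0.
  by rewrite /= lee_fin (ger0_norm s0).
split.
- apply: (@le_integrable _ _ _ mu D mD _ _ m1' _ ii) => x _; apply: bnd.
  by have := @normr_Re_mul_le 1 (f x) (g x) ltr01; rewrite invr1 !mul1r.
- apply: (@le_integrable _ _ _ mu D mD _ _ m2' _ ii) => x _; apply: bnd.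
  by have := @normr_Im_mul_le 1 (f x) (g x) ltr01; rewrite invr1 !mul1r.
Qed.

Lemma cintegral_eq D f g : (forall x, D x -> f x = g x) ->
  cintegral D f = cintegral D g.
Proof.
move=> fg; rewrite /cintegral; congr (_ +i* _);
  by apply: eq_Rintegral => x /set_mem Dx; rewrite fg.
Qed.

Lemma cintegral_ae D f g : measurable D -> cmeasurable D f -> cmeasurable D g ->
  f = g %[ae mu in D] -> cintegral D f = cintegral D g.
Proof.
move=> mD [f1 f2] [g1 g2] fg; rewrite /cintegral; congr (_ +i* _); rewrite /Rintegral;
  congr fine; apply: ae_eq_integral => //.
- exact/measurable_EFinP.
- exact/measurable_EFinP.
- by apply: ae_imply fg => x fg Dx; rewrite fg.
- exact/measurable_EFinP.
- exact/measurable_EFinP.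
- by apply: ae_imply fg => x fg Dx; rewrite fg.
Qed.

Lemma cintegralD D f g : measurable D -> cintegrable D f -> cintegrable D g ->
  cintegral D (fun x => f x + g x) = cintegral D f + cintegral D g.
Proof.
move=> mD [f1 f2] [g1 g2]; apply: complex_ext; rewrite !ReImE /=.
- by under eq_Rintegral do rewrite ReImE; exact: RintegralD.
- by under eq_Rintegral do rewrite ReImE; exact: RintegralD.
Qed.

Lemma cintegrableZ D s f : measurable D -> cintegrable D f ->
  cintegrable D (fun x => s * f x).
Proof.
move=> mD [f1 f2]; split.
- have := @integrableB _ _ _ mu D mD _ _ (@integrableZl _ _ _ mu D mD (complex.Re s) _ f1)
    (@integrableZl _ _ _ mu D mD (complex.Im s) _ f2).
  by congr (integrable _ _ _); apply/funext => x; rewrite -[RHS]/((complex.Re (s * f x))%:E) cReM.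
- have := @integrableD _ _ _ mu D mD _ _ (@integrableZl _ _ _ mu D mD (complex.Re s) _ f2)
    (@integrableZl _ _ _ mu D mD (complex.Im s) _ f1).
  by congr (integrable _ _ _); apply/funext => x; rewrite -[RHS]/((complex.Im (s * f x))%:E) cImM.
Qed.

Lemma cintegralZ D s f : measurable D -> cintegrable D f ->
  cintegral D (fun x => s * f x) = s * cintegral D f.
Proof.
move=> mD [f1 f2].
have ZE (c : R) (u : R -> R) : mu.-integrable D (EFin \o u) ->
    mu.-integrable D (EFin \o (fun x => c * u x)).
  by move=> h; have := @integrableZl _ _ _ mu D mD c _ h.
apply: complex_ext; rewrite !ReImE /=.
- under eq_Rintegral do rewrite ReImE.
  by rewrite RintegralB// ?RintegralZl//; exact: ZE.
- under eq_Rintegral do rewrite ReImE.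
  by rewrite RintegralD// ?RintegralZl//; exact: ZE.
Qed.

Lemma cintegrableN D f : measurable D -> cintegrable D f ->
  cintegrable D (fun x => - f x).
Proof.
move=> mD /(cintegrableZ (-1) mD); congr (cintegrable D).
by apply/funext => x; rewrite mulN1r.
Qed.

Lemma cintegralN D f : measurable D -> cintegrable D f ->
  cintegral D (fun x => - f x) = - cintegral D f.
Proof.
move=> mD fi; rewrite -mulN1r -cintegralZ//; apply: cintegral_eq => x _.
by rewrite mulN1r.
Qed.

Lemma cintegralB D f g : measurable D -> cintegrable D f -> cintegrable D g ->
  cintegral D (fun x => f x - g x) = cintegral D f - cintegral D g.
Proof.
move=> mD fi gi; rewrite -cintegralN// -cintegralD//; exact: cintegrableN.
Qed.

(** A substitute for Cauchy-Schwarz that avoids square roots of extended reals: the weight t remains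
    free and is taken large when the first factor is the small one. *)
Lemma normr_Re_cintegral_le D f g (t : R) : measurable D -> L2on D f -> L2on D g ->
  0 < t -> (`|complex.Re (cintegral D (fun x => (f x * g x)%R))|%:E <=
   t%:E * sqL2norm D f + t^-1%:E * sqL2norm D g)%E.
Proof.
move=> mD lf lg t0; have [i1 _] := L2on_cintegrable mD lf lg.
have t0' : 0 < t^-1 by rewrite invr_gt0.
rewrite /cintegral /= EFin_normr_Rintegral//.
apply: (le_trans (le_abse_integral mu mD (measurable_int mu i1))).
have sf := cmeasurable_sqnormc lf.1; have sg := cmeasurable_sqnormc lg.1.
have s0 (h : R -> R[i]) x : D x -> (0 <= (sqnormc (h x))%:E)%E by rewrite lee_fin sqnormc_ge0.
rewrite /sqL2norm -!ge0_integralZl//; try (exact: s0); try by rewrite lee_fin ltW.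
rewrite -ge0_integralD//; try exact: measurable_funeM; last 2 first.
- by move=> x Dx; rewrite mule_ge0// ?s0// lee_fin ltW.
- by move=> x Dx; rewrite mule_ge0// ?s0// lee_fin ltW.
apply: ge0_le_integral => //.
- by apply: measurableT_comp => //; exact: measurable_int i1.
- apply: emeasurable_funD; apply: measurable_funeM.
  + exact: (cmeasurable_sqnormc lf.1).
  + exact: (cmeasurable_sqnormc lg.1).
- by move=> x _; rewrite -!EFinM -EFinD /= lee_fin normr_Re_mul_le.
Qed.

Lemma cintegral_mul_continuous0 D g (eta : R) : measurable D -> L2on D g -> 0 < eta ->
  exists2 e : R, 0 < e & forall f, L2on D f -> (sqL2norm D f < e%:E)%E ->
    `|complex.Re (cintegral D (fun x => f x * g x))| <= eta /\
    `|complex.Im (cintegral D (fun x => f x * g x))| <= eta.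
Proof.
move=> mD lg eta0.
have gf : sqL2norm D g \is a fin_num by rewrite ge0_fin_numE ?sqL2norm_ge0//; exact: lg.2.
set N := fine (sqL2norm D g); have N0 : 0 <= N by rewrite fine_ge0 ?sqL2norm_ge0.
(* This weight makes the term in g at most eta / 2; the bound imposed on f is then chosen so that t
   times it is eta / 2. The summand 1 keeps t positive when g has norm 0. *)
pose t := 2 * (N + 1) / eta; have t0 : 0 < t by rewrite divr_gt0// mulr_gt0// ltr_wpDl.
exists (eta / 2 / t); first by rewrite divr_gt0// divr_gt0.
have bnd f h : L2on D f -> (sqL2norm D f < (eta / 2 / t)%:E)%E -> L2on D h ->
    sqL2norm D h = sqL2norm D g ->
    `|complex.Re (cintegral D (fun x => f x * h x))| <= eta.
  move=> lf fe lh hg.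
  have := normr_Re_cintegral_le mD lf lh t0; rewrite hg -(fineK gf) -/N.
  have ff : sqL2norm D f \is a fin_num by rewrite ge0_fin_numE ?sqL2norm_ge0//; exact: lf.2.
  move: fe; rewrite -(fineK ff) lte_fin -!EFinM -EFinD lee_fin => fe.
  move/le_trans; apply.
  have h1 : t * fine (sqL2norm D f) <= eta / 2 by rewrite mulrC -ler_pdivlMr// ltW.
  have h2 : t^-1 * N <= eta / 2.
    rewrite /t invf_div mulrC mulrA ler_pdivrMr ?mulr_gt0 ?ltr_wpDl//.
    have := eta0; nra.
  by lra.
move=> f lf fe; split; first exact: bnd.
have lg' : L2on D (fun x => 'i * - g x) by apply: L2onZ => //; exact: L2onN.
have E : complex.Im (cintegral D (fun x => f x * g x)) =
    complex.Re (cintegral D (fun x => f x * ('i * - g x))).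
  by apply: eq_Rintegral => x _; rewrite -Im_mul.
rewrite E; apply: bnd => //; rewrite sqL2normZ ?sqL2normN//; last first.
  exact: cmeasurableN lg.1.
by rewrite /sqnormc /= expr0n expr1n add0r mul1e.
Qed.

(** The concluding device of the density arguments: z is the defect of an identity, and subtracting
    an approximant expresses it through small functions. There are two terms because Green's formula
    pairs a function and a derivative of it at once. *)
Lemma cintegral_small2 D g1 g2 (z : R[i]) : measurable D -> L2on D g1 -> L2on D g2 ->
  (forall e : R, 0 < e -> exists f1 f2, [/\ L2on D f1 /\ L2on D f2,
     (sqL2norm D f1 < e%:E)%E, (sqL2norm D f2 < e%:E)%E &
     cintegral D (fun x => f1 x * g1 x) + cintegral D (fun x => f2 x * g2 x) = z]) -> z = 0.
Proof.
move=> mD lg1 lg2 H.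
suff K eta : 0 < eta -> `|complex.Re z| <= 0 + eta /\ `|complex.Im z| <= 0 + eta.
  by apply: complex_ext; apply/eqP; rewrite -normr_le0; apply/ler_addgt0Pl => e e0;
     rewrite addrC; have [] := K e e0.
move=> eta0; have eta2 : 0 < eta / 2 by rewrite divr_gt0.
have [e1 e10 h1] := cintegral_mul_continuous0 mD lg1 eta2.
have [e2 e20 h2] := cintegral_mul_continuous0 mD lg2 eta2.
have [|f1 [f2 [[l1 l2] n1 n2 <-]]] := H (Num.min e1 e2); first by rewrite lt_min e10.
have [|r1 i1] := h1 f1 l1; first by rewrite (lt_le_trans n1)// lee_fin ge_min lexx.
have [|r2 i2] := h2 f2 l2; first by rewrite (lt_le_trans n2)// lee_fin ge_min lexx orbT.
rewrite !ReImE add0r; split; apply: (le_trans (ler_normD _ _)); lra.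
Qed.

Lemma cintegral_small D g (z : R[i]) : measurable D -> L2on D g ->
  (forall e : R, 0 < e -> exists f, [/\ L2on D f, (sqL2norm D f < e%:E)%E &
     cintegral D (fun x => f x * g x) = z]) -> z = 0.
Proof.
move=> mD lg H; apply: (cintegral_small2 mD lg lg) => e /H[f [lf fe fz]].
have z0 : sqL2norm D (fun=> 0) = 0%E.
  by apply: integral0_eq => x _; rewrite /sqnormc /= expr0n addr0.
have c0 : cintegral D (fun x => 0 * g x) = 0.
  rewrite /cintegral; apply: complex_ext => /=; rewrite /Rintegral integral0_eq// => x _;
  by rewrite mul0r.
exists f, (fun=> 0); split => //.
- by split=> //; split; [exact: cmeasurable_cst|rewrite z0 ltry].
- by rewrite z0; apply: le_lt_trans fe; exact: sqL2norm_ge0.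
- by rewrite c0 addr0.
Qed.

End square_integrable_functions.

(** * Integration by parts for smooth functions *)

Section integration_by_parts.
Context {R : realType}.
Local Notation mu := (@lebesgue_measure R).
Implicit Types (f g h phi : R -> R[i]).

Lemma Rintegral_is_derive (a b : R) (F f : R -> R) : a < b -> continuous f ->
  (forall x, is_derive x (1 : R) F (f x)) ->
  (\int[mu]_(x in [set` `]a, b[ ]) f x)%R = F b - F a.
Proof.
move=> ab cf dF.
have cF : continuous F.
  move=> x; have h := dF x.
  apply/differentiable_continuous/derivable1_diffP; exact: ex_derive.
rewrite /Rintegral integral_itv_obnd_cbnd; last first.
  by apply: measurable_funTS; apply/measurable_EFinP; exact: continuous_measurable_fun.
rewrite integral_itv_bndo_bndc; last first.
  by apply: measurable_funTS; apply/measurable_EFinP; exact: continuous_measurable_fun.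
rewrite (@continuous_FTC2 _ f F)//.
- exact: continuous_subspaceT.
- split; last 2 first.
  + by apply: cvg_at_right_filter; exact: cF.
  + by apply: cvg_at_left_filter; exact: cF.
  by move=> x _; have h := dF x; exact: ex_derive.
- by move=> x _; rewrite derive1E; have h := dF x; exact: derive_val.
Qed.

Lemma cintegral_cderive (a b : R) f : a < b -> csmooth f ->
  cintegral [set` `]a, b[ ] (cderive 1 f) = f b - f a.
Proof.
move=> ab sf; have [c1 c2] := csmooth_continuous (csmooth_cderive 1 sf).
have df := csmooth_is_cderive 0 sf; rewrite cderive0 in df.
apply: complex_ext; rewrite !ReImE /=.
- by apply: (@Rintegral_is_derive _ _ (fun x => complex.Re (f x)) _ ab c1) => x; have [] := df x.
- by apply: (@Rintegral_is_derive _ _ (fun x => complex.Im (f x)) _ ab c2) => x; have [] := df x.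
Qed.

Lemma cderive1_cderive n f : cderive 1 (cderive n f) = cderive n.+1 f.
Proof. by []. Qed.

Lemma cderive_cderive1 n f : cderive n (cderive 1 f) = cderive n.+1 f.
Proof. by rewrite /cderive /derive1n; apply/funext => x; congr (_ +i* _); rewrite -iterSr. Qed.

Lemma test_csmooth (a b : R) phi : test_function a b phi -> csmooth phi.
Proof. by case. Qed.

Lemma test_cderive (a b : R) n phi : a < b -> test_function a b phi ->
  test_function a b (cderive n phi).
Proof.
move=> ab tphi; have sphi := test_csmooth tphi.
have [c [d [ac cd db phi0]]] := test_functionE ab tphi.
apply: (test_functionI (csmooth_cderive n sphi) ac db).
have d0 m : cderive m (fun=> 0 : R[i]) = fun=> 0.
  elim: m => [|m IH]; first by rewrite cderive0.
  by rewrite -cderive_cderive1 (is_cderiveE (is_cderive_cst 0)).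
move=> x; rewrite negb_and -!ltNge => /orP[xc|dx].
- rewrite (@cderive_open _ [set` `]-oo, c[ ] _ _ (fun=> 0) (lray_open c)) ?d0//.
  by move=> y /=; rewrite in_itv /= => yc; rewrite phi0// negb_and -ltNge yc.
- rewrite (@cderive_open _ [set` `]d, +oo[ ] _ _ (fun=> 0) (rray_open d)) ?d0//.
  + by move=> y /=; rewrite in_itv /= andbT => yc; rewrite phi0// negb_and -!ltNge yc orbT.
  + by rewrite /= in_itv /= andbT.
Qed.

Lemma test_boundary (a b : R) phi : a < b -> test_function a b phi ->
  phi a = 0 /\ phi b = 0.
Proof.
move=> ab tphi; have [c [d [ac cd db phi0]]] := test_functionE ab tphi.
by split; apply: phi0; rewrite negb_and -!ltNge ?ac ?db ?orbT.
Qed.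

Lemma cintegral_by_parts (a b : R) f g : a < b -> csmooth f -> csmooth g ->
  f a * g a = 0 -> f b * g b = 0 ->
  cintegral [set` `]a, b[ ] (fun x => f x * cderive 1 g x) =
  - cintegral [set` `]a, b[ ] (fun x => cderive 1 f x * g x).
Proof.
move=> ab sf sg fa fb.
have dfg := is_cderiveM (csmooth_is_cderive 0 sf) (csmooth_is_cderive 0 sg).
rewrite !cderive0 in dfg.
have := cintegral_cderive ab (csmoothM sf sg).
rewrite (is_cderiveE dfg) fa fb subrr cintegralD//.
- by move/eqP; rewrite addrC addr_eq0 => /eqP.
- exact: L2on_cintegrable (measurable_itv _) (L2on_csmooth a b (csmooth_cderive 1 sf))
    (L2on_csmooth a b sg).
- exact: L2on_cintegrable (measurable_itv _) (L2on_csmooth a b sf)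
    (L2on_csmooth a b (csmooth_cderive 1 sg)).
Qed.

(** One derivative at a time passes to f; every derivative of phi vanishes at the endpoints, hence f
    is unrestricted there. *)
Lemma cintegral_by_parts_test (a b : R) k f phi : a < b -> csmooth f ->
  test_function a b phi ->
  cintegral [set` `]a, b[ ] (fun x => f x * cderive k phi x) =
  (-1) ^+ k * cintegral [set` `]a, b[ ] (fun x => cderive k f x * phi x).
Proof.
move=> ab sf tphi; elim: k f sf => [|k IH] f sf.
  by rewrite !cderive0 mul1r.
have tk := test_cderive k ab tphi; have [pa pb] := test_boundary ab tk.
have ea : f a * cderive k phi a = 0 by rewrite pa mulr0.
have eb : f b * cderive k phi b = 0 by rewrite pb mulr0.
rewrite -cderive1_cderive (cintegral_by_parts ab sf (test_csmooth tk) ea eb).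
by rewrite (IH _ (csmooth_cderive 1 sf)) cderive_cderive1 exprS mulN1r mulNr.
Qed.

End integration_by_parts.

(** * Density of the test functions in L^2 *)

Section density_of_test_functions.
Context {R : realType}.
Variables a b : R.
Local Notation mu := (@lebesgue_measure R).
Local Notation I := [set` `]a, b[ ].
Implicit Types (f g h phi : R -> R[i]) (A : set R).

(** Membership in the L^2 closure of the test functions, phrased for functions instead of classes
    and with squared norms, so that sums, limits and indicators can be treated pointwise. *)
Definition test_limit f := forall e : R, 0 < e -> exists2 phi,
  test_function a b phi & (sqL2norm I (fun x => f x - phi x)%R < e%:E)%E.

Lemma test_function0 : test_function a b (fun=> 0 : R[i]).
Proof.
have E : [set x : R | (0 : R[i]) != 0] = set0.
  by apply/seteqP; split => x //=; rewrite eqxx.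
split; rewrite ?E ?closure0//; first exact: csmooth_cst.
exact: compact0.
Qed.

Lemma test_functionD f g : a < b -> test_function a b f -> test_function a b g ->
  test_function a b (fun x => f x + g x).
Proof.
move=> ab tf tg; have [c [d [ac cd db f0]]] := test_functionE ab tf.
have [c' [d' [ac' cd' db' g0]]] := test_functionE ab tg.
apply: (@test_functionI _ a b (Num.min c c') (Num.max d d')).
- exact: csmoothD (test_csmooth tf) (test_csmooth tg).
- by rewrite lt_min ac.
- by rewrite gt_max db.
- move=> x; rewrite ge_min le_max => h; rewrite f0 ?g0 ?addr0//;
  by apply: contra h => /andP[-> ->]; rewrite ?orbT.
Qed.

Lemma test_functionM f g : a < b -> csmooth f -> test_function a b g ->
  test_function a b (fun x => f x * g x).
Proof.
move=> ab sf tg; have [c [d [ac cd db g0]]] := test_functionE ab tg.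
apply: (test_functionI (csmoothM sf (test_csmooth tg)) ac db).
by move=> x /g0 ->; rewrite mulr0.
Qed.

Hypothesis ab : a < b.

Let mI : measurable I. Proof. exact: measurable_itv. Qed.

Lemma test_cmeasurable phi : test_function a b phi -> cmeasurable I phi.
Proof. by move=> /test_csmooth; exact: cmeasurable_csmooth. Qed.

Lemma test_limit_eq f g : (forall x, I x -> f x = g x) -> test_limit f -> test_limit g.
Proof.
move=> fg tf e /tf[phi tphi h]; exists phi; first exact: tphi.
by rewrite (@sqL2norm_eq _ _ _ (fun x => f x - phi x))// => x Ix; rewrite fg.
Qed.

Lemma test_limit_test phi : test_function a b phi -> test_limit phi.
Proof.
move=> tphi e e0; exists phi; first exact: tphi.
by rewrite /sqL2norm integral0_eq ?lte_fin// => x _; rewrite subrr /sqnormc /= expr0n addr0.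
Qed.

Lemma test_limitD f g : cmeasurable I f -> cmeasurable I g ->
  test_limit f -> test_limit g -> test_limit (fun x => f x + g x).
Proof.
(* A quarter each, since [sqL2normD] costs a factor 2 on both terms. *)
move=> mf mg tf tg e e0; have e4 : 0 < e / 4 by rewrite divr_gt0.
have [phi tphi h1] := tf _ e4; have [psi tpsi h2] := tg _ e4.
exists (fun x => phi x + psi x); first exact: test_functionD.
have m1 := cmeasurableB mf (test_cmeasurable tphi).
have m2 := cmeasurableB mg (test_cmeasurable tpsi).
rewrite (@sqL2norm_eq _ _ _ (fun x => (f x - phi x) + (g x - psi x))); last first.
  by move=> x _; ring.
apply: (le_lt_trans (sqL2normD mI m1 m2)).
have -> : e%:E = (2%:E * (e / 4)%:E + 2%:E * (e / 4)%:E)%E.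
  by rewrite -!EFinM -EFinD; congr (_%:E); lra.
by apply: lteD; rewrite lte_pmul2l ?lte_fin.
Qed.

Lemma test_limitZ s f : cmeasurable I f -> test_limit f -> test_limit (fun x => s * f x).
Proof.
move=> mf tf e e0.
have s0 : 0 < sqnormc s + 1 by rewrite ltr_wpDl// sqnormc_ge0.
have [phi tphi h] := tf (e / (sqnormc s + 1)) (divr_gt0 e0 s0).
exists (fun x => s * phi x).
  exact: (test_functionM ab (csmooth_cst s) tphi).
rewrite (@sqL2norm_eq _ _ _ (fun x => s * (f x - phi x))); last first.
  by move=> x _; rewrite mulrBr.
rewrite sqL2normZ//; last exact: cmeasurableB mf (test_cmeasurable tphi).
apply: (@le_lt_trans _ _ ((sqnormc s + 1)%:E * sqL2norm I (fun x => f x - phi x)%R)%E).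
  by rewrite lee_wpmul2r ?sqL2norm_ge0// lee_fin lerDl.
rewrite (@lt_le_trans _ _ ((sqnormc s + 1)%:E * (e / (sqnormc s + 1))%:E)%E)//.
  by rewrite lte_pmul2l.
by rewrite -EFinM lee_fin mulrC divfK ?gt_eqF.
Qed.

(** Dominated convergence brings some u n within e / 4 of f in squared norm, and a test function is
    then taken close to that u n. Half-lines, countable unions and approximation by simple functions
    all enter through this lemma. *)
Lemma test_limit_lim (u : nat -> R -> R[i]) f (g : R -> R) :
  (forall n, cmeasurable I (u n)) -> cmeasurable I f ->
  (forall n, test_limit (u n)) ->
  (forall x, I x -> sqnormc (f x - u n x) @[n --> \oo] --> (0 : R)) ->
  mu.-integrable I (EFin \o g) ->
  (forall n x, I x -> sqnormc (f x - u n x) <= g x) -> test_limit f.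
Proof.
move=> mu_u mf tu uf ig ug e e0; have e4 : 0 < e / 4 by rewrite divr_gt0.
have [n hn] : exists n, (sqL2norm I (fun x => f x - u n x)%R < (e / 4)%:E)%E.
  have h : (sqL2norm I (fun x => f x - u n x)%R @[n --> \oo] --> (\int[mu]_(x in I) 0))%E.
    apply: (@dominated_cvg _ _ R mu I mI
      (fun n x => (sqnormc (f x - u n x))%:E) (fun=> 0%E) (EFin \o g)) => //.
    - by move=> n; exact: (cmeasurable_sqnormc (cmeasurableB mf (mu_u n))).
    - by move=> x /uf h; apply/cvg_EFin => //; apply: nearW.
    - by move=> n x Ix; rewrite /= lee_fin ger0_norm ?sqnormc_ge0// ug.
  rewrite integral0 in h.
  have [N _ hN] : \forall n \near \oo, (sqL2norm I (fun x => f x - u n x)%R < (e / 4)%:E)%E.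
    have hs : nbhs (0%:E : \bar R) [set y | (y < (e / 4)%:E)%E].
      by apply: open_nbhs_nbhs; split; [exact: open_ereal_lt_ereal|rewrite /= lte_fin].
    exact: h hs.
  by exists N; exact: hN (leqnn N).
have [phi tphi h] := tu n _ e4.
exists phi; first exact: tphi.
rewrite (@sqL2norm_eq _ _ _ (fun x => (f x - u n x) + (u n x - phi x))); last first.
  by move=> x _; ring.
apply: (le_lt_trans (sqL2normD mI (cmeasurableB mf (mu_u n))
  (cmeasurableB (mu_u n) (test_cmeasurable tphi)))).
have -> : e%:E = (2%:E * (e / 4)%:E + 2%:E * (e / 4)%:E)%E.
  by rewrite -!EFinM -EFinD; congr (_%:E); lra.
by apply: lteD; rewrite lte_pmul2l ?lte_fin.
Qed.

Lemma cvg_eventually_cst (u : nat -> R) l : (exists N, forall n, (N <= n)%N -> u n = l) ->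
  u n @[n --> \oo] --> l.
Proof.
by move=> [N uN]; apply: cvg_near_cst; exists N.
Qed.

Lemma integrable_cst_itv (M : R) : mu.-integrable I (EFin \o (fun=> M)).
Proof.
apply/integrableP; split; first exact: measurable_cst.
by rewrite integral_cst// lte_mul_pinfty// mu_itv_oo.
Qed.

Definition cindic A : R -> R[i] := fun x => (\1_A x)%:C.

Lemma cmeasurable_real (r : R -> R) : measurable_fun I r -> cmeasurable I (fun x => (r x)%:C).
Proof. by move=> mr; split => //=; exact: measurable_cst. Qed.

Lemma cmeasurable_cindic A : measurable A -> cmeasurable I (cindic A).
Proof. by move=> mA; apply: cmeasurable_real; exact: measurable_indic. Qed.

Lemma cindicT A x : A x -> cindic A x = 1.
Proof. by move=> Ax; rewrite /cindic indicE mem_set. Qed.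

Lemma cindicF A x : ~ A x -> cindic A x = 0.
Proof. by move=> Ax; rewrite /cindic indicE memNset. Qed.

End density_of_test_functions.

(** * Plateau functions built from a smooth step *)

Section plateau_functions.
Context {R : realType}.
Variable eta : R -> R[i].
Hypotheses (seta : csmooth eta) (eta0 : forall x, x <= 0 -> eta x = 0)
  (eta1 : forall x, 1 <= x -> eta x = 1).
Implicit Types (c d k x : R).

(* Equal to 0 outside [c + 1/k, d - 1/k] and to 1 on [c + 2/k, d - 2/k]. *)
Definition plateau c d k x : R[i] := eta (k * x + (- k * c - 1)) * eta (- k * x + (k * d - 1)).

Lemma csmooth_plateau c d k : csmooth (plateau c d k).
Proof. exact: csmoothM (csmooth_affine _ _ seta) (csmooth_affine _ _ seta). Qed.

Lemma plateau0l c d k x : k * (x - c) <= 1 -> plateau c d k x = 0.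
Proof. by move=> h; rewrite /plateau eta0 ?mul0r//; lra. Qed.

Lemma plateau0r c d k x : k * (d - x) <= 1 -> plateau c d k x = 0.
Proof. by move=> h; rewrite /plateau [eta (- k * _ + _)]eta0 ?mulr0//; lra. Qed.

Lemma plateau1 c d k x : 2 <= k * (x - c) -> 2 <= k * (d - x) -> plateau c d k x = 1.
Proof. by move=> h1 h2; rewrite /plateau !eta1 ?mulr1//; lra. Qed.

(** Between 0 and 1 only smoothness of [eta] is known, and its values there may be complex; the
    bound comes from compactness of that interval. *)
Lemma eta_bounded : exists2 M, 0 < M & forall x, sqnormc (eta x) <= M.
Proof.
have [M M0 hM] := csmooth_bounded 0 1 seta.
have z0 : sqnormc (0 : R[i]) = 0 by rewrite /sqnormc /= expr0n addr0.
have z1 : sqnormc (1 : R[i]) = 1 by rewrite /sqnormc /= expr0n expr1n addr0.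
exists (M + 1); first lra.
move=> x; have [x0|x0] := leP x 0; first by rewrite eta0// z0; lra.
have [x1|x1] := leP 1 x; first by rewrite eta1// z1; lra.
have : sqnormc (eta x) <= M by apply: hM; apply/andP; split; lra.
lra.
Qed.

Lemma plateau_bounded : exists2 M, 0 < M & forall c d k x, sqnormc (plateau c d k x) <= M.
Proof.
have [M M0 hM] := eta_bounded; exists (M * M); first exact: mulr_gt0.
by move=> c d k x; rewrite /plateau sqnormcZ ler_pM ?sqnormc_ge0.
Qed.

Lemma test_plateau a b c d k : 0 < k -> a <= c -> d <= b ->
  test_function a b (plateau c d k).
Proof.
move=> k0 ac db; have k0' : 0 < k^-1 by rewrite invr_gt0.
apply: (@test_functionI _ a b (c + k^-1) (d - k^-1)).
- exact: csmooth_plateau.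
- lra.
- lra.
- move=> x; rewrite negb_and -!ltNge => /orP[h|h].
  + by apply: plateau0l; rewrite mulrC -ler_pdivlMr// mul1r; lra.
  + by apply: plateau0r; rewrite mulrC -ler_pdivlMr// mul1r; lra.
Qed.

Lemma eventually_large x : 0 < x -> exists N : nat, forall n, (N <= n)%N -> 2 <= n.+1%:R * x.
Proof.
move=> x0; have h : 0 <= 2 / x by rewrite divr_ge0// ltW.
exists (Num.bound (2 / x)) => n Nn.
rewrite -ler_pdivrMr// (le_trans (ltW (archi_boundP h)))// ler_nat.
exact: leqW.
Qed.

End plateau_functions.

Lemma sqnormc_real {R : realType} (r : R) : sqnormc r%:C = r ^+ 2.
Proof. by rewrite /sqnormc /= expr0n addr0. Qed.

(** * Indicators as limits of test functions *)

Section density.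
Context {R : realType}.
Variables (a b : R) (eta : R -> R[i]).
Hypotheses (ab : a < b) (seta : csmooth eta) (eta0 : forall x, x <= 0 -> eta x = 0)
  (eta1 : forall x, 1 <= x -> eta x = 1).
Local Notation mu := (@lebesgue_measure R).
Local Notation I := [set` `]a, b[ ].
Implicit Types (f g h phi : R -> R[i]) (A : set R).

Let mI : measurable I. Proof. exact: measurable_itv. Qed.

(** On I the indicator is the pointwise limit of ever steeper plateaus over the part of I beyond c.
    The start is moved to [Num.max a c] because test functions must vanish near a. *)
Lemma test_limit_ray (c : R) : test_limit a b (cindic [set` `]c, +oo[ ]).
Proof.
have [bc|cb] := leP b c.
  apply: (@test_limit_eq _ _ _ (fun=> 0)); last exact/test_limit_test/test_function0.
  move=> x /=; rewrite in_itv /= => /andP[_ xb]; rewrite cindicF//=.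
  by rewrite in_itv /= andbT; apply/negP; rewrite -leNgt; lra.
pose c' := Num.max a c.
have [M M0 hM] := plateau_bounded seta eta0 eta1.
have ac' : a <= c' by rewrite le_max lexx.
have mr : cmeasurable I (cindic [set` `]c, +oo[ ]).
  by apply: cmeasurable_cindic; exact: measurable_itv.
(* The majorant comes from [sqnormcD]: the indicator contributes at most 1 and the plateaus at most
   M. *)
apply: (@test_limit_lim _ a b (fun n => plateau eta c' b n.+1%:R) _ (fun=> 2 * (1 + M))) => //.
- by move=> n; exact: cmeasurable_csmooth mI (csmooth_plateau seta c' b n.+1%:R).
- by move=> n; apply: test_limit_test; exact: test_plateau.
- move=> x /=; rewrite in_itv /= => /andP[ax xb].
  apply: cvg_eventually_cst; have [c'x|xc'] := ltP c' x.
    have [N1 h1] := @eventually_large R (x - c') ltac:(lra).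
    have [N2 h2] := @eventually_large R (b - x) ltac:(lra).
    exists (maxn N1 N2) => n; rewrite geq_max => /andP[/h1 {}h1 /h2 {}h2].
    rewrite plateau1// cindicT ?subrr /= ?in_itv /= ?andbT; last first.
      by rewrite (le_lt_trans _ c'x)// le_max lexx orbT.
    by rewrite /sqnormc /= expr0n addr0.
  exists 0%N => n _; have h : n.+1%:R * (x - c') <= 1.
    by rewrite (@le_trans _ _ 0)// mulr_ge0_le0//; lra.
  rewrite plateau0l// cindicF ?subrr /= ?in_itv /= ?andbT; last first.
    by apply/negP; rewrite -leNgt; move: xc'; rewrite le_max leNgt ax.
  by rewrite /sqnormc /= expr0n addr0.
- exact: integrable_cst_itv.
- move=> n x _; apply: (le_trans (sqnormcD _ _)).
  have -> : sqnormc (- plateau eta c' b n.+1%:R x) = sqnormc (plateau eta c' b n.+1%:R x).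
    by rewrite /sqnormc !ReImE !sqrrN.
  have := hM c' b n.+1%:R x.
  have : sqnormc (cindic [set` `]c, +oo[ ] x) <= 1.
    rewrite /cindic /sqnormc /= expr0n addr0 indicE.
    by case: (_ \in _); rewrite ?expr0n ?expr1n.
  by lra.
Qed.

Lemma sum_indic_trivIset (A : nat -> set R) n x : trivIset setT A ->
  \sum_(k < n) \1_(A k) x = \1_(\bigcup_(k in [set k | (k < n)%N]) A k) x :> R.
Proof.
move=> tA; elim: n => [|n IH].
  rewrite big_ord0 indicE memNset// => -[k //].
rewrite big_ord_recr /= IH !indicE.
have [Anx|Anx] := pselect (A n x).
  rewrite (mem_set Anx) memNset ?add0r; last first.
    move=> [k /= kn Akx]; have := tA k n Logic.I Logic.I; move: kn => /[swap] -> ; last by exists x.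
    by rewrite ltnn.
  by rewrite mem_set//; exists n => //=.
rewrite (memNset Anx) addr0; congr (nat_of_bool _)%:R.
apply/idP/idP => /set_mem [k /= kn Akx]; apply/mem_set.
- by exists k => //=; exact: ltnW.
- exists k => //=; move: kn; rewrite ltnS leq_eqVlt => /orP[/eqP kn|//].
  by rewrite -kn in Anx.
Qed.

(* Dynkin's pi-lambda theorem, starting from the half-lines. *)
Lemma test_limit_indic A : measurable A -> test_limit a b (cindic A).
Proof.
suff H : measurable `<=` [set A : set R | measurable A /\ test_limit a b (cindic A)].
  by move=> /H[].
rewrite [X in X `<=` _]RGenOInfty.measurableE.
rewrite -[X in X `<=` _](setI_closed_g_dynkin_g_sigma_algebra); last first.
  move=> _ _ [x ->] [y ->]; exists (Num.max x y).
  apply/seteqP; split => z /=; rewrite !in_itv /= !andbT gt_max; last by move=> /andP[].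
  by move=> [-> ->].
apply: smallest_sub; last first.
  by move=> _ [x ->]; split; [exact: measurable_itv|exact: test_limit_ray].
have tT : test_limit a b (cindic setT).
  apply: test_limit_eq (test_limit_ray a) => x /=.
  by rewrite in_itv /= => /andP[ax _]; rewrite !cindicT//= in_itv /= ax.
split.
- by split; [exact: measurableT|].
- move=> X [mX tX]; split; first exact: measurableC.
  apply: (@test_limit_eq _ _ _ (fun x => cindic setT x + (-1) * cindic X x)).
    move=> x _; have [Xx|Xx] := pselect (X x).
      by rewrite (@cindicT _ setT x)// (@cindicT _ X x)// (@cindicF _ (~` X) x) ?mulr1 ?subrr.
    by rewrite (@cindicT _ setT x)// (@cindicF _ X x)// (@cindicT _ (~` X) x)// mulr0 addr0.
  apply: test_limitD => //.
  + by apply: cmeasurable_cindic; exact: measurableT.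
  + by apply: cmeasurableM; [exact: cmeasurable_cst|exact: cmeasurable_cindic].
  + by apply: test_limitZ => //; exact: cmeasurable_cindic.
- move=> F tF HF; have mF n : measurable (F n) by have [] := HF n.
  split; first by apply: bigcup_measurable => n _; exact: mF.
  (* Partial unions: by disjointness their indicators are finite sums, and at each point they
     eventually agree with that of the full union. *)
  pose G n := \bigcup_(k in [set k | (k < n)%N]) F k.
  have mG n : measurable (G n) by apply: bigcup_measurable => k _; exact: mF.
  apply: (@test_limit_lim _ a b (fun n => cindic (G n)) _ (fun=> 1)) => //.
  + by move=> n; exact: cmeasurable_cindic.
  + by apply: cmeasurable_cindic; apply: bigcup_measurable => n _; exact: mF.
  + elim => [|n IH].
      apply: (@test_limit_eq _ _ _ (fun=> 0)); last exact/test_limit_test/test_function0.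
      by move=> x _; rewrite cindicF// => -[].
    apply: (@test_limit_eq _ _ _ (fun x => cindic (G n) x + cindic (F n) x)).
      move=> x _; rewrite /cindic -!sum_indic_trivIset// big_ord_recr /=.
      by rewrite -rmorphD.
    apply: test_limitD => //; [exact: cmeasurable_cindic|exact: cmeasurable_cindic|].
    by have [] := HF n.
  + move=> x _; apply: cvg_eventually_cst.
    have [[k _ Fkx]|Fx] := pselect ((\bigcup_n F n) x).
      exists k.+1 => n kn; rewrite !cindicT ?subrr; first by rewrite /sqnormc /= expr0n addr0.
      * by exists k.
      * by exists k.
    exists 0%N => n _; rewrite !cindicF ?subrr; first by rewrite /sqnormc /= expr0n addr0.
    * by move=> [k _ Fkx]; apply: Fx; exists k.
    * by [].
  + exact: integrable_cst_itv.
  + move=> n x _; rewrite /cindic -rmorphB sqnormc_real !indicE.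
    by case: (_ \in _); case: (_ \in _); rewrite ?subrr ?subr0 ?sub0r ?sqrrN ?expr0n ?expr1n.
Qed.

End density.

(** * From indicators to all of L^2 *)

Section density_L2.
Context {R : realType}.
Variables (a b : R) (eta : R -> R[i]).
Hypotheses (ab : a < b) (seta : csmooth eta) (eta0 : forall x, x <= 0 -> eta x = 0)
  (eta1 : forall x, 1 <= x -> eta x = 1).
Local Notation mu := (@lebesgue_measure R).
Local Notation I := [set` `]a, b[ ].
Implicit Types (f g h phi : R -> R[i]) (A : set R).

Import HBNNSimple.

Let mI : measurable I. Proof. exact: measurable_itv. Qed.

Lemma test_limit_sfun (g : {nnsfun R >-> R}) : test_limit a b (fun x => (g x)%:C).
Proof.
(* Arbitrary finite lists of values in place of the range of g, so that the sum can be built by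
   induction. *)
pose G (s : seq R) := fun x => \sum_(y <- s) (y%:C * cindic (g @^-1` [set y]) x).
have mg y : measurable (g @^-1` [set y]) by exact: measurable_funPTI.
have H s : cmeasurable I (G s) /\ test_limit a b (G s).
  elim: s => [|y s [IH1 IH2]].
    have -> : G [::] = fun=> 0 by apply/funext => x; rewrite /G big_nil.
    by split; [exact: cmeasurable_cst|exact/test_limit_test/test_function0].
  have -> : G (y :: s) = fun x => y%:C * cindic (g @^-1` [set y]) x + G s x.
    by apply/funext => x; rewrite /G big_cons.
  have m1 : cmeasurable I (fun x => y%:C * cindic (g @^-1` [set y]) x).
    by apply: cmeasurableM; [exact: cmeasurable_cst|exact: cmeasurable_cindic].
  split; first exact: cmeasurableD.
  apply: test_limitD => //; apply: test_limitZ => //; first exact: cmeasurable_cindic.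
  exact: (test_limit_indic ab seta eta0 eta1 (mg y)).
apply: (test_limit_eq _ (H (finmap.enum_fset (fset_set (range g)))).2) => x _.
rewrite /G fimfunE fsbig_finite//= rmorph_sum /=.
by apply: eq_bigr => y _; rewrite rmorphM.
Qed.

(** Simple functions g n increase to r, and 0 <= r - g n <= r makes r^2 an integrable majorant of
    the squared errors. *)
Lemma test_limit_ge0 (r : R -> R) : (forall x, I x -> 0 <= r x) ->
  L2on I (fun x => (r x)%:C) -> test_limit a b (fun x => (r x)%:C).
Proof.
move=> r0 [[mr _] lr].
have mf : measurable_fun I (EFin \o r) by exact/measurable_EFinP.
have r0' x : I x -> (0 <= (EFin \o r) x)%E by move=> Ix; rewrite /= lee_fin r0.
pose g n := nnsfun_approx mI mf n.
have gr x : I x -> g n x @[n --> \oo] --> r x.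
  by move=> Ix; have /fine_cvgP[_] := cvg_nnsfun_approx mI mf r0' Ix.
have gle n x : I x -> g n x <= r x.
  move=> Ix; have nd : nondecreasing_seq (fun n => g n x).
    by move=> p q pq; have /lefP := nd_nnsfun_approx mI mf pq; exact.
  have := nondecreasing_cvgn_le nd (cvgP _ (gr x Ix)) n.
  by rewrite (cvg_lim _ (gr x Ix)).
apply: (@test_limit_lim _ a b (fun n x => (g n x)%:C) _ (fun x => sqnormc (r x)%:C)).
- by move=> n; apply: cmeasurable_real; apply: measurable_funTS.
- exact: cmeasurable_real.
- by move=> n; exact: test_limit_sfun.
- move=> x Ix; under eq_fun do rewrite -rmorphB sqnormc_real expr2.
  have h : r x - g n x @[n --> \oo] --> (0 : R).
    by rewrite -[X in _ --> X](subrr (r x)); apply: cvgB; [exact: cvg_cst|exact: gr].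
  have hh := cvgM h h; rewrite mulr0 in hh; exact: hh.
- by apply: sqnormc_integrable; split => //; exact: cmeasurable_real.
- move=> n x Ix; rewrite -rmorphB !sqnormc_real.
  have := gle n x Ix; have : 0 <= g n x by []; have := r0 x Ix; nra.
Qed.

Lemma test_limit_real (r : R -> R) : L2on I (fun x => (r x)%:C) ->
  test_limit a b (fun x => (r x)%:C).
Proof.
move=> [[mr _] lr].
have le1 x : `|Num.max (r x) 0| <= `|r x| by case: (leP 0 (r x)) => h; rewrite ?normr0.
have le2 x : `|Num.max (- r x) 0| <= `|r x|.
  by case: (leP 0 (- r x)) => h; rewrite ?normr0 ?normrN.
have L2max (u : R -> R) : measurable_fun I u -> (forall x, `|u x| <= `|r x|) ->
    L2on I (fun x => (u x)%:C).
  move=> um ur; split; first exact: cmeasurable_real.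
  apply: (le_lt_trans _ lr); apply: sqL2norm_le => //; try exact: cmeasurable_real.
  by move=> x _; rewrite !sqnormc_real -[u x ^+ 2]real_normK ?num_real// -[r x ^+ 2]real_normK ?num_real// lerXn2r ?nnegrE.
have m1 : measurable_fun I (fun x => Num.max (r x) 0) by apply: measurable_maxr.
have m2 : measurable_fun I (fun x => Num.max (- r x) 0).
  by apply: measurable_maxr => //; exact: measurableT_comp.
have l1 := L2max _ m1 le1; have l2 := L2max _ m2 le2.
apply: (@test_limit_eq _ _ _ (fun x => (Num.max (r x) 0)%:C + (-1) * (Num.max (- r x) 0)%:C)).
  move=> x _; rewrite mulN1r -rmorphB /=; congr (_%:C).
  case/orP: (le_total 0 (r x)) => h.
    by rewrite (max_l h) max_r ?oppr_le0// subr0.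
  by rewrite (max_r h) max_l ?oppr_ge0// sub0r opprK.
have t1 : test_limit a b (fun x => (Num.max (r x) 0)%:C).
  by apply: test_limit_ge0 l1 => x _; rewrite le_max lexx orbT.
have t2 : test_limit a b (fun x => (Num.max (- r x) 0)%:C).
  by apply: test_limit_ge0 l2 => x _; rewrite le_max lexx orbT.
apply: (test_limitD ab l1.1 _ t1 (test_limitZ ab (-1) l2.1 t2)).
exact: cmeasurableM (cmeasurable_cst _ _) l2.1.
Qed.

Lemma test_functions_dense f : L2on I f -> test_limit a b f.
Proof.
move=> [[mr mi] lf].
have L2part (u : R -> R) : measurable_fun I u ->
    (forall x, u x ^+ 2 <= sqnormc (f x)) -> L2on I (fun x => (u x)%:C).
  move=> um ur; split; first exact: cmeasurable_real.
  apply: (le_lt_trans _ lf); apply: sqL2norm_le => //.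
  by move=> x _; rewrite sqnormc_real.
have l1 := L2part _ mr (fun x => ltac:(rewrite lerDl sqr_ge0//)).
have l2 := L2part _ mi (fun x => ltac:(rewrite lerDr sqr_ge0//)).
apply: (@test_limit_eq _ _ _ (fun x => (complex.Re (f x))%:C + 'i * (complex.Im (f x))%:C)).
  by move=> x _; case: (f x) => u v; apply: complex_ext; rewrite !ReImE /=; ring.
apply: (test_limitD ab l1.1 _ (test_limit_real l1) (test_limitZ ab 'i l2.1 (test_limit_real l2))).
exact: cmeasurableM (cmeasurable_cst _ _) l2.1.
Qed.

(** The conjugate of f is a limit of test functions phi, and orthogonality turns the integral of
    |f|^2 into that of (conj f - phi) f, which is arbitrarily small. The conjugate compensates for
    the bilinearity of the pairing. *)
Lemma ae_eq0_of_test_orthogonal f : L2on I f ->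
  (forall phi, test_function a b phi -> cintegral I (fun x => f x * phi x) = 0) ->
  f = (fun=> 0) %[ae mu in I].
Proof.
move=> lf f0; apply: sqL2norm_eq0 => //; first exact: lf.1.
have lfc : L2on I (fun x => (f x)^*).
  have [[mr mi] lf2] := lf; split.
    split.
    - by have -> : (fun x => complex.Re (f x)^*) = (fun x => complex.Re (f x))
        by apply/funext => x; case: (f x).
    - have -> : (fun x => complex.Im (f x)^*) = (fun x => - complex.Im (f x))
        by apply/funext => x; case: (f x).
      exact: measurableT_comp.
  rewrite (_ : sqL2norm _ _ = sqL2norm I f)//; apply: eq_integral => x _.
  by case: (f x) => u v; rewrite /sqnormc /= sqrrN.
have ff : cintegral I (fun x => (f x)^* * f x) = 0.
  apply: (cintegral_small mI lf) => e e0.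
  have [phi tphi h] := test_functions_dense lfc e0.
  have lphi := L2on_csmooth a b (test_csmooth tphi).
  exists (fun x => (f x)^* - phi x); split => //; first exact: L2onB.
  rewrite (@cintegral_eq _ _ _ (fun x => (f x)^* * f x - phi x * f x)); last first.
    by move=> x _; rewrite mulrBl.
  rewrite cintegralB//; try exact: L2on_cintegrable.
  rewrite [X in _ - X](_ : _ = 0) ?subr0// -[RHS](f0 phi tphi).
  by apply: cintegral_eq => x _; rewrite mulrC.
have : complex.Re (cintegral I (fun x => (f x)^* * f x)) = 0 by rewrite ff.
rewrite /= => h.
have : fine (sqL2norm I f) = 0.
  rewrite -[RHS]h; apply: eq_Rintegral => x _.
  by case: (f x) => u v; rewrite /sqnormc /=; ring.
move/eqP; rewrite fine_eq0; first by move/eqP.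
by rewrite ge0_fin_numE ?sqL2norm_ge0//; exact: lf.2.
Qed.

End density_L2.

Local Open Scope quotient_scope.

(** * Weak derivatives and Sobolev spaces *)

Section L2loc_theory.
Context {R : realType} {a b : R} (E : exhaustion a b).
Hypothesis ab : a < b.
Local Notation mu := (@lebesgue_measure R).
Local Notation I := [set` `]a, b[ ].
Implicit Types (f g h phi : R -> R[i]) (u v w : L2loc E).

Let mI : measurable I. Proof. exact: measurable_itv. Qed.

Lemma poweR_half_lt (x : \bar R) (e : R) : (0 <= x)%E -> 0 < e ->
  ((x `^ 2^-1)%E < e%:E)%E = (x < (e ^+ 2)%:E)%E.
Proof.
case: x => [r| |] // r0 e0; last by rewrite poweRyr.
rewrite poweR_EFin !lte_fin powR12_sqrt; last by rewrite -lee_fin.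
by rewrite -[X in _ < X = _](ger0_norm (ltW e0)) -sqrtr_sqr ltr_sqrt// exprn_gt0.
Qed.

Lemma sqL2norm_extend (D D' : set R) f : D `<=` D' -> (forall x, ~ D x -> f x = 0) ->
  sqL2norm D f = sqL2norm D' f.
Proof.
move=> DD' f0; rewrite /sqL2norm integral_mkcond [RHS]integral_mkcond.
apply: eq_integral => x _; rewrite /patch; case: ifPn => xD; case: ifPn => xD' //.
- by move/negP: xD'; case; apply/mem_set/DD'/set_mem.
- rewrite f0 /sqnormc /= ?expr0n ?addr0// => Dx; move/negP: xD; apply.
  exact: mem_set.
Qed.

Lemma cintegral_extend (D D' : set R) f : D `<=` D' -> (forall x, ~ D x -> f x = 0) ->
  cintegral D f = cintegral D' f.
Proof.
move=> DD' f0; rewrite /cintegral; congr (_ +i* _);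
  rewrite Rintegral_mkcond [RHS]Rintegral_mkcond;
  apply: eq_Rintegral => x _; rewrite /patch; case: ifPn => xD; case: ifPn => xD' //.
- by move/negP: xD'; case; apply/mem_set/DD'/set_mem.
- by rewrite f0// => Dx; move/negP: xD; apply; exact: mem_set.
- by move/negP: xD'; case; apply/mem_set/DD'/set_mem.
- by rewrite f0// => Dx; move/negP: xD; apply; exact: mem_set.
Qed.

Lemma L2loc_add_ae u v : ((u + v : L2loc E) : R -> R[i]) = (fun x => u x + v x) %[ae mu in I].
Proof. exact: (repr_pi_L2loc E (repr u + repr v)). Qed.

Lemma L2loc_scale_ae c u : ((c *: u : L2loc E) : R -> R[i]) = (fun x => c * u x) %[ae mu in I].
Proof. exact: (repr_pi_L2loc E (c *: repr u)). Qed.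

Lemma L2loc_opp_ae u : ((- u : L2loc E) : R -> R[i]) = (fun x => - u x) %[ae mu in I].
Proof. exact: (repr_pi_L2loc E (- repr u)). Qed.

Lemma L2loc_sub_ae u v : ((u - v : L2loc E) : R -> R[i]) = (fun x => u x - v x) %[ae mu in I].
Proof.
apply: ae_imply2 (L2loc_add_ae u (- v)) (L2loc_opp_ae v) => x h1 h2 Ix.
by rewrite h1// h2.
Qed.

Lemma L2loc0_ae : ((0 : L2loc E) : R -> R[i]) = (fun=> 0) %[ae mu in I].
Proof. exact: (repr_pi_L2loc E 0). Qed.

Lemma L2loc_eqP u v : u = v <-> (u : R -> R[i]) = v %[ae mu in I].
Proof. by rewrite -[in X in X <-> _](reprK u) -[in X in X <-> _](reprK v); exact: pi_L2locP. Qed.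

Lemma L2loc_measurable u : cmeasurable I u.
Proof. by have /set_mem[] := L2loc_valP (repr u). Qed.

Lemma L2loc_segment (c d : R) u : a < c -> d < b ->
  (sqL2norm [set` `[c, d]] u < +oo)%E.
Proof.
move=> ac db; have /set_mem[_ h] := L2loc_valP (repr u); apply: h.
  exact: segment_compact.
by move=> x /=; rewrite !in_itv /= => /andP[cx xd]; rewrite (lt_le_trans ac cx) (le_lt_trans xd db).
Qed.

Lemma L2loc_exists f : L2on I f -> exists u, (u : R -> R[i]) = f %[ae mu in I].
Proof.
move=> [mf lf].
have fP : f \in locally_square_integrable a b.
  rewrite inE; split; first exact: mf.
  move=> K cK KI; apply: le_lt_trans lf; apply: ge0_subset_integral => //.
  - by apply: closed_measurable; exact: compact_closed.
  - exact: cmeasurable_sqnormc.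
  - by move=> x _; rewrite lee_fin sqnormc_ge0.
exists (\pi_(L2loc E) (L2locFun fP)); exact: repr_pi_L2loc.
Qed.

(** Passage from a concrete function to its class. The default 0 concerns functions without a class;
    smooth functions, being square integrable on the bounded interval I, have one by
    [L2loc_exists]. *)
Definition L2class f : L2loc E := xget 0 [set u : L2loc E | (u : R -> R[i]) = f %[ae mu in I]].

Lemma L2class_ae f : L2on I f -> (L2class f : R -> R[i]) = f %[ae mu in I].
Proof. 
move=> /L2loc_exists[u uf].
exact: (@xgetPex _ 0 [set u : L2loc E | (u : R -> R[i]) = f %[ae mu in I]] (ex_intro _ u uf)).
 Qed.

Lemma L2class_smooth_ae f : csmooth f -> (L2class f : R -> R[i]) = f %[ae mu in I].
Proof. by move=> sf; apply: L2class_ae; exact: L2on_csmooth. Qed.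

Lemma L2on_cindic_segment (c d : R) u : a < c -> d < b ->
  L2on I (fun x => cindic [set` `[c, d]] x * u x).
Proof.
move=> ac db; split.
  apply: cmeasurableM; last exact: L2loc_measurable.
  by apply: cmeasurable_cindic; exact: measurable_itv.
rewrite -(@sqL2norm_extend [set` `[c, d]]).
- rewrite (@sqL2norm_eq _ _ _ u); first exact: L2loc_segment.
  by move=> x cx; rewrite cindicT// mul1r.
- move=> x /=; rewrite !in_itv /= => /andP[cx xd].
  by rewrite (lt_le_trans ac cx) (le_lt_trans xd db).
- by move=> x cx; rewrite cindicF// mul0r.
Qed.

Lemma mul_cindic_supported (c d : R) (h phi : R -> R[i]) x : (forall x, ~~ (c <= x <= d) -> phi x = 0) ->
  h x * phi x = cindic [set` `[c, d]] x * h x * phi x.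
Proof.
move=> phi0; have [cx|cx] := boolP (c <= x <= d).
  by rewrite cindicT ?mul1r//= in_itv.
by rewrite phi0// !mulr0.
Qed.

(** An element of [L2loc] need not be square integrable on I; multiplied by the indicator of a
    segment that carries phi it is, and the product with phi does not change. *)
Lemma L2loc_test_cintegrable u phi : test_function a b phi ->
  cintegrable I (fun x => u x * phi x).
Proof.
move=> tphi; have [c [d [ac cd db phi0]]] := test_functionE ab tphi.
have -> : (fun x => u x * phi x) = (fun x => (cindic [set` `[c, d]] x * u x) * phi x).
  by apply/funext => x; exact: mul_cindic_supported.
apply: L2on_cintegrable => //; first exact: L2on_cindic_segment.
exact: L2on_csmooth (test_csmooth tphi).
Qed.

Lemma exhaustion_bounds n : a < lo E n /\ hi E n < b.
Proof.
have lh := lo_lt_hi E n; have cov := exhaustion_cover E.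
have h x : lo E n <= x <= hi E n -> a < x < b.
  move=> h; have : [set` `]a, b[ ] x by rewrite -cov; exists n => //=; rewrite in_itv.
  by rewrite /= in_itv.
have := h (lo E n); have := h (hi E n); rewrite !lexx !(ltW lh) /=.
by move=> /(_ isT)/andP[_ ->] /(_ isT)/andP[-> _].
Qed.

Lemma exhaustion_mono m n : (m < n)%N -> lo E n < lo E m /\ hi E m < hi E n.
Proof.
elim: n => [//|n IH]; rewrite ltnS => mn.
have lh := lo_lt_hi E n.
have h x : lo E n <= x <= hi E n -> lo E n.+1 < x < hi E n.+1.
  by move=> h; have /= := @exhaustion_incr _ _ _ E n x; rewrite !in_itv /=; exact.
have := h (lo E n); have := h (hi E n); rewrite !lexx !(ltW lh) /=.
move=> /(_ isT)/andP[_ h2] /(_ isT)/andP[h1 _].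
move: mn; rewrite leq_eqVlt => /orP[/eqP ->//|/IH[h3 h4]].
by rewrite (lt_trans h1 h3) (lt_trans h4 h2).
Qed.

Lemma ae_exhaustion (P : R -> Prop) :
  (forall n, {ae mu, forall x, [set` `]lo E n, hi E n[ ] x -> P x}) ->
  {ae mu, forall x, I x -> P x}.
Proof.
move=> h; have := ae_foralln h; apply: ae_imply => x {}h Ix.
have := exhaustion_cover E; move=> /seteqP[_] /(_ x Ix)[n _ nx].
by apply: (h n.+1); exact: (exhaustion_incr nx).
Qed.

(** Square integrability of u is available on the inner intervals of the exhaustion. Their test
    functions are test functions of I too, so u vanishes almost everywhere on each of these
    countably many intervals. *)
Lemma L2loc_eq0 u : (forall phi, test_function a b phi ->
    cintegral I (fun x => u x * phi x) = 0) -> u = 0.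
Proof.
move=> u0; apply/L2loc_eqP.
suff : (u : R -> R[i]) = (fun=> 0) %[ae mu in I].
  by move/(ae_imply2 _) => H; apply: H L2loc0_ae => x h1 h2 Ix; rewrite h1// h2.
have [eta [seta eta0 eta1]] := smooth_step E.
apply: ae_exhaustion => n; have [al hb] := exhaustion_bounds n; have lh := lo_lt_hi E n.
have sub : [set` `]lo E n, hi E n[ ] `<=` I.
  by move=> x /=; rewrite !in_itv /= => /andP[cx xd]; rewrite (lt_trans al cx) (lt_trans xd hb).
apply: (ae_eq0_of_test_orthogonal lh seta eta0 eta1).
  split.
    by have [m1 m2] := L2loc_measurable u; split; [apply: measurable_funS m1|apply: measurable_funS m2].
  apply: (le_lt_trans _ (L2loc_segment u al hb)).
  apply: ge0_subset_integral => //.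
  - apply: measurable_funS (cmeasurable_sqnormc (L2loc_measurable u)) => //.
    by move=> x /=; rewrite !in_itv /= => /andP[cx xd]; rewrite (lt_le_trans al cx) (le_lt_trans xd hb).
  - by move=> x _; rewrite lee_fin sqnormc_ge0.
  - exact: subset_itv_oo_cc.
move=> phi tphi; have [c [d [ac cd db phi0]]] := test_functionE lh tphi.
rewrite (cintegral_extend sub).
  apply: u0; apply: (test_functionI (test_csmooth tphi) _ _ phi0); first exact: lt_trans ac.
  exact: lt_trans hb.
move=> x xn; rewrite phi0 ?mulr0//; apply/negP => /andP[cx xd]; apply: xn.
by rewrite /= in_itv /= (lt_le_trans ac cx) (le_lt_trans xd db).
Qed.

Lemma cmeasurable_ltest u phi : test_function a b phi -> cmeasurable I (fun x => u x * phi x).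
Proof.
by move=> tphi; apply: cmeasurableM; [exact: L2loc_measurable|exact: test_cmeasurable].
Qed.

Lemma cintegral_L2locB u v phi : test_function a b phi ->
  cintegral I (fun x => (u - v : L2loc E) x * phi x) =
  cintegral I (fun x => u x * phi x) - cintegral I (fun x => v x * phi x).
Proof.
move=> tphi; rewrite -cintegralB//; try exact: L2loc_test_cintegrable.
apply: cintegral_ae => //; first exact: cmeasurable_ltest.
  by apply: cmeasurableB; exact: cmeasurable_ltest.
by apply: ae_imply (L2loc_sub_ae u v) => x h Ix; rewrite h// mulrBl.
Qed.

Lemma weak_derivative_unique k u v w : is_weak_derivative k u v ->
  is_weak_derivative k u w -> v = w.
Proof.
move=> hv hw; apply/eqP; rewrite -subr_eq0; apply/eqP; apply: L2loc_eq0 => phi tphi.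
rewrite cintegral_L2locB//; have := hv _ tphi; rewrite hw// => /eqP.
rewrite -subr_eq0 -mulrBr mulf_eq0 signr_eq0 /= subr_eq0 => /eqP ->.
by rewrite subrr.
Qed.

Lemma weak_derivativeE k u v : is_weak_derivative k u v -> weak_derivative k u = v.
Proof.
by move=> h; apply: weak_derivative_unique (xgetPex 0 (ex_intro _ v h)) h.
Qed.

Lemma is_weak_derivativeB k u u' v v' : is_weak_derivative k u u' ->
  is_weak_derivative k v v' -> is_weak_derivative k (u - v)%R (u' - v')%R.
Proof.
move=> hu hv phi tphi; rewrite !cintegral_L2locB ?mulrBr ?hu ?hv//.
exact: test_cderive.
Qed.

Lemma is_weak_derivative0 u : is_weak_derivative 0 u u.
Proof. by move=> phi tphi; rewrite cderive0 mul1r. Qed.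

Lemma L2class_weak_derivative k f : csmooth f ->
  is_weak_derivative k (L2class f) (L2class (cderive k f)).
Proof.
move=> sf phi tphi; have sk := csmooth_cderive k sf.
have tk := test_cderive k ab tphi.
rewrite (@cintegral_ae _ _ _ (fun x => f x * cderive k phi x)) ?cintegral_by_parts_test//.
- congr (_ * _); apply: cintegral_ae => //.
  + by apply: cmeasurableM; [exact: cmeasurable_csmooth|exact: test_cmeasurable].
  + exact: cmeasurable_ltest.
  + by apply: ae_imply (L2class_smooth_ae sk) => x h Ix; rewrite h.
- exact: cmeasurable_ltest.
- by apply: cmeasurableM; [exact: cmeasurable_csmooth|exact: test_cmeasurable].
- by apply: ae_imply (L2class_smooth_ae sf) => x h Ix; rewrite h.
Qed.

Lemma L2class_square_integrable f : csmooth f -> square_integrable (L2class f).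
Proof.
move=> sf; rewrite /square_integrable /= (@sqL2norm_ae _ _ _ f)//.
- by have [] := L2on_csmooth a b sf.
- exact: L2loc_measurable.
- exact: cmeasurable_csmooth.
- exact: L2class_smooth_ae.
Qed.

Lemma square_integrable_L2on u : square_integrable u -> L2on I u.
Proof. by split; [exact: L2loc_measurable|]. Qed.

Lemma L2class_sobolev k f : csmooth f -> sobolev k (L2class f).
Proof.
move=> sf j jk; exists (L2class (cderive j f)).
- exact: L2class_square_integrable (csmooth_cderive j sf).
- exact: L2class_weak_derivative.
Qed.

Lemma sobolev_weak_derivative k j u : sobolev k u -> (j <= k)%N ->
  square_integrable (weak_derivative j u) /\ is_weak_derivative j u (weak_derivative j u).
Proof.
by move=> su jk; have [v sv hv] := su j jk; rewrite (weak_derivativeE hv).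
Qed.

Lemma sobolev_norm_lt k u (e : R) : 0 < e -> (sobolev_norm k u < e%:E)%E ->
  forall j, (j <= k)%N -> (sqL2norm I (weak_derivative j u) < (e ^+ 2)%:E)%E.
Proof.
move=> e0; rewrite /sobolev_norm poweR_half_lt//; last first.
  by apply: sume_ge0 => i _; exact: sqL2norm_ge0.
move=> h j jk; apply: le_lt_trans h; rewrite (bigD1 (Ordinal (jk : (j < k.+1)%N)))//=.
by rewrite leeDl// sume_ge0// => i _; exact: sqL2norm_ge0.
Qed.

(** There are k + 1 summands, each below the fraction 1 / (k + 2) of e^2: the spare fraction keeps
    the inequality strict after a termwise non-strict comparison. *)
Lemma lt_sobolev_norm k u (e : R) : 0 < e ->
  (forall j, (j <= k)%N -> (sqL2norm I (weak_derivative j u) < (e ^+ 2 / k.+2%:R)%:E)%E) ->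
  (sobolev_norm k u < e%:E)%E.
Proof.
move=> e0 h; rewrite /sobolev_norm poweR_half_lt//; last first.
  by apply: sume_ge0 => i _; exact: sqL2norm_ge0.
apply: (@le_lt_trans _ _ (\sum_(j < k.+1) (e ^+ 2 / k.+2%:R)%:E)%E).
  by apply: lee_sum => i _; apply/ltW/h; rewrite -ltnS.
rewrite sumEFin lte_fin sumr_const card_ord -[X in X < _](mulr_natr (e ^+ 2 / k.+2%:R)).
rewrite -mulrA gtr_pMr ?exprn_gt0// mulrC ltr_pdivrMr// mul1r ltr_nat.
exact: ltnSn.
Qed.

End L2loc_theory.

(** * Green's formula on H^k_0 and uniqueness of preimages *)

Section sobolev_theory.
Context {R : realType} {a b : R} (E : exhaustion a b).
Hypothesis ab : a < b.
Local Notation mu := (@lebesgue_measure R).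
Local Notation I := [set` `]a, b[ ].
Implicit Types (f g h phi : R -> R[i]) (u v w : L2loc E).

Let mI : measurable I. Proof. exact: measurable_itv. Qed.

Lemma sqnormc0 : sqnormc (0 : R[i]) = 0.
Proof. by rewrite /sqnormc /= expr0n addr0. Qed.

Lemma sqL2norm0 : sqL2norm I (0 : L2loc E) = 0%E.
Proof.
rewrite (@sqL2norm_ae _ _ _ (fun=> 0))//.
- by apply: integral0_eq => x _; rewrite sqnormc0.
- exact: L2loc_measurable.
- exact: L2loc0_ae.
Qed.

Lemma weak_derivative_zero k : weak_derivative k (0 : L2loc E) = 0.
Proof.
apply: (weak_derivativeE ab) => phi tphi.
have i0 psi : test_function a b psi -> cintegral I (fun x => (0 : L2loc E) x * psi x) = 0.
  move=> tpsi; rewrite (@cintegral_ae _ _ _ (fun=> 0))//.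
  - by rewrite /cintegral; apply: complex_ext => /=; rewrite /Rintegral integral0_eq.
  - exact: cmeasurable_ltest.
  - by apply: ae_imply (L2loc0_ae E) => x h Ix; rewrite h// mul0r.
by rewrite !i0 ?mulr0//; exact: test_cderive.
Qed.

Lemma L2class_test phi : test_function a b phi -> test_functions (L2class E phi).
Proof. by move=> tphi; exists phi; [exact: tphi|exact: L2class_smooth_ae (test_csmooth tphi)]. Qed.

Lemma test_functionsP w : test_functions w -> exists2 phi, test_function a b phi & w = L2class E phi.
Proof.
move=> [phi tphi h]; exists phi; first exact: tphi.
apply/L2loc_eqP; apply: ae_imply2 h (L2class_smooth_ae E (test_csmooth tphi)) => x h1 h2 Ix.
by rewrite h1// h2.
Qed.

Lemma test_functions_sobolev k w : test_functions w -> sobolev k w.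
Proof. by move=> /test_functionsP[phi tphi ->]; exact: L2class_sobolev (test_csmooth tphi). Qed.

Lemma test_functions_sobolev0 k w : test_functions w -> sobolev0 k w.
Proof.
move=> tw; split; first exact: test_functions_sobolev.
move=> e e0; exists w => //; rewrite subrr; apply: lt_sobolev_norm => // j _.
by rewrite weak_derivative_zero sqL2norm0 lte_fin divr_gt0// exprn_gt0.
Qed.

Lemma L2class_weak_derivativeE k f : csmooth f -> weak_derivative k (L2class E f) = L2class E (cderive k f).
Proof. by move=> sf; apply: (weak_derivativeE ab); exact: L2class_weak_derivative. Qed.

Lemma L2on_L2loc_csmooth u f : square_integrable u -> csmooth f ->
  cintegrable I (fun x => u x * f x).
Proof.
move=> su sf; apply: L2on_cintegrable => //; first exact: square_integrable_L2on.
exact: L2on_csmooth.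
Qed.

Lemma cmeasurable_L2loc_csmooth u f : csmooth f -> cmeasurable I (fun x => u x * f x).
Proof.
by move=> sf; apply: cmeasurableM; [exact: L2loc_measurable|exact: cmeasurable_csmooth].
Qed.

Lemma cintegral_cls f h : csmooth f -> csmooth h ->
  cintegral I (fun x => L2class E f x * h x) = cintegral I (fun x => f x * h x).
Proof.
move=> sf sh; apply: cintegral_ae => //.
- exact: cmeasurable_L2loc_csmooth.
- by apply: cmeasurableM; exact: cmeasurable_csmooth.
- by apply: ae_imply (L2class_smooth_ae E sf) => x hx Ix; rewrite hx.
Qed.

Lemma square_integrableB u v : square_integrable u -> square_integrable v ->
  square_integrable (u - v).
Proof.
move=> su sv; rewrite /square_integrable /= (@sqL2norm_ae _ _ _ (fun x => u x - v x))//.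
- by have [] := L2onB mI (square_integrable_L2on su) (square_integrable_L2on sv).
- exact: L2loc_measurable.
- by apply: cmeasurableB; exact: L2loc_measurable.
- exact: L2loc_sub_ae.
Qed.

Lemma cintegral_L2loc_csmoothB u v h : square_integrable u -> square_integrable v -> csmooth h ->
  cintegral I (fun x => (u - v : L2loc E) x * h x) =
  cintegral I (fun x => u x * h x) - cintegral I (fun x => v x * h x).
Proof.
move=> su sv sh; rewrite -cintegralB//; try exact: L2on_L2loc_csmooth.
apply: cintegral_ae => //; first exact: cmeasurable_L2loc_csmooth.
  by apply: cmeasurableB; exact: cmeasurable_L2loc_csmooth.
by apply: ae_imply (L2loc_sub_ae u v) => x hx Ix; rewrite hx// mulrBl.
Qed.

Lemma L2class_by_parts k phi h : test_function a b phi -> csmooth h ->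
  cintegral I (fun x => L2class E (cderive k phi) x * h x) =
  (-1) ^+ k * cintegral I (fun x => L2class E phi x * cderive k h x).
Proof.
move=> tphi sh; have sphi := test_csmooth tphi.
rewrite (cintegral_cls (csmooth_cderive k sphi) sh) (cintegral_cls sphi (csmooth_cderive k sh)).
have := cintegral_by_parts_test k ab sh tphi.
rewrite (@cintegral_eq _ _ _ (fun x => cderive k phi x * h x)); last by move=> x _; rewrite mulrC.
by move=> ->; congr (_ * _); apply: cintegral_eq => x _; rewrite mulrC.
Qed.

(** For a test function w in place of u this is integration by parts, valid for any h since w
    vanishes near the endpoints. The defect for u equals the defect for u - w, which is small
    because u - w and its j-th derivative are. *)
Lemma sobolev0_green k j u h : sobolev0 k u -> (j <= k)%N -> csmooth h ->
  cintegral I (fun x => weak_derivative j u x * h x) =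
  (-1) ^+ j * cintegral I (fun x => u x * cderive j h x).
Proof.
move=> [su u0] jk sh; have shj := csmooth_cderive j sh.
have [sj hj] := sobolev_weak_derivative ab su jk.
have [s0 h0] := sobolev_weak_derivative ab su (leq0n k).
rewrite (weak_derivativeE ab (@is_weak_derivative0 _ _ _ E u)) in s0 h0.
apply/eqP; rewrite -subr_eq0; apply/eqP.
(* The sign is put into the second partner so that the defect is a sum of two pairings, as
   [cintegral_small2] expects. *)
have lh2 : L2on I (fun x => - (-1) ^+ j * cderive j h x).
  by apply: L2onZ => //; exact: L2on_csmooth.
apply: (cintegral_small2 mI (L2on_csmooth a b sh) lh2) => e e0.
have se : 0 < Num.sqrt e by rewrite sqrtr_gt0.
have [w tw wn] := u0 _ se; have := sobolev_norm_lt se wn.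
rewrite sqr_sqrtr ?(ltW e0)// => wlt.
have [phi tphi wE] := test_functionsP tw; have sphi := test_csmooth tphi.
have wj := L2class_weak_derivative E ab j sphi; rewrite -wE in wj.
have w0 := @is_weak_derivative0 _ _ _ E w.
have dj := weak_derivativeE ab (is_weak_derivativeB ab hj wj).
have d0 := weak_derivativeE ab (@is_weak_derivative0 _ _ _ E (u - w)).
have swj : square_integrable (L2class E (cderive j phi)) by apply: L2class_square_integrable; exact: csmooth_cderive.
have sw : square_integrable w by rewrite wE; exact: L2class_square_integrable.
have s1 := square_integrableB sj swj; have s2 := square_integrableB s0 sw.
exists (weak_derivative j u - L2class E (cderive j phi) : L2loc E), (u - w : L2loc E); split.
- by split; exact: square_integrable_L2on.
- by rewrite -dj; exact: wlt jk.
- by rewrite -d0; exact: wlt (leq0n k).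
rewrite cintegral_L2loc_csmoothB// L2class_by_parts// -wE.
rewrite (@cintegral_eq _ _ (fun x => (u - w : L2loc E) x * (- (-1) ^+ j * cderive j h x))
  (fun x => - (-1) ^+ j * ((u - w : L2loc E) x * cderive j h x))); last by move=> x _; ring.
rewrite cintegralZ//; last exact: L2on_L2loc_csmooth.
by rewrite cintegral_L2loc_csmoothB//; ring.
Qed.

(* [B] stands for the boundary conditions under which Green's formula holds for [u] and [v]. *)
Lemma eigenfunction_unique (B : (R -> R[i]) -> Prop) u v (lam : R[i]) :
  sobolev 2 u -> sobolev 2 v ->
  (forall h, csmooth h -> B h ->
    cintegral I (fun x => weak_derivative 2 u x * h x) = cintegral I (fun x => u x * cderive 2 h x)) ->
  (forall h, csmooth h -> B h ->
    cintegral I (fun x => weak_derivative 2 v x * h x) = cintegral I (fun x => v x * cderive 2 h x)) ->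
  (forall g, test_function a b g -> exists h, [/\ csmooth h, B h &
    cderive 2 h = (fun x => lam * h x + g x)]) ->
  lam *: u - weak_derivative 2 u = lam *: v - weak_derivative 2 v -> u = v.
Proof.
move=> su sv gu gv H uv; apply/eqP; rewrite -subr_eq0; apply/eqP.
have [s2u h2u] := sobolev_weak_derivative ab su (leqnn 2).
have [s2v h2v] := sobolev_weak_derivative ab sv (leqnn 2).
have [s0u _] := sobolev_weak_derivative ab su (leq0n 2).
have [s0v _] := sobolev_weak_derivative ab sv (leq0n 2).
rewrite (weak_derivativeE ab (@is_weak_derivative0 _ _ _ E _)) in s0u.
rewrite (weak_derivativeE ab (@is_weak_derivative0 _ _ _ E _)) in s0v.
(* The difference of the two preimages is a weak eigenfunction for [lam]. *)
have duv : weak_derivative 2 u - weak_derivative 2 v = lam *: (u - v).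
  have lu : lam *: u = lam *: v - weak_derivative 2 v + weak_derivative 2 u.
    by rewrite -uv subrK.
  by rewrite scalerBr lu [lam *: v - _]addrC -!addrA [lam *: v + _]addrC subrK addrC.
apply: L2loc_eq0 => g /H[h [sh Bh h2]].
have sh2 := csmooth_cderive 2 sh.
have sduv := square_integrableB s2u s2v; have suv := square_integrableB s0u s0v.
rewrite (@cintegral_eq _ _ _ (fun x => (u - v : L2loc E) x * cderive 2 h x -
   lam * ((u - v : L2loc E) x * h x))); last by move=> x _; rewrite h2; ring.
rewrite (cintegralB mI (L2on_L2loc_csmooth suv sh2) (cintegrableZ lam mI (L2on_L2loc_csmooth suv sh))).
have -> : cintegral I (fun x => lam * ((u - v : L2loc E) x * h x)) =
   cintegral I (fun x => (weak_derivative 2 u - weak_derivative 2 v : L2loc E) x * h x).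
  rewrite duv; apply: (cintegral_ae mI).
  - by apply: cmeasurableM; [exact: cmeasurable_cst|exact: cmeasurable_L2loc_csmooth].
  - exact: cmeasurable_L2loc_csmooth.
  - by apply: ae_imply (L2loc_scale_ae lam (u - v)) => x hx Ix; rewrite hx// mulrA.
rewrite (cintegral_L2loc_csmoothB s0u s0v sh2) (cintegral_L2loc_csmoothB s2u s2v sh).
by rewrite (gu h sh Bh) (gv h sh Bh) subrr.
Qed.

(** Green's formula on H^2_0 puts no boundary condition on h, hence [B] is trivial and h may be the
    solution that starts from zero at a, which exists for every [lam]. *)
Lemma sobolev0_eigenfunction_unique u v (lam : R[i]) : sobolev0 2 u -> sobolev0 2 v ->
  lam *: u - weak_derivative 2 u = lam *: v - weak_derivative 2 v -> u = v.
Proof.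
move=> su sv; apply: (@eigenfunction_unique (fun=> True) _ _ _ su.1 sv.1).
- by move=> h sh _; rewrite (sobolev0_green su (leqnn 2) sh) sqrrN expr1n mul1r.
- by move=> h sh _; rewrite (sobolev0_green sv (leqnn 2) sh) sqrrN expr1n mul1r.
- move=> g tg; have [c [d [ac cd db g0]]] := test_functionE ab tg.
  have [|h [sh h0 h2]] := @linear_ode2 _ lam g a (test_csmooth tg).
    by move=> x xa; apply: g0; rewrite negb_and -ltNge (le_lt_trans xa ac).
  by exists h; split; [exact: sh|exact: Logic.I|exact: h2].
Qed.

End sobolev_theory.

(** * Approximation in H^1 of smooth functions vanishing at the endpoints *)

Section boundary_values.
Context {R : realType} {a b : R} (E : exhaustion a b).
Hypothesis ab : a < b.
Local Notation mu := (@lebesgue_measure R).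
Local Notation I := [set` `]a, b[ ].
Implicit Types (f g h phi : R -> R[i]) (u v w : L2loc E).

Let mI : measurable I. Proof. exact: measurable_itv. Qed.

Lemma sqL2norm_cvg0 (u : nat -> R -> R[i]) (C : R) : (forall n, cmeasurable I (u n)) ->
  (forall n x, I x -> sqnormc (u n x) <= C) ->
  (forall x, I x -> exists N, forall n, (N <= n)%N -> u n x = 0) ->
  forall e : R, 0 < e -> exists N, forall n, (N <= n)%N -> (sqL2norm I (u n) < e%:E)%E.
Proof.
move=> mu_u uC u0 e e0.
have h : (sqL2norm I (u n) @[n --> \oo] --> (\int[mu]_(x in I) 0))%E.
  apply: (@dominated_cvg _ _ R mu I mI
    (fun n x => (sqnormc (u n x))%:E) (fun=> 0%E) (EFin \o (fun=> C))) => //.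
  - by move=> n; exact: (cmeasurable_sqnormc (mu_u n)).
  - move=> x /u0[N hN]; apply: cvg_near_cst; exists N => // n /= Nn.
    by rewrite hN// sqnormc0.
  - exact: integrable_cst_itv.
  - by move=> n x Ix; rewrite /= lee_fin ger0_norm ?sqnormc_ge0// uC.
rewrite integral0 in h.
have hs : nbhs (0%:E : \bar R) [set y | (y < e%:E)%E].
  by apply: open_nbhs_nbhs; split; [exact: open_ereal_lt_ereal|rewrite /= lte_fin].
by have [N _ hN] := h _ hs; exists N.
Qed.

Lemma sqr_le_of_derive (F F' : R -> R) (c M x : R) : (forall y, is_derive y (1 : R) F (F' y)) ->
  (forall y, a <= y <= b -> F' y ^+ 2 <= M) -> F c = 0 -> a <= c <= b -> a <= x <= b ->
  F x ^+ 2 <= M * (x - c) ^+ 2.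
Proof.
move=> dF FM Fc cab xab.
have cF : continuous F.
  move=> y; have h := dF y.
  apply/differentiable_continuous/derivable1_diffP; exact: ex_derive.
have [cx|xc] := leP c x.
  have [y|y] := MVT_segment cx (fun y _ => dF y); first exact: continuous_subspaceT.
  rewrite in_itv /= => yc; rewrite Fc subr0 => ->.
  by rewrite exprMn ler_wpM2r ?sqr_ge0// FM//; lra.
have [y|y] := MVT_segment (ltW xc) (fun y _ => dF y); first exact: continuous_subspaceT.
rewrite in_itv /= => yc; rewrite Fc sub0r => /eqP; rewrite eqr_oppLR => /eqP ->.
by rewrite sqrrN exprMn -[c - x]opprB sqrrN ler_wpM2r ?sqr_ge0// FM//; lra.
Qed.

(** The mean value theorem is applied to the real and imaginary parts separately, each with a bound
    of |h'|^2 as constant. The quadratic decay is the rate that offsets the steep derivative of the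
    cutoffs. *)
Lemma sqnormc_le_of_root h (c : R) : csmooth h -> h c = 0 -> a <= c <= b ->
  exists2 L, 0 < L & forall x, a <= x <= b -> sqnormc (h x) <= L * (x - c) ^+ 2.
Proof.
move=> sh hc cab; have [M M0 hM] := csmooth_bounded a b (csmooth_cderive 1 sh).
have dh := csmooth_is_cderive 0 sh; rewrite cderive0 in dh.
exists (M + M); first lra.
move=> x xab; rewrite /sqnormc mulrDl; apply: lerD.
- apply: (@sqr_le_of_derive (fun y => complex.Re (h y)) (fun y => complex.Re (cderive 1 h y))) => //.
  + by move=> y; have [] := dh y.
  + by move=> y /hM; apply: le_trans; rewrite /sqnormc lerDl sqr_ge0.
  + by rewrite hc.
- apply: (@sqr_le_of_derive (fun y => complex.Im (h y)) (fun y => complex.Im (cderive 1 h y))) => //.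
  + by move=> y; have [] := dh y.
  + by move=> y /hM; apply: le_trans; rewrite /sqnormc lerDr sqr_ge0.
  + by rewrite hc.
Qed.

Lemma sqnormcN (z : R[i]) : sqnormc (- z) = sqnormc z.
Proof. by rewrite /sqnormc !ReImE !sqrrN. Qed.

(* The derivative of the cutoff is of order k on a neighbourhood of size 1/k of
   the endpoints, where h is of order 1/k: the product stays bounded there. *)
Lemma test_functions_H1_approx h : csmooth h -> h a = 0 -> h b = 0 ->
  forall e : R, 0 < e -> exists phi, [/\ test_function a b phi,
    (sqL2norm I (fun x => h x - phi x)%R < e%:E)%E &
    (sqL2norm I (fun x => cderive 1 h x - cderive 1 phi x)%R < e%:E)%E].
Proof.
move=> sh ha hb e e0.
have [eta [seta eta0 eta1]] := smooth_step E.
have sh' := csmooth_cderive 1 sh.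
have dh := csmooth_is_cderive 0 sh; rewrite cderive0 in dh.
have seta' := csmooth_cderive 1 seta.
have deta := csmooth_is_cderive 0 seta; rewrite cderive0 in deta.
have deta1 y : 1 < y -> cderive 1 eta y = 0.
  move=> y1; rewrite (@cderive_open _ [set` `]1, +oo[ ] _ _ (fun=> 1) (rray_open (1 : R)))//.
  - by rewrite (is_cderiveE (is_cderive_cst 1)).
  - by move=> z /=; rewrite in_itv /= andbT => z1; apply: eta1; exact: ltW.
  - by rewrite /= in_itv /= andbT.
have deta0 y : y < 0 -> cderive 1 eta y = 0.
  move=> y1; rewrite (@cderive_open _ [set` `]-oo, 0[ ] _ _ (fun=> 0) (lray_open (0 : R)))//.
  - by rewrite (is_cderiveE (is_cderive_cst 0)).
  - by move=> z /=; rewrite in_itv /= => z1; apply: eta0; exact: ltW.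
have [M M0 hM] := eta_bounded seta eta0 eta1.
have [P P0 hP] := plateau_bounded seta eta0 eta1.
have [M' M'0 hM'] : exists2 M', 0 < M' & forall y, sqnormc (cderive 1 eta y) <= M'.
  have [M' M'0 hM'] := csmooth_bounded 0 1 seta'.
  exists M' => // y; have [y0|y0] := ltP y 0; first by rewrite deta0// sqnormc0 ltW.
  have [y1|y1] := ltP 1 y; first by rewrite deta1// sqnormc0 ltW.
  by apply: hM'; rewrite y0 y1.
have [La La0 hLa] := @sqnormc_le_of_root h a sh ha ltac:(rewrite lexx ltW//).
have [Lb Lb0 hLb] := @sqnormc_le_of_root h b sh hb ltac:(rewrite lexx ltW//).
have [H H0 hH] := csmooth_bounded a b sh.
have [H' H'0 hH'] := csmooth_bounded a b sh'.
pose chi n := plateau eta a b n.+1%:R.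
have schi n : csmooth (chi n) by exact: csmooth_plateau.
pose y1 n (x : R) : R := n.+1%:R * x + (- n.+1%:R * a - 1).
pose y2 n (x : R) : R := - n.+1%:R * x + (n.+1%:R * b - 1).
(* [D1] and [D2] are the two terms of the product rule for the plateau, concentrated near a and near
   b respectively. *)
pose D1 n (x : R) : R[i] := n.+1%:R%:C * cderive 1 eta (y1 n x) * eta (y2 n x).
pose D2 n (x : R) : R[i] := eta (y1 n x) * ((- n.+1%:R)%:C * cderive 1 eta (y2 n x)).
have dchi n : is_cderive (chi n) (fun x => D1 n x + D2 n x).
  exact: is_cderiveM (is_cderive_affine _ _ deta) (is_cderive_affine _ _ deta).
have dphi n : cderive 1 (fun x => h x * chi n x) =
    fun x => cderive 1 h x * chi n x + h x * (D1 n x + D2 n x).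
  exact: is_cderiveE (is_cderiveM dh (dchi n)).
have k0 n : 0 < n.+1%:R :> R by rewrite ltr0n.
have bD1 n x : I x -> sqnormc (h x * D1 n x) <= 4 * (M' * M * La).
  rewrite /= in_itv /= => /andP[ax xb]; rewrite /D1.
  have [yy|yy] := ltP 1 (y1 n x); first by rewrite deta1// mulr0 mul0r mulr0 sqnormc0 !mulr_ge0 ?ltW.
  rewrite !sqnormcZ sqnormc_real.
  have h1 := hLa x ltac:(rewrite !ltW//).
  (* In the remaining case y1 is at most 1, that is (n + 1) (x - a) <= 2; so the square of the slope
     is absorbed by the bound La (x - a)^2 on h. *)
  have h2 : (n.+1%:R * (x - a)) ^+ 2 <= 4.
    have l0 : 0 <= n.+1%:R * (x - a) by rewrite mulr_ge0 ?ltW ?k0// subr_gt0.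
    have l2 : n.+1%:R * (x - a) <= 2 by move: yy; rewrite /y1; lra.
    nra.
  apply: (@le_trans _ _ ((La * (x - a) ^+ 2) * (n.+1%:R ^+ 2 * M' * M))).
    by rewrite !ler_pM ?sqnormc_ge0 ?mulr_ge0 ?sqr_ge0 ?sqnormc_ge0 ?ler_pM ?sqr_ge0 ?sqnormc_ge0.
  have -> : La * (x - a) ^+ 2 * (n.+1%:R ^+ 2 * M' * M) = (n.+1%:R * (x - a)) ^+ 2 * (M' * M * La) by ring.
  by rewrite ler_wpM2r// !mulr_ge0 ?ltW.
have bD2 n x : I x -> sqnormc (h x * D2 n x) <= 4 * (M' * M * Lb).
  rewrite /= in_itv /= => /andP[ax xb]; rewrite /D2.
  have [yy|yy] := ltP 1 (y2 n x); first by rewrite deta1// !mulr0 sqnormc0 !mulr_ge0 ?ltW.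
  rewrite !sqnormcZ sqnormc_real sqrrN.
  have h1 := hLb x ltac:(rewrite !ltW//).
  have h2 : (n.+1%:R * (x - b)) ^+ 2 <= 4.
    have l0 : 0 <= n.+1%:R * (b - x) by rewrite mulr_ge0 ?ltW ?k0// subr_gt0.
    have l2 : n.+1%:R * (b - x) <= 2 by move: yy; rewrite /y2; lra.
    nra.
  apply: (@le_trans _ _ ((Lb * (x - b) ^+ 2) * (M * (n.+1%:R ^+ 2 * M')))).
    by rewrite !ler_pM ?sqnormc_ge0 ?mulr_ge0 ?sqr_ge0 ?sqnormc_ge0 ?ler_pM ?sqr_ge0 ?sqnormc_ge0.
  have -> : Lb * (x - b) ^+ 2 * (M * (n.+1%:R ^+ 2 * M')) = (n.+1%:R * (x - b)) ^+ 2 * (M' * M * Lb) by ring.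
  by rewrite ler_wpM2r// !mulr_ge0 ?ltW.
have b1 n x : sqnormc (1 - chi n x) <= 2 * (1 + P).
  apply: (le_trans (sqnormcD _ _)); rewrite sqnormcN.
  by have := hP a b n.+1%:R x; rewrite -/(chi n) (_ : 1 = 1%:C)// sqnormc_real; lra.
have ev x : I x -> exists N, forall n, (N <= n)%N -> [/\ chi n x = 1, D1 n x = 0 & D2 n x = 0].
  rewrite /= in_itv /= => /andP[ax xb].
  (* Half of the distance gives (n + 1) (x - a) >= 4, so that the arguments of [eta] exceed 1
     strictly, as [deta1] requires. *)
  have [N1 h1] := @eventually_large R ((x - a) / 2) ltac:(lra).
  have [N2 h2] := @eventually_large R ((b - x) / 2) ltac:(lra).
  exists (maxn N1 N2) => n; rewrite geq_max => /andP[/h1 {}h1 /h2 {}h2].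
  split; first by rewrite /chi plateau1//; lra.
  - by rewrite /D1 deta1 ?mulr0 ?mul0r//; rewrite /y1; lra.
  - by rewrite /D2 deta1 ?mulr0//; rewrite /y2; lra.
have mA n : cmeasurable I (fun x => h x - h x * chi n x).
  exact: cmeasurable_csmooth mI (csmoothB sh (csmoothM sh (schi n))).
have mB n : cmeasurable I (fun x => cderive 1 h x - cderive 1 (fun x => h x * chi n x) x).
  exact: cmeasurable_csmooth mI (csmoothB sh' (csmooth_cderive 1 (csmoothM sh (schi n)))).
have [||N1 hN1] := @sqL2norm_cvg0 _ (H * (2 * (1 + P))) mA _ _ _ e0.
- move=> n x /=; rewrite in_itv /= => /andP[ax xb].
  have -> : h x - h x * chi n x = h x * (1 - chi n x) by ring.
  by rewrite sqnormcZ ler_pM ?sqnormc_ge0 ?hH ?b1// !ltW.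
- move=> x /ev[N hN]; exists N => n /hN[-> _ _]; by rewrite mulr1 subrr.
(* The nested factors 2 follow [sqnormcD]: one splits off the term with h', one separates [D1] from
   [D2], and one comes from [b1]. *)
have [||N2 hN2] := @sqL2norm_cvg0 _ (2 * (H' * (2 * (1 + P)) + 2 * (4 * (M' * M * La) + 4 * (M' * M * Lb)))) mB _ _ _ e0.
- move=> n x Ix; rewrite dphi.
  have -> : cderive 1 h x - (cderive 1 h x * chi n x + h x * (D1 n x + D2 n x)) =
     cderive 1 h x * (1 - chi n x) + - (h x * D1 n x + h x * D2 n x) by ring.
  apply: (le_trans (sqnormcD _ _)); rewrite ler_pM2l// sqnormcN; apply: lerD.
    move: Ix; rewrite /= in_itv /= => /andP[ax xb].
    by rewrite sqnormcZ ler_pM ?sqnormc_ge0 ?hH' ?b1// !ltW.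
  by apply: (le_trans (sqnormcD _ _)); rewrite ler_pM2l// lerD ?bD1 ?bD2.
- move=> x /ev[N hN]; exists N => n /hN[h1 h2 h3].
  by rewrite dphi h1 h2 h3 addr0 mulr1 mulr0 addr0 subrr.
exists (fun x => h x * chi (maxn N1 N2) x); split.
- exact: (test_functionM ab sh (test_plateau seta eta0 (k0 _) (lexx a) (lexx b))).
- by apply: hN1; exact: leq_maxl.
- by apply: hN2; exact: leq_maxr.
Qed.

End boundary_values.

(** * Spectra *)

Section topology_L2loc.
Context {R : realType} {a b : R} (E : exhaustion a b).
Hypothesis ab : a < b.
Local Notation mu := (@lebesgue_measure R).
Local Notation I := [set` `]a, b[ ].
Local Notation K n := [set` `[lo E n, hi E n]].
Implicit Types (f g h phi : R -> R[i]) (u v w : L2loc E) (lam s : R[i]).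

Let mI : measurable I. Proof. exact: measurable_itv. Qed.

Lemma L2class_eq f u : csmooth f -> (u : R -> R[i]) = f %[ae mu in I] -> u = L2class E f.
Proof.
move=> sf uf; apply/L2loc_eqP; apply: ae_imply2 uf (L2class_smooth_ae E sf) => x h1 h2 Ix.
by rewrite h1// h2.
Qed.

Lemma ae_imply3 (P Q S T : R -> Prop) : (forall x, P x -> Q x -> S x -> T x) ->
  {ae mu, forall x, P x} -> {ae mu, forall x, Q x} -> {ae mu, forall x, S x} ->
  {ae mu, forall x, T x}.
Proof. exact: (@filterS3 _ _ (ae_filter_ringOfSetsType mu)). Qed.

Lemma L2class_scale lam f : csmooth f -> lam *: L2class E f = L2class E (fun x => lam * f x).
Proof.
move=> sf; apply: (L2class_eq (csmoothZ lam sf)).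
by apply: ae_imply2 (L2loc_scale_ae lam (L2class E f)) (L2class_smooth_ae E sf) => x h1 h2 Ix; rewrite h1// h2.
Qed.

Lemma L2class_sub f g : csmooth f -> csmooth g -> L2class E f - L2class E g = L2class E (fun x => f x - g x).
Proof.
move=> sf sg; apply: (L2class_eq (csmoothB sf sg)).
by apply: ae_imply3 (L2loc_sub_ae (L2class E f) (L2class E g)) (L2class_smooth_ae E sf) (L2class_smooth_ae E sg)
  => x h1 h2 h3 Ix; rewrite h1// h2// h3.
Qed.

Lemma L2class0 : L2class E (fun=> 0) = 0.
Proof. by apply/esym/L2class_eq; [exact: csmooth_cst|exact: L2loc0_ae]. Qed.

Lemma ae_notin_itv (c d : R) : c < d -> ~ {ae mu, forall x, ~ [set` `[c, d]] x}.
Proof.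
move=> cd [N [mN N0 sub]].
have : (mu [set` `[c, d]] <= mu N)%E.
  apply: le_measure; rewrite ?inE//.
  by move=> x /= cx; apply: sub => /=.
by rewrite N0 lebesgue_measure_itv /= lte_fin cd lee_fin leNgt subr_gt0 cd.
Qed.

Lemma exhaustion_segment_sub n : K n `<=` I.
Proof.
have [al hb] := exhaustion_bounds E n; move=> x /=; rewrite !in_itv /= => /andP[lx xh].
by rewrite (lt_le_trans al lx) (le_lt_trans xh hb).
Qed.

Lemma cutoff_eq0 n j x : (j <= n)%N -> ~ K n.+1 x -> cutoff E j x = 0.
Proof.
move=> jn Kx.
have [c [d [lc cd dh h0]]] := test_functionE (lo_lt_hi E j.+1) (cutoff_test E j).
apply: h0; apply/negP => /andP[cx xd]; apply: Kx; rewrite /= in_itv /=.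
have [<-|jn'] := eqVneq j n; first by rewrite (le_trans (ltW lc) cx) (le_trans xd (ltW dh)).
have [|h1 h2] := @exhaustion_mono _ _ _ E j.+1 n.+1; first by rewrite ltnS ltn_neqAle jn'.
by rewrite (le_trans (ltW (lt_trans h1 lc)) cx) (le_trans xd (ltW (lt_trans dh h2))).
Qed.

Lemma cutoff_bounded n : exists2 M, 0 < M & forall j x, (j <= n)%N -> sqnormc (cutoff E j x) <= M.
Proof.
have B j : exists2 M, 0 < M & forall x, sqnormc (cutoff E j x) <= M.
  have [M M0 hM] := csmooth_bounded (lo E j.+1) (hi E j.+1) (test_csmooth (cutoff_test E j)).
  exists M => // x; have [Kx|Kx] := pselect (K j.+1 x).
    by apply: hM; move: Kx; rewrite /= in_itv.
  by rewrite (cutoff_eq0 (leqnn j) Kx) sqnormc0 ltW.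
elim: n => [|n [M M0 hM]].
  by have [M M0 hM] := B 0%N; exists M => // j x; rewrite leqn0 => /eqP ->.
have [M' M'0 hM'] := B n.+1; exists (M + M'); first lra.
move=> j x; rewrite leq_eqVlt => /orP[/eqP ->|/hM h]; first by have := hM' x; lra.
by have := h x; lra.
Qed.

Lemma cutoff_cmeasurable j : cmeasurable I (cutoff E j).
Proof. exact: cmeasurable_csmooth mI (test_csmooth (cutoff_test E j)). Qed.

Lemma seminorm_lt j v (e : R) : 0 < e ->
  (seminorm j v < e%:E)%E = (sqL2norm I (fun x => cutoff E j x * v x)%R < (e ^+ 2)%:E)%E.
Proof.
move=> e0; rewrite /seminorm /L2norm poweR_half_lt ?sqL2norm_ge0//.
rewrite -(@sqL2norm_extend _ I)// => x Ix; rewrite (@cutoff_eq0 j j x) ?mul0r//.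
by move/exhaustion_segment_sub.
Qed.

(** The shift by one index comes from the cutoffs: that of index j equals 1 on the j-th segment but
    spreads into the next one. A common bound for the first n + 1 cutoffs gives d. *)
Lemma seminorm_small n (e : R) : 0 < e -> exists2 d : R, 0 < d &
  forall v, (sqL2norm (K n.+1) v < d%:E)%E -> forall j, (j <= n)%N -> (seminorm j v < e%:E)%E.
Proof.
move=> e0; have [M M0 hM] := cutoff_bounded n.
exists (e ^+ 2 / M); first by rewrite divr_gt0 ?exprn_gt0.
move=> v vd j jn; rewrite seminorm_lt//.
have mK : measurable (K n.+1) by exact: measurable_itv.
have mKf f : cmeasurable I f -> cmeasurable (K n.+1) f.
  by move=> [m1 m2]; split; [apply: measurable_funS m1|apply: measurable_funS m2] => //; exact: exhaustion_segment_sub.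
rewrite -(@sqL2norm_extend _ (K n.+1)); last 2 first.
- exact: exhaustion_segment_sub.
- by move=> x Kx; rewrite (cutoff_eq0 jn Kx) mul0r.
apply: (@le_lt_trans _ _ (M%:E * sqL2norm (K n.+1) v)%E).
  apply: sqL2norm_leM => //; first exact: ltW.
  - by apply: mKf; exact: cmeasurableM (cutoff_cmeasurable j) (L2loc_measurable v).
  - exact/mKf/L2loc_measurable.
  - by move=> x _; rewrite sqnormcZ ler_wpM2r ?sqnormc_ge0 ?hM.
have -> : (e ^+ 2)%:E = (M%:E * (e ^+ 2 / M)%:E)%E.
  by rewrite -EFinM mulrCA divff ?mulr1// gt_eqF.
by rewrite lte_pmul2l.
Qed.

Lemma sqL2norm_ae_segment n v f : cmeasurable I f ->
  (v : R -> R[i]) = f %[ae mu in I] -> sqL2norm (K n) v = sqL2norm (K n) f.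
Proof.
move=> mf vf; apply: sqL2norm_ae; first exact: measurable_itv.
- have [m1 m2] := L2loc_measurable v.
  by split; [apply: measurable_funS m1|apply: measurable_funS m2] => //; exact: exhaustion_segment_sub.
- have [m1 m2] := mf.
  by split; [apply: measurable_funS m1|apply: measurable_funS m2] => //; exact: exhaustion_segment_sub.
- by apply: ae_imply vf => x h /exhaustion_segment_sub; exact: h.
Qed.

Lemma nbhs_L2loc u (U : set (L2loc E)) : nbhs u U -> exists n (e : R), 0 < e /\
  forall v, (forall j, (j <= n)%N -> (seminorm j (v - u)%R < e%:E)%E) -> U v.
Proof.
rewrite nbhsE => -[V [oV Vu] VU]; have [n [e [e0 h]]] := oV u Vu.
by exists n, e; split => // v /h/VU.
Qed.

Lemma nbhs_L2loc_segment u (U : set (L2loc E)) : nbhs u U -> exists n (d : R), 0 < d /\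
  forall v, (sqL2norm (K n) (v - u : L2loc E)%R < d%:E)%E -> U v.
Proof.
move=> /nbhs_L2loc[n [e [e0 h]]]; have [d d0 hd] := seminorm_small n e0.
by exists n.+1, d; split => // v /hd /h.
Qed.

Lemma local_unit (c d : R) : a < c -> d < b -> exists chi c' d',
  [/\ test_function a b chi, c' < c, d < d' & forall x, c' < x < d' -> chi x = 1].
Proof.
move=> ac db; have [eta [seta eta0 eta1]] := smooth_step E.
pose m := Num.min ((c - a) / 2) ((b - d) / 2).
have m1 : m <= (c - a) / 2 by rewrite ge_min lexx.
have m2 : m <= (b - d) / 2 by rewrite ge_min lexx orbT.
have m0 : 0 < m by rewrite lt_min; apply/andP; split; lra.
(* With slope 2 / m the plateau reaches 1 at distance m from the endpoints; m is at most half of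
   either gap, so it equals 1 on a neighbourhood of the segment. *)
exists (plateau eta a b (2 / m)), (a + m), (b - m); split.
- by apply: test_plateau => //; rewrite divr_gt0.
- lra.
- lra.
- move=> x /andP[x1 x2]; apply: plateau1 => //.
  + by rewrite mulrAC ler_pdivlMr// ler_pM2l//; lra.
  + by rewrite mulrAC ler_pdivlMr// ler_pM2l//; lra.
Qed.

(** f is multiplied by a cutoff equal to 1 on a neighbourhood of the segment, not just on it, hence
    derivatives of all orders agree there. *)
Lemma test_localization (c d : R) f : a < c -> d < b -> csmooth f -> exists2 phi,
  test_function a b phi &
  forall k x, c <= x <= d -> cderive k phi x = cderive k f x.
Proof.
move=> ac db sf; have [chi [c' [d' [tchi c'c dd' chi1]]]] := local_unit ac db.
exists (fun x => f x * chi x); first exact: test_functionM ab sf tchi.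
move=> k x /andP[cx xd]; apply: (@cderive_open _ [set` `]c', d'[ ]).
- exact: itv_open.
- by move=> y /=; rewrite in_itv /= => /chi1 ->; rewrite mulr1.
- by rewrite /= in_itv /= (lt_le_trans c'c cx) (le_lt_trans xd dd').
Qed.

Lemma test_localization_exhaustion n f : csmooth f -> exists2 phi,
  test_function a b phi & forall k x, K n x -> cderive k phi x = cderive k f x.
Proof.
move=> sf; have [al hb] := exhaustion_bounds E n.
have [phi tphi h] := test_localization al hb sf.
by exists phi; [exact: tphi|move=> k x Kx; apply: h; move: Kx; rewrite /= in_itv].
Qed.

End topology_L2loc.

(** * Operators whose graph contains the Laplacian on test functions *)

Section spectra_of_extensions.
Context {R : realType} {a b : R} (E : exhaustion a b).
Hypothesis ab : a < b.
Local Notation mu := (@lebesgue_measure R).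
Local Notation I := [set` `]a, b[ ].
Local Notation K n := [set` `[lo E n, hi E n]].
Implicit Types (f g h phi : R -> R[i]) (u v w : L2loc E) (lam s : R[i])
  (G : set (L2loc E * L2loc E)).

Let mI : measurable I. Proof. exact: measurable_itv. Qed.

(** Density of the range, discontinuity of the inverse and the eigenvalues of the closure are
    derived from this property of the graph, so the proofs of the first two serve both [laplacian]
    and [laplacian_L2]. *)
Definition extends_test_laplacian G := forall phi, test_function a b phi ->
  G (L2class E phi, L2class E (cderive 2 phi)).

Lemma shift_test_laplacian G lam phi : extends_test_laplacian G -> test_function a b phi ->
  Defs.shift lam G (L2class E phi, L2class E (fun x => lam * phi x - cderive 2 phi x)).
Proof.
move=> GG tphi; have sphi := test_csmooth tphi.
exists (L2class E phi, L2class E (cderive 2 phi)); first exact: GG.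
by rewrite /= (L2class_scale E lam sphi) (L2class_sub E (csmoothZ lam sphi) (csmooth_cderive 2 sphi)).
Qed.

Lemma cmeasurableK n f : cmeasurable I f -> cmeasurable (K n) f.
Proof.
by move=> [m1 m2]; split; [apply: measurable_funS m1|apply: measurable_funS m2] => //; exact: exhaustion_segment_sub.
Qed.

Lemma dense_range G lam : extends_test_laplacian G ->
  closure (op_range (Defs.shift lam G)) = setT.
Proof.
move=> GG.
suff H (f : L2loc E) : closure (op_range (Defs.shift lam G)) f by apply/seteqP; split=> // f _; exact: H.
move=> U /nbhs_L2loc_segment[n [d [d0 hU]]].
have [al hb] := exhaustion_bounds E n; have lh := lo_lt_hi E n.
have [eta [seta eta0 eta1]] := smooth_step E.
(* f itself need not be in L^2(I); its truncation to the segment seen by the neighbourhood is. *)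
have [g tg hg] := test_functions_dense ab seta eta0 eta1 (L2on_cindic_segment f al hb) d0.
have [p [q [ap pq qb g0]]] := test_functionE ab tg.
have sg := test_csmooth tg.
(* The right-hand side is -g so that lam u - u'' = g. *)
have [|u [su u0 u2]] := @linear_ode2 _ lam (fun x => - g x) a (csmoothN sg).
  by move=> x xa; rewrite g0 ?oppr0// negb_and -ltNge (le_lt_trans xa ap).
have [phi tphi hphi] := test_localization_exhaustion E ab n su.
have sphi := test_csmooth tphi.
pose w := L2class E (fun x => lam * phi x - cderive 2 phi x).
have sw : csmooth (fun x => lam * phi x - cderive 2 phi x).
  exact: csmoothB (csmoothZ lam sphi) (csmooth_cderive 2 sphi).
exists w; split.
  by exists (L2class E phi, w) => //; exact: shift_test_laplacian.
apply: hU.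
have mphi : cmeasurable I (fun x => lam * phi x - cderive 2 phi x - f x).
  exact: cmeasurableB (cmeasurable_csmooth mI sw) (L2loc_measurable f).
rewrite (@sqL2norm_ae_segment _ _ _ E n _ _ mphi); last first.
  by apply: ae_imply2 (L2loc_sub_ae w f) (L2class_smooth_ae E sw) => x h1 h2 Ix; rewrite h1// h2.
have mfg : cmeasurable I (fun x => cindic (K n) x * f x - g x).
  exact: cmeasurableB (L2on_cindic_segment f al hb).1 (cmeasurable_csmooth mI sg).
apply: le_lt_trans hg.
rewrite (@sqL2norm_eq _ _ _ (fun x => - (cindic (K n) x * f x - g x))); last first.
  move=> x Kx; rewrite cindicT// mul1r.
  have := hphi 0%N x Kx; rewrite !cderive0 => ->; rewrite (hphi 2 x Kx) u2; ring.
rewrite sqL2normN; apply: ge0_subset_integral => //.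
- exact: cmeasurable_sqnormc.
- by move=> x _; rewrite lee_fin sqnormc_ge0.
- exact: exhaustion_segment_sub.
Qed.

Lemma eigenfunction_exists lam : exists s, s * s = lam.
Proof. by exists (sqrtc lam); rewrite -expr2 sqr_sqrtc. Qed.

(* Cutting off an eigenfunction further and further away gives functions that all
   coincide with it on the first segment, hence stay away from 0, although their
   images under lam - G are supported closer and closer to the endpoints. *)
Lemma inverse_discontinuous G lam : extends_test_laplacian G ->
  ~ op_inverse_continuous (Defs.shift lam G).
Proof.
move=> GG [F FG cF]; have [s ss] := eigenfunction_exists lam.
have t0 := test_function0 a b.
have z0 : L2class E (fun x : R => lam * 0 - cderive 2 (fun=> 0) x) = 0.
  rewrite -(L2class0 E); congr L2class; apply/funext => x.
  by rewrite (cderive2E (is_cderive_cst 0) (is_cderive_cst 0)) mulr0 subrr.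
have G0 : Defs.shift lam G (0, 0).
  by have := shift_test_laplacian lam GG t0; rewrite z0 L2class0.
have F0 : F 0 = 0 by exact: FG G0.
(* A neighbourhood of F 0 = 0 that contains no function equal to the eigenfunction on the first
   segment; continuity at 0 is refuted on it. *)
pose V := [set v : L2loc E | ~ (v : R -> R[i]) = cexp s %[ae mu in K 0%N]].
have V0 : V 0.
  move=> h; apply: (@ae_notin_itv R (lo E 0) (hi E 0) (lo_lt_hi E 0)).
  apply: ae_imply2 h (L2loc0_ae E) => x h1 h2 Kx; have := cexp_neq0 s x.
  by rewrite -h1// h2 ?eqxx//; exact: exhaustion_segment_sub Kx.
(* No triangle inequality: if v differs from the eigenfunction on the first
   segment, so does every w whose distance to v is smaller than that of v to it. *)
have oV : open V.
  move=> v Vv.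
  have mv : cmeasurable (K 0%N) (fun x => cexp s x - v x).
    apply: cmeasurableB; last exact/cmeasurableK/L2loc_measurable.
    exact: cmeasurable_csmooth (measurable_itv _) (csmooth_cexp s).
  pose N := sqL2norm (K 0%N) (fun x => cexp s x - v x).
  have N0 : (0 < N)%E.
    rewrite lt_neqAle sqL2norm_ge0 andbT; apply/eqP => N0; apply: Vv.
    have := sqL2norm_eq0 (measurable_itv _) mv (esym N0).
    by apply: ae_imply => x h Kx; have := h Kx => /eqP; rewrite subr_eq0 => /eqP.
  have [e e0 eN] : exists2 e : R, 0 < e & ((e ^+ 2)%:E <= N)%E.
    case: N N0 => [r| |]//; last by exists 1; rewrite ?leey.
    by rewrite lte_fin => r0; exists (Num.sqrt r); rewrite ?sqrtr_gt0// sqr_sqrtr// ltW.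
  exists 0%N, e; split => // w /(_ 0%N (leqnn _)).
  rewrite seminorm_lt// => hw Vw.
  have : (N <= sqL2norm I (fun x => cutoff E 0 x * (w - v : L2loc E) x)%R)%E.
    have -> : N = sqL2norm (K 0%N) (fun x => cutoff E 0 x * (w - v : L2loc E) x).
      apply: sqL2norm_ae => //.
      - apply: cmeasurableM; apply: cmeasurableK; first exact: cutoff_cmeasurable.
        exact: L2loc_measurable.
      - apply: ae_imply2 Vw (L2loc_sub_ae w v) => x h1 h2 Kx.
        by rewrite cutoff1 ?mul1r ?h2 ?h1//; exact: exhaustion_segment_sub Kx.
    apply: ge0_subset_integral => //.
    - apply: cmeasurable_sqnormc; apply: cmeasurableM; first exact: cutoff_cmeasurable.
      exact: L2loc_measurable.
    - by move=> x _; rewrite lee_fin sqnormc_ge0.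
    - exact: exhaustion_segment_sub.
  by rewrite leNgt (lt_le_trans hw eN).
have nV : nbhs (F 0) V by rewrite F0; exact: open_nbhs_nbhs.
move/subspace_continuousP: cF => /(_ 0).
have R0 : op_range (Defs.shift lam G) 0 by exists (0, 0).
move=> /(_ R0 V nV); rewrite /nbhs /= /within /= => /nbhs_L2loc_segment[n [d [d0 hn]]].
have [phi tphi hphi] := test_localization_exhaustion E ab n (csmooth_cexp s).
have sphi := test_csmooth tphi.
pose w := L2class E (fun x => lam * phi x - cderive 2 phi x).
have sw : csmooth (fun x => lam * phi x - cderive 2 phi x).
  exact: csmoothB (csmoothZ lam sphi) (csmooth_cderive 2 sphi).
have Gw := shift_test_laplacian lam GG tphi.
(* phi is the exponential on the n-th segment, so its image vanishes there and no smallness has to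
   be estimated. *)
have hw : (sqL2norm (K n) (w - 0 : L2loc E)%R < d%:E)%E.
  rewrite subr0 (sqL2norm_ae_segment n (cmeasurable_csmooth mI sw) (L2class_smooth_ae E sw)).
  rewrite (@sqL2norm_eq _ _ _ (fun=> 0)).
    by rewrite /sqL2norm integral0_eq ?lte_fin// => x _; rewrite sqnormc0.
  move=> x Kx; have := hphi 0%N x Kx; rewrite !cderive0 => ->; rewrite (hphi 2 x Kx).
  by rewrite cderive2_cexp mulrA ss subrr.
have Rw : op_range (Defs.shift lam G) w by exists (L2class E phi, w).
have hV : V (F w) := hn w hw Rw.
have Fw : F w = L2class E phi by exact: FG Gw.
rewrite Fw in hV; apply: hV.
apply: ae_imply (L2class_smooth_ae E sphi) => x h Kx.
have K0n : K n x.
  move: Kx; rewrite /= !in_itv /= => /andP[h1 h2].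
  case: (n) => [|m]; first by rewrite h1 h2.
  have [h3 h4] := @exhaustion_mono _ _ _ E 0 m.+1 (ltn0Sn m).
  by rewrite (le_trans (ltW h3) h1) (le_trans h2 (ltW h4)).
by rewrite h; [have := hphi 0%N x K0n; rewrite !cderive0|exact: exhaustion_segment_sub Kx].
Qed.

Lemma point_spectrum_closure G : extends_test_laplacian G ->
  point_spectrum (closure G) = setT.
Proof.
move=> GG; apply/seteqP; split=> // lam _; have [s ss] := eigenfunction_exists lam.
have se := csmooth_cexp s; pose u := L2class E (cexp s).
have cu : closure G (u, lam *: u).
  move=> U [[U1 U2] /= [n1 n2] sub].
  have [n [d [d0 h1]]] := nbhs_L2loc_segment n1.
  have [m [d' [d'0 h2]]] := nbhs_L2loc_segment n2.
  (* The two coordinates of the graph see different segments; one cutoff beyond the larger of them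
     serves both. *)
  have [phi tphi hphi] := test_localization_exhaustion E ab (maxn n m) se.
  have sphi := test_csmooth tphi.
  have hphi' j k x : (j <= maxn n m)%N -> K j x -> cderive k phi x = cderive k (cexp s) x.
    move=> jm Kx; apply: hphi; move: jm; rewrite leq_eqVlt => /orP[/eqP <-//|jm].
    have [h3 h4] := @exhaustion_mono _ _ _ E _ _ jm.
    move: Kx; rewrite /= !in_itv /= => /andP[h5 h6].
    by rewrite (le_trans (ltW h3) h5) (le_trans h6 (ltW h4)).
  have small j k f (e : R) : 0 < e -> (j <= maxn n m)%N -> csmooth f ->
      (forall x, K j x -> f x = cderive k (cexp s) x) ->
      (sqL2norm (K j) (L2class E (cderive k phi) - L2class E f : L2loc E)%R < e%:E)%E.
    move=> e0 jm sf fE; have sk := csmooth_cderive k sphi; rewrite L2class_sub//.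
    have sB := csmoothB sk sf.
    rewrite (sqL2norm_ae_segment j (cmeasurable_csmooth mI sB) (L2class_smooth_ae E sB)).
    rewrite (@sqL2norm_eq _ _ _ (fun=> 0)).
      by rewrite /sqL2norm integral0_eq ?lte_fin// => x _; rewrite sqnormc0.
    by move=> x Kx; rewrite (hphi' j k x jm Kx) fE// subrr.
  exists (L2class E phi, L2class E (cderive 2 phi)); split; first exact: GG.
  apply: sub; split => /=.
  - apply: h1; have := small n 0%N (cexp s) d d0 (leq_maxl _ _) se.
    by rewrite !cderive0; apply.
  - apply: h2; rewrite /u (L2class_scale E lam se).
    apply: (small m 2%N _ _ d'0 (leq_maxr _ _) (csmoothZ lam se)).
    by move=> x _; rewrite cderive2_cexp mulrA ss.
have c0 : closure G (0, 0).
  apply: subset_closure; have := GG _ (test_function0 a b).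
  by rewrite (cderive2E (is_cderive_cst 0) (is_cderive_cst 0)) L2class0.
move=> /(_ u 0 0) H; have : u = 0.
  apply: H; first by exists (u, lam *: u) => //=; rewrite subrr.
  by exists (0, 0) => //=; rewrite scaler0 subrr.
move=> u0; apply: (@ae_notin_itv R (lo E 0) (hi E 0) (lo_lt_hi E 0)).
apply: ae_imply2 (L2class_smooth_ae E se) (L2loc0_ae E) => x h1 h2 Kx; have := cexp_neq0 s x.
have Ix := exhaustion_segment_sub Kx; move: h1; rewrite -/u u0 => /(_ Ix) <-.
by rewrite h2// eqxx.
Qed.

End spectra_of_extensions.

(** * The adjoint on compactly supported functions *)

Section adjoint.
Context {R : realType} {a b : R} (E : exhaustion a b).
Hypothesis ab : a < b.
Local Notation mu := (@lebesgue_measure R).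
Local Notation I := [set` `]a, b[ ].
Local Notation K n := [set` `[lo E n, hi E n]].
Implicit Types (f g h phi : R -> R[i]) (u v w : L2loc E) (lam s : R[i]) (k : L2c E).

Let mI : measurable I. Proof. exact: measurable_itv. Qed.

Definition supported_in (c d : R) u := {ae mu, forall x, I x -> ~~ (c <= x <= d) -> u x = 0}.

Lemma supported_inW (c d c' d' : R) u : c' <= c -> d <= d' ->
  supported_in c d u -> supported_in c' d' u.
Proof.
move=> cc dd; apply: ae_imply => x h Ix cx; apply: h => //; apply: contra cx => /andP[h1 h2].
by rewrite (le_trans cc h1) (le_trans h2 dd).
Qed.

Lemma supported_inB (c d : R) u v : supported_in c d u -> supported_in c d v ->
  supported_in c d (u - v : L2loc E).
Proof.
move=> hu hv; apply: ae_imply3 hu hv (L2loc_sub_ae u v) => x h1 h2 h3 Ix cx.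
by rewrite h3// h1// h2// subrr.
Qed.

Lemma supported_inZ (c d : R) u lam : supported_in c d u -> supported_in c d (lam *: u : L2loc E).
Proof.
move=> hu; apply: ae_imply2 hu (L2loc_scale_ae lam u) => x h1 h2 Ix cx.
by rewrite h2// h1// mulr0.
Qed.

Lemma L2c_supported k : exists c d, [/\ a < c, d < b & supported_in c d k].
Proof.
have /set_mem[C [cC CI kC]] := L2c_valP k.
have [c [d [ac cd db h]]] := compact_sub_segment ab cC CI.
exists c, d; split => //; apply: ae_imply kC => x kx Ix cx; apply: kx; split => // Cx.
by move: cx; rewrite h.
Qed.

Lemma L2c_supported2 k1 k2 : exists c d, [/\ a < c, d < b, supported_in c d k1 & supported_in c d k2].
Proof.
have [c1 [d1 [ac1 db1 s1]]] := L2c_supported k1; have [c2 [d2 [ac2 db2 s2]]] := L2c_supported k2.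
exists (Num.min c1 c2), (Num.max d1 d2); split.
- by rewrite lt_min ac1.
- by rewrite gt_max db1.
- by apply: supported_inW s1; rewrite ?ge_min ?le_max lexx.
- by apply: supported_inW s2; rewrite ?ge_min ?le_max lexx orbT.
Qed.

Lemma cintegral_supported (c d : R) u f h : csmooth f -> csmooth h -> supported_in c d u ->
  (forall x, c <= x <= d -> f x = h x) ->
  cintegral I (fun x => u x * f x) = cintegral I (fun x => u x * h x).
Proof.
move=> sf sh su fh; apply: (cintegral_ae mI).
- exact: cmeasurable_L2loc_csmooth.
- exact: cmeasurable_L2loc_csmooth.
apply: ae_imply su => x ux Ix; have [cx|cx] := boolP (c <= x <= d); first by rewrite fh.
by rewrite ux// !mul0r.
Qed.

Lemma pairing_cls u f : csmooth f -> pairing u (L2class E f) = cintegral I (fun x => u x * f x).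
Proof.
move=> sf; apply: (cintegral_ae mI).
- by apply: cmeasurableM; exact: L2loc_measurable.
- exact: cmeasurable_L2loc_csmooth.
- by apply: ae_imply (L2class_smooth_ae E sf) => x h Ix; rewrite h.
Qed.

Lemma cintegral_L2locZ lam u phi : test_function a b phi ->
  cintegral I (fun x => (lam *: u : L2loc E) x * phi x) = lam * cintegral I (fun x => u x * phi x).
Proof.
move=> tphi; have sphi := test_csmooth tphi.
rewrite -cintegralZ//; last exact: L2loc_test_cintegrable.
apply: (cintegral_ae mI).
- exact: cmeasurable_L2loc_csmooth.
- by apply: cmeasurableM; [exact: cmeasurable_cst|exact: cmeasurable_L2loc_csmooth].
- by apply: ae_imply (L2loc_scale_ae lam u) => x h Ix; rewrite h// mulrA.
Qed.

Lemma cintegral_test_comb lam u phi psi : test_function a b phi -> test_function a b psi ->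
  cintegral I (fun x => u x * (lam * phi x - psi x)) =
  lam * cintegral I (fun x => u x * phi x) - cintegral I (fun x => u x * psi x).
Proof.
move=> tphi tpsi; have i1 := L2loc_test_cintegrable ab u tphi.
have i2 := L2loc_test_cintegrable ab u tpsi.
rewrite -cintegralZ// -cintegralB//; last exact: cintegrableZ.
by apply: cintegral_eq => x _; ring.
Qed.

Lemma L2c_valB k1 k2 : L2c_val (k1 - k2) = L2c_val k1 - L2c_val k2.
Proof. exact: (linearB (val : L2c E -> L2loc E)). Qed.

Lemma L2c_valZ lam k : L2c_val (lam *: k) = lam *: L2c_val k.
Proof. exact: (linearZZ (val : L2c E -> L2loc E)). Qed.

(** Test functions lie in H^2_0, so the adjoint acts as the weak second derivative. Both spectral
    statements about the adjoint go through this identity. *)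
Lemma adjoint_test (gh : L2c E * L2c E) phi : laplacian_adjoint E gh -> test_function a b phi ->
  cintegral I (fun x => gh.2 x * phi x) = cintegral I (fun x => gh.1 x * cderive 2 phi x).
Proof.
move=> [_ H] tphi; have sphi := test_csmooth tphi.
have := H (L2class E phi) (test_functions_sobolev0 ab 2 (L2class_test E tphi)).
by rewrite (L2class_weak_derivativeE E ab 2 sphi) (pairing_cls _ sphi) (pairing_cls _ (csmooth_cderive 2 sphi)).
Qed.

(** By transposition: g = lam h - h'', and on the compact supports of the two preimages h may be
    replaced by a test function phi. Pairing a preimage with g then amounts to pairing its image,
    which is common to both, with phi. *)
Lemma adjoint_injective lam : op_injective (Defs.shift lam (laplacian_adjoint E)).
Proof.
move=> u v w [p Ap /= [<- ew]] [q Aq /= [<- ew']].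
have /(congr1 (@L2c_val _ _ _ E)) : lam *: p.1 - p.2 = lam *: q.1 - q.2 by rewrite ew ew'.
rewrite !L2c_valB !L2c_valZ => e.
apply: val_inj; apply/eqP; rewrite -subr_eq0; apply/eqP; apply: L2loc_eq0 => g tg.
rewrite cintegral_L2locB//; apply/eqP; rewrite subr_eq0; apply/eqP.
have [c [d [ac db s1 s2]]] := L2c_supported2 p.1 q.1.
have [c' [d' [ac' cd' db' g0]]] := test_functionE ab tg; have sg := test_csmooth tg.
have [|h [sh h0 h2]] := @linear_ode2 _ lam (fun x => - g x) a (csmoothN sg).
  by move=> x xa; rewrite g0 ?oppr0// negb_and -ltNge (le_lt_trans xa ac').
have [phi tphi hphi] := test_localization E ab ac db sh; have sphi := test_csmooth tphi.
have t2 := test_cderive 2 ab tphi.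
have sc : csmooth (fun x => lam * phi x - cderive 2 phi x).
  exact: csmoothB (csmoothZ lam sphi) (test_csmooth t2).
(* The support of g may exceed [c, d]: the two smooth factors need only agree where k lives. *)
have E1 k : supported_in c d k -> cintegral I (fun x => k x * g x) =
    lam * cintegral I (fun x => k x * phi x) - cintegral I (fun x => k x * cderive 2 phi x).
  move=> sk; rewrite -(cintegral_test_comb lam k tphi t2).
  apply: (cintegral_supported sg sc sk) => x cx.
  have := hphi 0%N x cx; rewrite !cderive0 => ->; rewrite (hphi 2 x cx) h2; ring.
rewrite (E1 p.1 s1) (E1 q.1 s2) -!adjoint_test// -!cintegral_L2locZ// -!cintegral_L2locB//.
by rewrite e.
Qed.

(** Evaluation at u is weak* continuous, and this set is its kernel. For u an exponential it is the
    closed subspace that confines the range of lam minus the adjoint. *)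
Lemma closed_pairing_eq0 u : closed [set k : L2c E | pairing k u = 0].
Proof.
have c1 : closed [set (0 : R[i]^o)].
  exact: (accessible_closed_set1 (hausdorff_accessible (@norm_hausdorff _ R[i]^o))).
have cf : continuous (fun k : L2c E => (weak_star_embedding k : {ptws L2loc E -> R[i]^o}) u).
  move=> k; apply: (@continuous_comp _ _ _ (@weak_star_embedding R a b E)
     (fun F : {ptws L2loc E -> R[i]^o} => F u)).
    exact: initial_continuous.
  exact: (@proj_continuous _ (fun=> R[i]^o) u).
have := @closed_comp _ _ _ [set (0 : R[i]^o)] (fun k _ => cf k) c1.
by [].
Qed.

(* u is not in H^2_0, but g and its image have compact support, where u may be
   replaced by a test function. *)
Lemma adjoint_range_orthogonal lam s : s * s = lam ->
  op_range (Defs.shift lam (laplacian_adjoint E)) `<=`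
  [set k : L2c E | pairing k (L2class E (cexp s)) = 0].
Proof.
move=> ss w [_ [p Ap <-]] /= <-.
have se := csmooth_cexp s.
have [c [d [ac db s1 s2]]] := L2c_supported2 p.1 p.2.
have [phi tphi hphi] := test_localization E ab ac db se; have sphi := test_csmooth tphi.
have hphi0 x : c <= x <= d -> cexp s x = phi x.
  by move=> cx; have := hphi 0%N x cx; rewrite !cderive0.
rewrite pairing_cls// L2c_valB L2c_valZ.
rewrite (cintegral_supported se sphi (supported_inB (supported_inZ lam s1) s2) hphi0).
rewrite cintegral_L2locB// cintegral_L2locZ// adjoint_test//.
rewrite (cintegral_supported (csmooth_cderive 2 sphi) (csmoothZ lam sphi) s1).
  rewrite (@cintegral_eq _ _ (fun x => p.1 x * (lam * phi x)) (fun x => lam * (p.1 x * phi x))).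
    by rewrite cintegralZ ?subrr//; exact: L2loc_test_cintegrable.
  by move=> x _; ring.
by move=> x cx; rewrite (hphi 2 x cx) cderive2_cexp -hphi0// mulrA ss.
Qed.

(** The witness is the conjugate exponential cut to the first segment, whose pairing is the integral
    of |e^(sx)|^2 there. The conjugate appears because the pairing is bilinear. *)
Lemma pairing_cexp_neq0 s : exists k, pairing k (L2class E (cexp s)) <> 0.
Proof.
have se := csmooth_cexp s; have [al hb] := exhaustion_bounds E 0.
have mK : measurable (K 0%N) by exact: measurable_itv.
pose ce : R -> R[i] := fun x => (cexp s x)^*.
have sqce (z : R[i]) : sqnormc z^* = sqnormc z by case: z => x y; rewrite /sqnormc /= sqrrN.
have mce : cmeasurable I ce.
  have [m1 m2] := cmeasurable_csmooth mI se; split.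
    have -> : (fun x => complex.Re (ce x)) = (fun x => complex.Re (cexp s x)).
      by apply/funext => x; rewrite /ce; case: (cexp s x).
    exact: m1.
  have -> : (fun x => complex.Im (ce x)) = (fun x => - complex.Im (cexp s x)).
    by apply/funext => x; rewrite /ce; case: (cexp s x).
  exact: measurableT_comp.
pose kf := fun x => cindic (K 0%N) x * ce x.
have sqind x : sqnormc (cindic (K 0%N) x) <= 1.
  by rewrite /cindic sqnormc_real indicE; case: (_ \in _); rewrite ?expr0n ?expr1n.
have lkf : L2on I kf.
  have mkf : cmeasurable I kf by apply: cmeasurableM => //; exact: cmeasurable_cindic.
  split; first exact: mkf.
  apply: (le_lt_trans _ (L2on_csmooth a b se).2); apply: sqL2norm_le => //.
  - exact: cmeasurable_csmooth mI se.
  - by move=> x _; rewrite /kf sqnormcZ sqce ler_piMl ?sqnormc_ge0.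
have kP : L2class E kf \in compactly_supported (E := E).
  rewrite inE; exists (K 0%N); split; first exact: segment_compact.
    exact: exhaustion_segment_sub.
  apply: ae_imply (L2class_ae E lkf) => x h [Ix Kx]; rewrite h// /kf cindicF// mul0r.
  by [].
exists (L2cMk kP) => /= h.
have le : L2on I (fun x => cindic (K 0%N) x * cexp s x).
  have mkf : cmeasurable I (fun x => cindic (K 0%N) x * cexp s x).
    by apply: cmeasurableM; [exact: cmeasurable_cindic|exact: cmeasurable_csmooth mI se].
  split; first exact: mkf.
  apply: (le_lt_trans _ (L2on_csmooth a b se).2); apply: sqL2norm_le => //.
  - exact: cmeasurable_csmooth mI se.
  - by move=> x _; rewrite sqnormcZ ler_piMl ?sqnormc_ge0.
have : sqL2norm I (fun x => cindic (K 0%N) x * cexp s x) = 0%E.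
  have : fine (sqL2norm I (fun x => cindic (K 0%N) x * cexp s x)) = 0.
    have {h} : complex.Re (cintegral I (fun x => kf x * cexp s x)) = 0.
      have <- : pairing (L2class E kf) (L2class E (cexp s)) = cintegral I (fun x => kf x * cexp s x).
        rewrite pairing_cls//; apply: (cintegral_ae mI).
        - exact: cmeasurable_L2loc_csmooth.
        - by apply: cmeasurableM; [exact: lkf.1|exact: cmeasurable_csmooth mI se].
        - by apply: ae_imply (L2class_ae E lkf) => x hx Ix; rewrite hx.
      by rewrite h.
    move=> <-; apply: eq_Rintegral => x _; rewrite /kf /ce /cindic.
    move: (cexp s x) => z.
    have [->|->] : \1_(K 0%N) x = 0 :> R \/ \1_(K 0%N) x = 1 :> R.
    - by rewrite indicE; case: (_ \in _); [right|left].
    - by case: z => p q; rewrite /sqnormc /=; ring.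
    - by case: z => p q; rewrite /sqnormc /=; ring.
  move/eqP; rewrite fine_eq0; first by move/eqP.
  by rewrite ge0_fin_numE ?sqL2norm_ge0//; exact: le.2.
move/(sqL2norm_eq0 mI le.1) => h0.
apply: (@ae_notin_itv R (lo E 0) (hi E 0) (lo_lt_hi E 0)).
apply: ae_imply h0 => x hx Kx; have := cexp_neq0 s x.
by have := hx (exhaustion_segment_sub Kx); rewrite cindicT// mul1r => ->; rewrite eqxx.
Qed.

Lemma adjoint_range_not_dense lam :
  closure (op_range (Defs.shift lam (laplacian_adjoint E))) <> setT.
Proof.
move=> H; have [s ss] := eigenfunction_exists lam; have [k kn] := pairing_cexp_neq0 s.
apply: kn; have : closure (op_range (Defs.shift lam (laplacian_adjoint E))) k by rewrite H.
move=> /(closure_subset (adjoint_range_orthogonal ss)).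
by rewrite -((closure_id _).1 (@closed_pairing_eq0 _)).
Qed.

End adjoint.

(** * The Dirichlet Laplacian and its eigenvalues *)

Section dirichlet_laplacian.
Context {R : realType} {a b : R} (E : exhaustion a b).
Hypothesis ab : a < b.
Local Notation mu := (@lebesgue_measure R).
Local Notation I := [set` `]a, b[ ].
Local Notation K n := [set` `[lo E n, hi E n]].
Implicit Types (f g h phi : R -> R[i]) (u v w : L2loc E) (lam s : R[i]).

Let mI : measurable I. Proof. exact: measurable_itv. Qed.

(** Two different integrations by parts. From u'' to u' the function h is approximated by test
    functions in H^1, which its zeros at the endpoints permit; from u' to u it is u in H^1_0 that is
    approximated, and the partner h' is unrestricted. *)
Lemma dirichlet_green u h : sobolev0 1 u -> sobolev 2 u -> csmooth h -> h a = 0 -> h b = 0 ->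
  cintegral I (fun x => weak_derivative 2 u x * h x) = cintegral I (fun x => u x * cderive 2 h x).
Proof.
move=> s1 s2 sh ha hb; have sh' := csmooth_cderive 1 sh.
have [sq1 d1] := sobolev_weak_derivative ab s2 (isT : (1 <= 2)%N).
have [sq2 d2] := sobolev_weak_derivative ab s2 (leqnn 2).
have zero_test phi : test_function a b phi ->
    cintegral I (fun x => phi x * weak_derivative 2 u x) +
    cintegral I (fun x => cderive 1 phi x * weak_derivative 1 u x) = 0.
  move=> tphi; have := d2 _ tphi; have := d1 _ (test_cderive 1 ab tphi).
  rewrite sqrrN expr1n mul1r cderive1_cderive mulN1r => -> e2.
  rewrite (@cintegral_eq _ _ (fun x => phi x * _) (fun x => weak_derivative 2 u x * phi x)); last first.
    by move=> x _; rewrite mulrC.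
  rewrite (@cintegral_eq _ _ (fun x => cderive 1 phi x * _)
    (fun x => weak_derivative 1 u x * cderive 1 phi x)); last by move=> x _; rewrite mulrC.
  by rewrite -e2 addNr.
have z : cintegral I (fun x => h x * weak_derivative 2 u x) +
    cintegral I (fun x => cderive 1 h x * weak_derivative 1 u x) = 0.
  have l1 := square_integrable_L2on sq1; have l2 := square_integrable_L2on sq2.
  apply: (cintegral_small2 mI l2 l1) => e e0.
  have [phi [tphi n0 n1]] := test_functions_H1_approx E ab sh ha hb e0.
  have sphi := test_csmooth tphi; have sphi' := csmooth_cderive 1 sphi.
  have lh := L2on_csmooth a b sh; have lh' := L2on_csmooth a b sh'.
  have lp := L2on_csmooth a b sphi; have lp' := L2on_csmooth a b sphi'.
  exists (fun x => h x - phi x), (fun x => cderive 1 h x - cderive 1 phi x); split.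
  - by split; exact: L2onB.
  - exact: n0.
  - exact: n1.
  rewrite (@cintegral_eq _ _ (fun x => (h x - phi x) * _)
     (fun x => h x * weak_derivative 2 u x - phi x * weak_derivative 2 u x)); last by move=> x _; ring.
  rewrite (@cintegral_eq _ _ (fun x => (cderive 1 h x - _) * _)
     (fun x => cderive 1 h x * weak_derivative 1 u x - cderive 1 phi x * weak_derivative 1 u x));
    last by move=> x _; ring.
  rewrite (cintegralB mI (L2on_cintegrable mI lh l2) (L2on_cintegrable mI lp l2)).
  rewrite (cintegralB mI (L2on_cintegrable mI lh' l1) (L2on_cintegrable mI lp' l1)).
  by rewrite addrACA -opprD (zero_test phi tphi) subr0.
have g1 := sobolev0_green ab s1 (leqnn 1) sh'.
rewrite cderive1_cderive mulN1r in g1.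
rewrite (@cintegral_eq _ _ _ (fun x => h x * weak_derivative 2 u x)); last by move=> x _; rewrite mulrC.
apply/eqP; rewrite -subr_eq0 -[X in _ - X]opprK -g1 opprK; apply/eqP; rewrite -[RHS]z.
by congr (_ + _); apply: cintegral_eq => x _; rewrite mulrC.
Qed.

Lemma L2class_dirichlet h : csmooth h -> h a = 0 -> h b = 0 -> sobolev0 1 (L2class E h).
Proof.
move=> sh ha hb; split; first exact: L2class_sobolev.
(* A third because [lt_sobolev_norm] divides by k + 2, here with k = 1. *)
move=> e e0; have e30 : 0 < e ^+ 2 / 3 by rewrite divr_gt0// exprn_gt0.
have [phi [tphi n0 n1]] := test_functions_H1_approx E ab sh ha hb e30.
have sphi := test_csmooth tphi.
exists (L2class E phi); first exact: L2class_test.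
apply: (lt_sobolev_norm e0) => j j1.
have sB := csmoothB (csmooth_cderive j sh) (csmooth_cderive j sphi).
have -> : weak_derivative j (L2class E h - L2class E phi) = L2class E (fun x => cderive j h x - cderive j phi x).
  rewrite -(L2class_sub E (csmooth_cderive j sh) (csmooth_cderive j sphi)).
  apply: (weak_derivativeE ab); apply: (is_weak_derivativeB ab); exact: L2class_weak_derivative.
rewrite (sqL2norm_ae mI (L2loc_measurable _) (cmeasurable_csmooth mI sB) (L2class_smooth_ae E sB)).
case: j j1 {sB} => [_|[_|j]].
- by rewrite !cderive0; exact: n0.
- exact: n1.
- by move=> j1; exfalso; move: j1; rewrite ltnS ltn0.
Qed.

Lemma cderive2_comb f g s : csmooth f -> csmooth g ->
  cderive 2 (fun x => f x + s * g x) = fun x => cderive 2 f x + s * cderive 2 g x.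
Proof.
move=> sf sg.
have f1 := csmooth_is_cderive 0 sf; have g1 := csmooth_is_cderive 0 sg.
rewrite !cderive0 in f1 g1.
apply: (cderive2E (is_cderiveD f1 (is_cderiveZ s g1))).
exact: is_cderiveD (csmooth_is_cderive 1 sf) (is_cderiveZ s (csmooth_is_cderive 1 sg)).
Qed.

(* Twice [sinh (s * (x - a))]. *)
Definition sinh_sol s x := cexp s x * cexp (- s) a - cexp (- s) x * cexp s a.

Lemma is_cderive_sinh_sol s : is_cderive (sinh_sol s)
  (fun x => s * (cexp s x * cexp (- s) a + cexp (- s) x * cexp s a)).
Proof.
have := is_cderiveD (is_cderiveM (is_cderive_cexp s) (is_cderive_cst (cexp (- s) a)))
  (is_cderiveN (is_cderiveM (is_cderive_cexp (- s)) (is_cderive_cst (cexp s a)))).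
congr is_cderive; apply/funext => x; move: (cexp s x) (cexp s a) (cexp (- s) x) (cexp (- s) a).
by move=> p q r t; ring.
Qed.

Lemma csmooth_sinh_sol s : csmooth (sinh_sol s).
Proof.
exact: csmoothB (csmoothM (csmooth_cexp s) (csmooth_cst _))
  (csmoothM (csmooth_cexp (- s)) (csmooth_cst _)).
Qed.

Lemma cderive2_sinh_sol s : cderive 2 (sinh_sol s) = fun x => s * s * sinh_sol s x.
Proof.
apply: (cderive2E (is_cderive_sinh_sol s)).
have := is_cderiveZ s (is_cderiveD (is_cderiveM (is_cderive_cexp s) (is_cderive_cst (cexp (- s) a)))
  (is_cderiveM (is_cderive_cexp (- s)) (is_cderive_cst (cexp s a)))).
congr is_cderive; apply/funext => x; rewrite /sinh_sol.
move: (cexp s x) (cexp s a) (cexp (- s) x) (cexp (- s) a) => p q r t; ring.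
Qed.

Lemma sinh_sol_a s : sinh_sol s a = 0.
Proof. by rewrite /sinh_sol mulrC subrr. Qed.

(** Equal moduli of e^(s(b-a)) and e^(-s(b-a)) force Re s = 0; on the imaginary axis the solution is
    2i times a sine. *)
Lemma sinh_sol_b s : sinh_sol s b = 0 <->
  complex.Re s = 0 /\ sin (complex.Im s * (b - a)) = 0.
Proof.
case: s => p q /=.
have Eim : p = 0 -> sinh_sol (p +i* q) b = 0 +i* (2 * sin (q * (b - a))).
  move=> ->; rewrite mulrBr sinD sinN cosN /sinh_sol /cexp /=.
  rewrite oppr0 !mul0r expR0 !mulNr !cosN !sinN.
  by apply: complex_ext; rewrite !ReImE /=; ring.
split=> [h|[p0 sq]]; last first.
  by rewrite Eim// sq mulr0.
have p0 : p = 0.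
  have : sqnormc (cexp (p +i* q) b * cexp (- (p +i* q)) a) =
         sqnormc (cexp (- (p +i* q)) b * cexp (p +i* q) a).
    by congr sqnormc; apply/eqP; rewrite -subr_eq0; apply/eqP.
  rewrite (sqnormcZ (cexp (p +i* q) b)) (sqnormcZ (cexp (- (p +i* q)) b)) !sqnormc_cexp /= -!exprMn -!expRD => /eqP.
  rewrite eqrXn2 ?expR_ge0// => /eqP/expR_inj e.
  have : p * (b - a) = 0 by lra.
  by move/eqP; rewrite mulf_eq0 subr_eq0 (gt_eqF ab) orbF => /eqP.
split; first exact: p0.
by move: h; rewrite Eim// => -[] /eqP; rewrite mulf_eq0 pnatr_eq0 /= => /eqP.
Qed.

Lemma sin_root (y : R) : sin y = 0 -> exists n : nat, `|y| = pi * n%:R.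
Proof.
move=> sy; have sy' : sin `|y| = 0.
  by have [y0|y0] := leP 0 y; rewrite ?(ger0_norm y0)// (ltr0_norm y0) sinN sy oppr0.
have pi0 : 0 < pi :> R := pi_gt0 R.
(* The absolute value is reduced modulo pi: the remainder lies in [0, pi), where the sine vanishes
   only at 0. *)
pose n := Num.truncn (`|y| / pi).
have /andP[n1 n2] : n%:R <= `|y| / pi < n.+1%:R by apply: truncn_itv; rewrite divr_ge0// ltW.
exists n; pose r := `|y| - pi * n%:R.
have r0 : 0 <= r by rewrite subr_ge0 mulrC -ler_pdivlMr.
have r1 : r < pi.
  by move: n2; rewrite ltr_pdivrMr// -natr1 mulrDl mul1r /r; lra.
have : sin (r + pi * n%:R) = (-1) ^+ n * sin r.
  by rewrite mulr_natr (alternatingn (@sinDpi R)).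
rewrite /r subrK sy' => /esym/eqP.
rewrite mulf_eq0 signr_eq0 /= => sr.
apply/eqP; rewrite -subr_eq0 -/r; apply: contraLR sr => rn0.
have : 0 < sin r by apply: sin_gt0_pi; rewrite r1 andbT lt_neqAle eq_sym rn0 r0.
by move/gt_eqF ->.
Qed.

Lemma sin_pi_nat (n : nat) : sin (pi * n%:R : R) = 0.
Proof.
have : sin (0 + pi *+ n : R) = (-1) ^+ n * sin 0 by rewrite (alternatingn (@sinDpi R)).
by rewrite add0r sin0 mulr0 mulr_natr.
Qed.

Definition dirichlet_eigenvalues : set R[i] :=
  [set (- (pi ^+ 2 * n%:R ^+ 2 / (b - a) ^+ 2))%:C | n in [set n : nat | (1 <= n)%N]].

(** S starts from zero at a, so a zero at b would make it a Dirichlet eigenfunction; by [sinh_sol_b]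
    this puts [lam] among the excluded values. *)
Lemma fundamental_solution lam : ~ dirichlet_eigenvalues lam -> exists S,
  [/\ csmooth S, cderive 2 S = (fun x => lam * S x), S a = 0 & S b != 0].
Proof.
move=> nlam; have ba : b - a != 0 by rewrite subr_eq0 gt_eqF.
have [s ss] := eigenfunction_exists lam; have [s0|s0] := eqVneq s 0.
  (* For s = 0 the function [sinh_sol] vanishes identically; x - a takes its place. *)
  have D1 := is_cderiveD is_cderive_id (is_cderive_cst (- a%:C)).
  have D2 : is_cderive (fun=> 1 + 0 : R[i]) (fun=> 0) := is_cderive_cst _.
  exists (fun x => x%:C - a%:C); split.
  - exact: csmoothD csmooth_id (csmooth_cst (- a%:C)).
  - by rewrite (cderive2E D1 D2) -ss s0; apply/funext => x; rewrite !mul0r.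
  - by rewrite subrr.
  - by rewrite -rmorphB /= eq_complex /= eqxx andbT.
exists (sinh_sol s); split.
- exact: csmooth_sinh_sol.
- by rewrite cderive2_sinh_sol ss.
- exact: sinh_sol_a.
- apply/eqP => /sinh_sol_b[p0 /sin_root[n hn]]; apply: nlam; exists n.
    (* The root with n = 0 would mean s = 0, as b differs from a; hence n >= 1. *)
    rewrite /= lt0n; apply/eqP => n0; move: hn; rewrite n0 mulr0 => /eqP.
    rewrite normr_eq0 mulf_eq0 (negbTE ba) orbF => /eqP q0.
    by move/eqP: s0; apply; exact: complex_ext.
  have -> : pi ^+ 2 * n%:R ^+ 2 / (b - a) ^+ 2 = complex.Im s ^+ 2.
    rewrite -exprMn -hn real_normK ?num_real// exprMn mulfK// expf_neq0//.
  by rewrite -ss; apply: complex_ext; rewrite !ReImE /= p0 ?mul0r ?mulr0 ?addr0 // sub0r expr2.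
Qed.

(** The solution of the initial value problem at a is corrected by the multiple of S that cancels
    its value at b; [S b != 0] makes this possible. *)
Lemma dirichlet_bvp lam g : ~ dirichlet_eigenvalues lam -> test_function a b g ->
  exists h, [/\ csmooth h, h a = 0 /\ h b = 0 & cderive 2 h = (fun x => lam * h x + g x)].
Proof.
move=> nlam tg; have [S [sS S2 Sa Sb]] := fundamental_solution nlam.
have [c [d [ac cd db g0]]] := test_functionE ab tg.
have [|h [sh h0 h2]] := @linear_ode2 _ lam g a (test_csmooth tg).
  by move=> x xa; apply: g0; rewrite negb_and -ltNge (le_lt_trans xa ac).
pose r := - (h b / S b).
exists (fun x => h x + r * S x); split.
- exact: csmoothD sh (csmoothZ r sS).
- by rewrite h0// Sa mulr0 addr0 /r mulNr divfK// subrr.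
- by rewrite cderive2_comb// h2 S2; apply/funext => x; ring.
Qed.

Lemma dirichlet_injective lam : ~ dirichlet_eigenvalues lam ->
  op_injective (Defs.shift lam (laplacian_L2 E)).
Proof.
move=> nlam u v w [_ [p [p1 p2] <-] /= [<- ew]] [_ [q [q1 q2] <-] /= [<- ew']].
apply: (@eigenfunction_unique _ _ _ E ab (fun h => h a = 0 /\ h b = 0) p q lam p2 q2).
- by move=> h sh [ha hb]; exact: dirichlet_green.
- by move=> h sh [ha hb]; exact: dirichlet_green.
- by move=> g tg; exact: dirichlet_bvp.
- by rewrite ew ew'.
Qed.

(* The solution and its derivative have no common zero, as S' + s S is a
   nonzero multiple of an exponential. *)
Lemma sinh_sol_neq0 s : s != 0 -> L2class E (sinh_sol s) <> 0.
Proof.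
move=> s0 S0; have sS := csmooth_sinh_sol s.
have S0' : L2class E (cderive 1 (sinh_sol s)) = 0.
  by rewrite -(L2class_weak_derivativeE E ab 1 sS) S0 weak_derivative_zero.
apply: (@ae_notin_itv R (lo E 0) (hi E 0) (lo_lt_hi E 0)).
apply: ae_imply3 (L2class_smooth_ae E sS) (L2class_smooth_ae E (csmooth_cderive 1 sS)) (L2loc0_ae E).
move=> x; rewrite S0 S0' (is_cderiveE (is_cderive_sinh_sol s)) /sinh_sol => h1 h2 h3 Kx.
have Ix := exhaustion_segment_sub Kx; move: (h1 Ix) (h2 Ix); rewrite (h3 Ix).
have := cexp_neq0 s x; have := cexp_neq0 (- s) a.
move: (cexp s x) (cexp s a) (cexp (- s) x) (cexp (- s) a) => p q r t t0 p0 e1 e2.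
have : 2 * s * (p * t) = 0.
  transitivity (s * (p * t - r * q) + s * (p * t + r * q)); first by ring.
  by rewrite -e1 -e2 mulr0 addr0.
by apply/eqP; rewrite !mulf_neq0// pnatr_eq0.
Qed.

Lemma dirichlet_not_injective lam : dirichlet_eigenvalues lam ->
  ~ op_injective (Defs.shift lam (laplacian_L2 E)).
Proof.
move=> [n /= n1 <-]; set q : R := pi * n%:R / (b - a).
have ba : b - a != 0 by rewrite subr_eq0 gt_eqF.
(* The square root of the eigenvalue lies on the imaginary axis, and q (b - a) = n pi; the solution
   is a multiple of sin (q (x - a)). *)
pose s : R[i] := 0 +i* q.
have ss : (- (pi ^+ 2 * n%:R ^+ 2 / (b - a) ^+ 2))%:C = s * s.
  rewrite -exprMn -exprVn -exprMn -/q.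
  by apply: complex_ext; rewrite !ReImE /= ?mul0r ?mulr0 ?addr0 // sub0r expr2.
have s0 : s != 0.
  rewrite eq_complex /= eqxx /= /q !mulf_neq0 ?invr_neq0//.
    by rewrite gt_eqF// pi_gt0.
  by rewrite pnatr_eq0 -lt0n.
have sS := csmooth_sinh_sol s.
have Sb : sinh_sol s b = 0.
  by apply/sinh_sol_b; split => //=; rewrite /q divfK// sin_pi_nat.
have G0 : Defs.shift (s * s) (laplacian_L2 E) (0, 0).
  exists (0, 0); last by rewrite /= scaler0 subrr.
  have t0 := L2class_test E (test_function0 a b); rewrite L2class0 in t0.
  exists 0; last by rewrite weak_derivative_zero.
  by split; [exact: test_functions_sobolev0|exact: test_functions_sobolev].
rewrite ss => /(_ (L2class E (sinh_sol s)) 0 0) H; apply: (sinh_sol_neq0 s0); apply: H G0.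
exists (L2class E (sinh_sol s), weak_derivative 2 (L2class E (sinh_sol s))).
  exists (L2class E (sinh_sol s)) => //; split.
    by apply: L2class_dirichlet => //; exact: sinh_sol_a.
  exact: L2class_sobolev.
rewrite /= (L2class_weak_derivativeE E ab 2 sS) cderive2_sinh_sol L2class_scale// subrr.
by [].
Qed.

Lemma laplacian_extends : extends_test_laplacian (laplacian E).
Proof.
move=> phi tphi; exists (L2class E phi).
  exact: (test_functions_sobolev0 ab 2 (L2class_test E tphi)).
by rewrite (L2class_weak_derivativeE E ab 2 (test_csmooth tphi)).
Qed.

Lemma laplacian_L2_extends : extends_test_laplacian (laplacian_L2 E).
Proof.
move=> phi tphi; exists (L2class E phi).
  split; first exact: (test_functions_sobolev0 ab 1 (L2class_test E tphi)).
  exact: (@test_functions_sobolev _ _ _ E ab 2 _ (L2class_test E tphi)).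
by rewrite (L2class_weak_derivativeE E ab 2 (test_csmooth tphi)).
Qed.

Lemma laplacian_injective lam : op_injective (Defs.shift lam (laplacian E)).
Proof.
move=> u v w [_ [p p1 <-] /= [<- ew]] [_ [q q1 <-] /= [<- ew']].
by apply: (@sobolev0_eigenfunction_unique _ _ _ E ab p q lam p1 q1); rewrite ew ew'.
Qed.

End dirichlet_laplacian.

Theorem mainTheorem3 (R : realType) (a b : R) (E : exhaustion a b) :
  a < b ->
  [/\ continuous_spectrum (laplacian E) = [set: R[i]],
      residual_spectrum (laplacian_adjoint E) = [set: R[i]],
      point_spectrum (closure (laplacian E)) = [set: R[i]] &
      continuous_spectrum (laplacian_L2 E) =
        [set: R[i]] `\`
          [set (- (pi ^+ 2 * n%:R ^+ 2 / (b - a) ^+ 2))%:C | n in [set n : nat | (1 <= n)%N]]].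
Proof.
move=> ab; split.
- apply/seteqP; split=> // lam _; split.
  + exact: (@laplacian_injective _ _ _ E ab lam).
  + exact: (dense_range ab lam (laplacian_extends E ab)).
  + exact: (inverse_discontinuous ab (laplacian_extends E ab)).
- apply/seteqP; split=> // lam _; split.
  + exact: (@adjoint_injective _ _ _ E ab lam).
  + exact: (@adjoint_range_not_dense _ _ _ E ab lam).
- exact: (point_spectrum_closure ab (laplacian_extends E ab)).
- apply/seteqP; split=> lam.
  + move=> [inj _ _]; split=> // nlam.
    exact: (@dirichlet_not_injective _ _ _ E ab lam nlam inj).
  + move=> [_ nlam]; split.
    * exact: (@dirichlet_injective _ _ _ E ab lam nlam).
    * exact: (dense_range ab lam (laplacian_L2_extends E ab)).
    * exact: (inverse_discontinuous ab (laplacian_L2_extends E ab)).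
Qed.
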